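(* Let $A\in SL(d,\mathbb Z)$ be a hyperbolic matrix, and let $f_A:\mathbb T^d\to\mathbb T^d$ be the induced automorphism. Assume that $A$ has only two different eigenvalues $\lambda_s,\lambda_u$, with $0<|\lambda_s|<1<|\lambda_u|$, and let $d_s$ be the multiplicity of $\lambda_s$. For each $j\ge1$ let $\varphi_j:\mathbb N\to(0,1]$ and $\mathcal Z_j=\{z_j^i\}_{i=0}^\infty\subset\mathbb T^d$. Put $\underline\tau:=\sup_{j\ge1}\liminf_{n\to\infty}-\frac{\ln\varphi_j(n)}{n}$. (1) If $\underline\tau<-\ln|\lambda_s|$, then $\bigcap_{j=1}^\infty\mathfrak S(f_A,\varphi_j,\mathcal Z_j,\mathbb N)$ is non-empty and $$h_{top}\Big(f_A,\bigcap_{j=1}^\infty\mathfrak S(f_A,\varphi_j,\mathcal Z_j,\mathbb N)\Big)=d_s\frac{\ln|\lambda_s|^{-1}\ln|\lambda_u|-\underline\tau\ln|\lambda_u|}{\ln|\lambda_u|+\underline\tau},$$ $$\dim_H\bigcap_{j=1}^\infty\mathfrak S(f_A,\varphi_j,\mathcal Z_j,\mathbb N)=d_s\frac{\ln|\lambda_s|^{-1}+\ln|\lambda_u|}{\ln|\lambda_u|+\underline\tau}.$$ (2) If $\underline\tau=-\ln|\lambda_s|$, then $h_{top}(f_A,\bigcap_{j=1}^\infty\mathfrak S(f_A,\varphi_j,\mathcal Z_j,\mathbb N))=0$ and $\dim_H\bigcap_{j=1}^\infty\mathfrak S(f_A,\varphi_j,\mathcal Z_j,\mathbb N)\le d_s$.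 (3) If $\underline\tau>-\ln|\lambda_s|$, then $h_{top}(f_A,\bigcap_{j=1}^\infty\mathfrak S(f_A,\varphi_j,\mathcal Z_j,\mathbb N))=0$ and $\dim_H\bigcap_{j=1}^\infty\mathfrak S(f_A,\varphi_j,\mathcal Z_j,\mathbb N)=0$.
   Context: $\mathbb N$ is the set of non-negative integers. $\mathbb T^d=\mathbb R^d/\mathbb Z^d$ with its standard (flat) metric, and $f_A(x)=Ax \bmod 1$. $A$ is hyperbolic if it has no eigenvalues on the unit circle. Multiplicity means algebraic multiplicity. Shrinking target set: for $X=\mathbb T^d$, $f=f_A$, $\mathfrak S(f,\varphi,\mathcal Z,\mathbb N):=\{x\in X: d(f^n(x),z_n)<\varphi(n)\text{ for infinitely many }n\in\mathbb N\}$; for $\mathcal Z_j=\{z_j^i\}_{i\ge0}$ the centre at time $n$ is $z_j^n$. Bowen topological entropy of a subset $Z\subseteq X$: let $B_n(x,\varepsilon,f)=\{y: d(f^i(x),f^i(y))<\varepsilon,\ 0\le i\le n-1\}$. For $s\ge0$, $M\ge 1$, $\varepsilon>0$ let $\mathcal M^s_{M,\varepsilon}(Z)=\inf\sum_i e^{-sn_i}$ over finite or countable families $\{B_{n_i}(x_i,\varepsilon,f)\}$ covering $Z$ with $x_i\in X$, $n_i\ge M$; $\mathcal M^s_\varepsilon(Z)=\lim_{M\to\infty}\mathcal M^s_{M,\varepsilon}(Z)$; $h_{top}(f,Z,\varepsilon)=\inf\{s:\mathcal M^s_\varepsilon(Z)=0\}$; $h_{top}(f,Z)=\lim_{\varepsilon\to0}h_{top}(f,Z,\varepsilon)$.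 $\dim_H$ is Hausdorff dimension. *)

(* Defs.v *)
From HB Require Import structures.
From mathcomp Require Import all_boot all_order all_algebra.
From mathcomp Require Import generic_quotient complex.
From mathcomp Require Import all_classical all_reals all_analysis.
From mathcomp Require Import ring lra.

Set Implicit Arguments.
Unset Strict Implicit.
Unset Printing Implicit Defensive.

Import Order.TTheory GRing.Theory Num.Theory.
Import numFieldNormedType.Exports.

Local Open Scope classical_set_scope.
Local Open Scope ring_scope.

Section euclidean_norm.
Context {R : realType} {d : nat}.
Implicit Types u v : 'cV[R]_d.

Definition enorm u : R := Num.sqrt (\sum_i u i 0 ^+ 2).

Lemma enorm_ge0 u : 0 <= enorm u.
Proof. exact: sqrtr_ge0. Qed.

Lemma enorm_sq u : enorm u ^+ 2 = \sum_i u i 0 ^+ 2.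
Proof. by rewrite sqr_sqrtr// sumr_ge0// => i _; exact: sqr_ge0. Qed.

Lemma enorm0 : enorm 0 = 0.
Proof.
by rewrite /enorm big1 ?sqrtr0// => i _; rewrite mxE expr0n.
Qed.

Lemma enormN u : enorm (- u) = enorm u.
Proof. by rewrite /enorm; under eq_bigr do rewrite mxE sqrrN. Qed.

Lemma ler_coord_enorm u i : `|u i 0| <= enorm u.
Proof.
rewrite -sqrtr_sqr ler_wsqrtr// (bigD1 i)//= lerDl sumr_ge0// => j _.
exact: sqr_ge0.
Qed.

Lemma ler_dot_enorm u v : \sum_i u i 0 * v i 0 <= enorm u * enorm v.
Proof.
have [a0|a0] := eqVneq (enorm u) 0.
  rewrite a0 mul0r big1// => i _.
  have := ler_coord_enorm u i; rewrite a0 normr_le0 => /eqP ->.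
  by rewrite mul0r.
have [b0|b0] := eqVneq (enorm v) 0.
  rewrite b0 mulr0 big1// => i _.
  have := ler_coord_enorm v i; rewrite b0 normr_le0 => /eqP ->.
  by rewrite mulr0.
have ab : 0 < enorm u * enorm v by rewrite mulr_gt0// lt_def enorm_ge0 ?a0 ?b0.
have : 0 <= \sum_i (u i 0 * enorm v - v i 0 * enorm u) ^+ 2.
  by apply: sumr_ge0 => i _; exact: sqr_ge0.
under eq_bigr do rewrite sqrrB !exprMn.
rewrite big_split/= sumrB -!mulr_suml -!enorm_sq.
have -> : \sum_i (u i 0 * enorm v * (v i 0 * enorm u)) *+ 2 =
   (\sum_i u i 0 * v i 0) * (enorm u * enorm v) *+ 2.
  by rewrite sumrMnl mulr_suml; congr (_ *+ 2); apply: eq_bigr => i _; ring.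
move=> h; rewrite -(ler_pM2r ab); nra.
Qed.

Lemma ler_enormD u v : enorm (u + v) <= enorm u + enorm v.
Proof.
rewrite -ler_sqr ?nnegrE ?addr_ge0 ?enorm_ge0// enorm_sq.
under eq_bigr do rewrite mxE sqrrD.
rewrite 2!big_split -!enorm_sq sqrrD lerD2r lerD2l sumrMnl lerMn2r.
exact: ler_dot_enorm.
Qed.

End euclidean_norm.

Section torus.
Context {R : realType} {d : nat}.
Implicit Types u v w : 'cV[R]_d.

Definition int_equiv : rel 'cV[R]_d :=
  fun u v => [forall i, u i 0 - v i 0 \is a Num.int].

Lemma int_equivP u v :
  reflect (forall i, u i 0 - v i 0 \is a Num.int) (int_equiv u v).
Proof. exact: forallP. Qed.

Lemma int_equiv_refl : reflexive int_equiv.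
Proof. by move=> u; apply/int_equivP => i; rewrite subrr rpred0. Qed.

Lemma int_equiv_sym : symmetric int_equiv.
Proof.
by move=> u v; apply/int_equivP/int_equivP => h i; rewrite -opprB rpredN.
Qed.

Lemma int_equiv_trans : transitive int_equiv.
Proof.
move=> v u w /int_equivP uv /int_equivP vw; apply/int_equivP => i.
by rewrite -(subrKA (v i 0)) rpredD.
Qed.

Canonical int_equiv_rel :=
  EquivRel int_equiv int_equiv_refl int_equiv_sym int_equiv_trans.

End torus.

Definition torus (R : realType) (d : nat) := {eq_quot (@int_equiv R d)}%qT.

Section torus_metric.
Context {R : realType} {d : nat}.
Implicit Types p q r : torus R d.
Implicit Types u v w : 'cV[R]_d.

HB.instance Definition _ := Choice.on (torus R d).
HB.instance Definition _ := EqQuotient.on (torus R d).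

Definition torus_pi (u : 'cV[R]_d) : torus R d := (\pi_(torus R d) u)%qT.
Definition torus_repr (p : torus R d) : 'cV[R]_d := repr p.

Lemma torus_reprK p : torus_pi (torus_repr p) = p.
Proof. exact: reprK. Qed.

Lemma torus_piP u v : torus_pi u = torus_pi v <-> int_equiv u v.
Proof. by split=> [/eqmodP|h]; last exact/eqmodP. Qed.

(* The flat metric is the quotient metric: the infimum of the Euclidean
   distances between the lifts of the two points. *)
Definition torus_dists p q : set R :=
  [set enorm (w.1 - w.2) | w in [set w | torus_pi w.1 = p /\ torus_pi w.2 = q]].

Definition torus_dist p q : R := inf (torus_dists p q).

Lemma torus_dist_le u v : torus_dist (torus_pi u) (torus_pi v) <= enorm (u - v).
Proof.
apply: ge_inf; last by exists (u, v).
by exists 0 => _ [w _ <-]; exact: enorm_ge0.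
Qed.

Lemma torus_dists_neq0 p q : torus_dists p q !=set0.
Proof.
exists (enorm (torus_repr p - torus_repr q)).
by exists (torus_repr p, torus_repr q) => //=; rewrite !torus_reprK.
Qed.

Lemma torus_dist_lt p q e : torus_dist p q < e ->
  exists u v, [/\ torus_pi u = p, torus_pi v = q & enorm (u - v) < e].
Proof.
move=> /(inf_lt (torus_dists_neq0 p q))[_ [[u v]/= [<- <-] <-] uve].
by exists u, v.
Qed.

Lemma torus_dist_ge0 p q : 0 <= torus_dist p q.
Proof.
apply: lb_le_inf; first exact: torus_dists_neq0.
by move=> _ [w _ <-]; exact: enorm_ge0.
Qed.

Lemma torus_distxx p : torus_dist p p = 0.
Proof.
apply/eqP; rewrite eq_le torus_dist_ge0 andbT -(torus_reprK p).
by rewrite (le_trans (torus_dist_le _ _))// subrr enorm0.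
Qed.

Lemma torus_dist_sym p q : torus_dist p q = torus_dist q p.
Proof.
rewrite /torus_dist; congr inf; apply/seteqP; split=> _ [[u v] /= [pu qv] <-];
  by exists (v, u) => //=; rewrite -enormN opprB.
Qed.

Lemma torus_dist_triangle q p r :
  torus_dist p r <= torus_dist p q + torus_dist q r.
Proof.
apply/ler_addgt0Pl => e e0.
have e20 : 0 < e / 2 by rewrite divr_gt0.
have : torus_dist p q < torus_dist p q + e / 2 by rewrite ltrDl.
move=> /torus_dist_lt[u [v [up vq uv]]].
have : torus_dist q r < torus_dist q r + e / 2 by rewrite ltrDl.
move=> /torus_dist_lt[v' [w [vq' wr vw]]].
have -> : torus_dist p r = torus_dist p (torus_pi (w + (v - v'))).
  congr torus_dist.
  rewrite -wr; apply/torus_piP/int_equivP => i; rewrite !mxE opprD addNKr.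
  have : int_equiv v' v by apply/torus_piP; rewrite vq vq'.
  by move=> /int_equivP/(_ i); rewrite opprB.
rewrite -[X in torus_dist X (torus_pi _)]up.
rewrite (le_trans (torus_dist_le _ _))//.
have -> : u - (w + (v - v')) = (u - v) + (v' - w).
  by apply/matrixP => i j; rewrite !mxE; ring.
by rewrite (le_trans (ler_enormD _ _))//; lra.
Qed.

Lemma torus_dist_eq0 p q : torus_dist p q = 0 -> p = q.
Proof.
move=> pq0; rewrite -(torus_reprK p) -(torus_reprK q).
apply/torus_piP/int_equivP => i.
set t := _ - _; apply/negPn/negP => tZ.
have t1 : (Num.floor t)%:~R < t.
  rewrite lt_neqAle floor_le andbT; apply: contra tZ => /eqP <-.
  exact: intr_int.
have t2 : t < (Num.floor t + 1)%:~R by exact: floorD1_gt.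
pose e := Num.min (t - (Num.floor t)%:~R) ((Num.floor t + 1)%:~R - t).
have e0 : 0 < e by rewrite lt_min !subr_gt0 t1.
have : torus_dist p q < e by rewrite pq0.
move=> /torus_dist_lt[u [v [up vq uve]]].
have : (u - v) i 0 - t \is a Num.int.
  have /int_equivP/(_ i) : int_equiv u (torus_repr p).
    by apply/torus_piP; rewrite torus_reprK.
  have /int_equivP/(_ i) : int_equiv v (torus_repr q).
    by apply/torus_piP; rewrite torus_reprK.
  move=> hv hu; have -> : (u - v) i 0 - t =
      (u i 0 - torus_repr p i 0) - (v i 0 - torus_repr q i 0).
    by rewrite !mxE /t; ring.
  exact: rpredB.
move=> /intrP[m mE].
have := le_lt_trans (ler_coord_enorm _ i) uve.
rewrite lt_min => /andP[]; have -> : (u - v) i 0 = t + m%:~R.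
  by rewrite -mE subrKC.
have [m0|m0] := leP (Num.floor t + m + 1) 0.
  have : (Num.floor t + m + 1)%:~R <= 0 :> R by rewrite lerz0.
  move: t1 t2; rewrite !intrD => t1 t2 m1.
  by rewrite !ltr_norml => /andP[? _] /andP[? _]; lra.
have : 0 <= (Num.floor t + m)%:~R :> R by rewrite ler0z -ltzD1.
move: t1 t2; rewrite !intrD => t1 t2 m1.
by rewrite !ltr_norml => /andP[_ ?] /andP[_ ?]; lra.
Qed.

HB.instance Definition _ := isMetric.Build R (torus R d)
  torus_distxx torus_dist_eq0 torus_dist_sym torus_dist_triangle.

End torus_metric.

Section torus_automorphism.
Context {R : realType} {d : nat}.

(* Any lift of p gives the same point; see torus_map_pi. *)
Definition torus_map (A : 'M[int]_d) (p : torus R d) : torus R d :=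
  torus_pi (map_mx intr A *m torus_repr p).

Lemma torus_map_pi (A : 'M[int]_d) (u : 'cV[R]_d) :
  torus_map A (torus_pi u) = torus_pi (map_mx intr A *m u).
Proof.
apply/torus_piP/int_equivP => i.
have : int_equiv (torus_repr (torus_pi u)) u.
  by apply/torus_piP; rewrite torus_reprK.
move=> /int_equivP h; rewrite !mxE -sumrB rpred_sum// => j _.
by rewrite mxE -mulrBr rpredM// intr_int.
Qed.

End torus_automorphism.

Section shrinking_target.
Context {R : realType} {X : metricType R}.

Definition shrinking_target (f : X -> X) (phi : nat -> R) (z : nat -> X) :
    set X :=
  [set x | infinite_set [set n | mdist (iter n f x) (z n) < phi n]].

End shrinking_target.

Section bowen_entropy.
Context {R : realType} {X : metricType R}.
Implicit Types (f : X -> X) (Z : set X) (s e : R) (M : nat).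
Local Open Scope ereal_scope.

Definition bowen_ball f (n : nat) (x : X) e : set X :=
  [set y | forall i, (i < n)%N -> (mdist (iter i f x) (iter i f y) < e)%R].

(* A finite or countable family is indexed by a subset I of nat. *)
Definition bowen_sums f Z s e M : set (\bar R) :=
  [set v | exists (I : set nat) (x : nat -> X) (n : nat -> nat),
    [/\ (forall i, I i -> (M <= n i)%N),
        Z `<=` \bigcup_(i in I) bowen_ball f (n i) (x i) e
      & v = \esum_(i in I) (expR (- s * (n i)%:R))%:E]].

Definition bowen_premeasure f Z s e M : \bar R :=
  ereal_inf (bowen_sums f Z s e M).

Definition bowen_measure f Z s e : \bar R :=
  limn (bowen_premeasure f Z s e).

Definition htop_scale f Z e : \bar R :=
  ereal_inf [set s%:E | s in [set s : R | (0 <= s)%R /\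
                                          bowen_measure f Z s e = 0]].

Definition htop f Z : \bar R :=
  lim (htop_scale f Z e @[e --> (0:R)^'+]).

End bowen_entropy.

Section hausdorff_dimension.
Context {R : realType} {X : metricType R}.
Implicit Types (E U : set X) (s delta : R).
Local Open Scope ereal_scope.

(* The maximum with 0 gives diam set0 = 0, since ereal_sup set0 = -oo. *)
Definition diam U : \bar R :=
  maxe 0 (ereal_sup [set (mdist p.1 p.2)%:E | p in U `*` U]).

(* poweR 0 0 = 1, so that the case s = 0 is the counting measure. *)
Definition hausdorff_sums E s delta : set (\bar R) :=
  [set v | exists (I : set nat) (U : nat -> set X),
    [/\ (forall i, I i -> diam (U i) <= delta%:E),
        E `<=` \bigcup_(i in I) U i
      & v = \esum_(i in I) poweR (diam (U i)) s]].

Definition hausdorff_premeasure E s delta : \bar R :=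
  ereal_inf (hausdorff_sums E s delta).

Definition hausdorff_measure E s : \bar R :=
  lim (hausdorff_premeasure E s delta @[delta --> (0:R)^'+]).

Definition hausdorff_dim E : \bar R :=
  ereal_inf [set s%:E | s in [set s : R | (0 <= s)%R /\
                                          hausdorff_measure E s = 0]].

End hausdorff_dimension.

Section matrix_spectrum.
Context {R : realType} {d : nat}.

(* The complex matrix of A; complex moduli are taken in R, through normc. *)
Definition complex_mx (A : 'M[int]_d) : 'M[R[i]]_d := map_mx intr A.

Definition hyperbolic_mx (A : 'M[int]_d) : Prop :=
  forall mu : R[i], eigenvalue (complex_mx A) mu -> Normc.normc mu != 1.

Definition alg_multiplicity (A : 'M[int]_d) (mu : R[i]) : nat :=
  mup mu (char_poly (complex_mx A)).

End matrix_spectrum.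

Arguments hyperbolic_mx R {d} A.

(* The term n = 0, where the quotient is 0, does not affect the limit inferior. *)
Definition tau_inf {R : realType} (phi : nat -> nat -> R) : \bar R :=
  ereal_sup [set limn_einf (fun n => (- (ln (phi j n) / n%:R))%:E)
            | j in [set j | (1 <= j)%N]].

(* Main.v *)
(** The determinant and integrality of the traces [\tr (A ^+ n)] force the two
    eigenvalues to be real, of equal multiplicity [k], with moduli [e^-L] and
    [e^L]; the space splits into a stable and an unstable subspace of dimension
    [k] on which the iterates of [A] grow at these rates up to a factor
    [e^(delta n)].

    Below, [t] is a real number close to [tau].

    Upper bounds: [A^-n B(z_n, e^(-tn))] is a strip of unstable width about
    [e^(-(L+t)n)] and stable width about [e^((L-t)n)]; cutting the stable
    directions into cubes gives economical covers, and it suffices to use one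
    index [j] whose liminf is close to [tau].

    Lower bounds: since the unit cube tiles the space, any point can be moved
    along its unstable leaf, by a vector of size [O(e^(-Lg))], so that from time
    [g] on it shadows a prescribed orbit. Taking [g] about [(1 - t/L) n] forces a
    hit of the target at time [n]; before [g] the unstable coordinate is free.
    This yields, in every unstable leaf, a Cantor set of dimension
    [k(L-t)/(L+t)] contained in the intersection, which is the exponent governing
    the entropy. A Fubini argument over the [k] stable coordinates adds [k] to
    the Hausdorff dimension. *)
Require Import Defs.
From HB Require Import structures.
From mathcomp Require Import all_boot all_order all_algebra.
From mathcomp Require Import generic_quotient complex.
From mathcomp Require Import all_classical all_reals all_analysis.
From mathcomp Require Import measurable_realfun.
From mathcomp Require Import ring lra zify.

Set Implicit Arguments.
Unset Strict Implicit.
Unset Printing Implicit Defensive.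

Import Order.TTheory GRing.Theory Num.Theory.
Import numFieldNormedType.Exports.

Local Open Scope classical_set_scope.
Local Open Scope ring_scope.

(** * Euclidean norm and growth of matrix powers *)

(** Nothing guarantees that [A] is diagonalizable, so every growth estimate loses a factor e^(delta
    n). The estimates are therefore proved under strict inequalities between exponents, whose slack
    absorbs [delta]; the exact values appear only as infima over exponents. No measure is put on the
    Cantor sets. Their size is expressed as a lower bound for weighted sums over arbitrary covers,
    with a constant [K] independent of the stable coordinate [y]. This one inequality yields
    non-emptiness (empty cover), entropy (slice [y = 0]) and, integrated over [y], the Hausdorff
    dimension; the integrands are indicators of intervals, so no question of measurability of slices
    arises. Entropy is [L] times the dimension inside a leaf, because a Bowen ball of length n cuts
    an unstable leaf in a set of size about e^(-Ln). *)

Section enorm_theory.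
Context {R : realType}.

Lemma enormZ n (a : R) (u : 'cV[R]_n) : enorm (a *: u) = `|a| * enorm u.
Proof.
rewrite /enorm -sqrtr_sqr -sqrtrM ?sqr_ge0// mulr_sumr.
by under eq_bigr do rewrite mxE exprMn.
Qed.

Lemma ler_enormB n (u v : 'cV[R]_n) : enorm (u - v) <= enorm u + enorm v.
Proof. by rewrite (le_trans (ler_enormD _ _))// enormN. Qed.

Lemma ler_enorm_sum n (I : finType) (F : I -> 'cV[R]_n) :
  enorm (\sum_i F i) <= \sum_i enorm (F i).
Proof.
elim/big_rec2: _ => [|i y x _ h]; first by rewrite enorm0.
by rewrite (le_trans (ler_enormD _ _))// lerD2l.
Qed.

Lemma enorm_delta n (i : 'I_n) : enorm (delta_mx i 0 : 'cV[R]_n) = 1.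
Proof.
rewrite /enorm (bigD1 i)//= mxE !eqxx/= expr1n big1 ?addr0 ?sqrtr1// => j ji.
by rewrite mxE (negbTE ji) expr0n.
Qed.

Lemma ler_enorm_coord n (u : 'cV[R]_n) r : (forall i, `|u i 0| <= r) ->
  enorm u <= n%:R * r.
Proof.
move=> ur; have -> : u = \sum_i u i 0 *: delta_mx i 0.
  apply/matrixP => i j; rewrite ord1 summxE (bigD1 i)//= !mxE !eqxx mulr1.
  by rewrite big1 ?addr0// => l li; rewrite !mxE eq_sym (negbTE li) mulr0.
rewrite (le_trans (ler_enorm_sum _))//.
have -> : n%:R * r = \sum_(i < n) r by rewrite sumr_const card_ord mulr_natl.
by apply: ler_sum => i _; rewrite enormZ enorm_delta mulr1.
Qed.

Lemma enorm_mulmx_bound m n (B : 'M[R]_(m, n)) :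
  exists2 C : R, 0 < C & forall v : 'cV[R]_n, enorm (B *m v) <= C * enorm v.
Proof.
exists (m%:R * \sum_i \sum_j `|B i j| + 1).
  by rewrite ltr_wpDl// mulr_ge0// sumr_ge0// => i _; exact: sumr_ge0.
move=> v; apply: (@le_trans _ _ (m%:R * ((\sum_i \sum_j `|B i j|) * enorm v))).
  apply: ler_enorm_coord => i; rewrite mxE (le_trans (ler_norm_sum _ _ _))//.
  rewrite (bigD1 i)//= mulrDl mulr_suml.
  rewrite ler_wpDr ?mulr_ge0 ?enorm_ge0 ?sumr_ge0//.
    by move=> *; exact: sumr_ge0.
  by apply: ler_sum => j _; rewrite normrM ler_wpM2l// ler_coord_enorm.
by rewrite mulrDl mulrA mul1r lerDl enorm_ge0.
Qed.

(* The orbit [y_i = M^i D v] solves [y_(i+1) = x y_i + M^i (M - x) D v], so an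
   induction on [k] replaces any discussion of Jordan blocks. *)
Lemma mulmx_exp_growth n k (M : 'M[R]_n) (x rho : R) :
  `|x| < rho -> forall D : 'M[R]_n, (M - x%:M) ^+ k *m D = 0 ->
  exists2 C : R, 0 < C &
    forall i (v : 'cV[R]_n), enorm (M ^+ i *m (D *m v)) <= C * rho ^+ i * enorm v.
Proof.
move=> xrho; have rho0 : 0 < rho by rewrite (le_lt_trans _ xrho).
elim: k => [|k IH] D.
  rewrite expr0 mul1mx => ->; exists 1 => // i v.
  by rewrite !mul0mx mulmx0 enorm0 !mulr_ge0 ?enorm_ge0// exprn_ge0// ltW.
rewrite exprSr -mulmxE -mulmxA => /IH [C1 C10 h1].
have [C2 C20 h2] := enorm_mulmx_bound D.
have gap : 0 < rho - `|x| by rewrite subr_gt0.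
pose C := C1 / (rho - `|x|) + C2.
have C0 : 0 < C by rewrite addr_gt0// divr_gt0.
exists C => //; elim=> [|i IHi] v.
  rewrite expr0 mul1mx expr0 mulr1 (le_trans (h2 v))// ler_wpM2r ?enorm_ge0//.
  by rewrite lerDr ltW// divr_gt0.
have -> : M ^+ i.+1 *m (D *m v) =
    x *: (M ^+ i *m (D *m v)) + M ^+ i *m (((M - x%:M) *m D) *m v).
  rewrite exprSr -mulmxE -!mulmxA scalemxAr -mulmxDr; congr (_ *m _).
  by rewrite mulmxBl mul_scalar_mx addrC subrK.
rewrite (le_trans (ler_enormD _ _))// enormZ.
apply: (@le_trans _ _ (`|x| * (C * rho ^+ i * enorm v) +
                       C1 * rho ^+ i * enorm v)).
  by rewrite lerD// ler_wpM2l.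
rewrite exprSr !mulrA -!mulrDl ler_wpM2r ?enorm_ge0//.
rewrite [leRHS]mulrAC ler_wpM2r ?exprn_ge0 ?(ltW rho0)//.
have : C1 <= C * (rho - `|x|).
  by rewrite mulrDl divfK ?gt_eqF// lerDl mulr_ge0 ?(ltW C20) ?ltW.
by lra.
Qed.

End enorm_theory.

(** * Spectral splitting *)

Section spectral_splitting.
Context {R : realType}.

(** With [u p + v q = 1] a Bezout relation between the coprime factors, [P] is [v q] evaluated at
    [M], and Cayley-Hamilton annihilates every multiple of [p q]. The rank of [P] is left open; it
    is recovered later from traces. *)
Lemma spectral_projection n (M : 'M[R]_n.+1) x y a b : x != y ->
  char_poly M = ('X - x%:P) ^+ a * ('X - y%:P) ^+ b ->
  exists P : 'M[R]_n.+1, [/\ P *m P = P, P *m M = M *m P,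
    (M - x%:M) ^+ a *m P = 0 & (M - y%:M) ^+ b *m (1%:M - P) = 0].
Proof.
move=> xy Mxy; set p := _ ^+ a in Mxy; set q := _ ^+ b in Mxy.
have pq : coprimep p q.
  by rewrite coprimep_expl// coprimep_expr// coprimep_XsubC2// subr_eq0 eq_sym.
have [[u v] /= uv] := Bezout_eq1_coprimepP _ _ pq.
have MX z k : (M - z%:M) ^+ k = horner_mx M (('X - z%:P) ^+ k).
  by rewrite rmorphXn rmorphB/= horner_mx_X horner_mx_C.
have pq0 z : horner_mx M (z * (p * q)) = 0.
  by rewrite rmorphM/= -Mxy Cayley_Hamilton mulr0.
have E1 : 1%:M - horner_mx M (v * q) = horner_mx M (u * p).
  by rewrite -[1%:M](rmorph1 (horner_mx M)) -uv rmorphD/= addrK.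
exists (horner_mx M (v * q)); split.
- have e : v * q * (v * q) = v * q - u * v * (p * q).
    by rewrite -[in RHS](mul1r (v * q)) -uv; ring.
  by rewrite mulmxE -rmorphM e rmorphB/= pq0 subr0.
- exact: comm_horner_mx.
- rewrite MX -/p mulmxE -rmorphM/= (_ : p * _ = v * (p * q)); last by ring.
  exact: pq0.
- rewrite E1 MX -/q mulmxE -rmorphM/= (_ : q * _ = u * (p * q)); last by ring.
  exact: pq0.
Qed.

(** Full-rank factors can be cancelled on both sides of [B C B C = B C]. The columns of [B] form a
    basis of the range of [P], and [C M B] is the matrix on it of any [M] commuting with [P]. *)
Lemma idempotent_factor n (P : 'M[R]_n) : P *m P = P ->
  exists r (B : 'M[R]_(n, r)) (C : 'M[R]_(r, n)), B *m C = P /\ C *m B = 1%:M.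
Proof.
move=> PP; have := mulmx_base P; have := col_base_full P; have := row_base_free P.
move: (col_base P) (row_base P) => B C Cfree Bfull BC.
exists (\rank P), B, C; split=> //.
apply: (row_full_inj Bfull); apply: (row_free_inj Cfree).
by rewrite mulmx1 !mulmxA BC -mulmxA BC PP.
Qed.

(** Over the complex numbers the characteristic polynomial splits, an eigenvector turns [N ^+ k = 0]
    into [z ^+ k = 0] for each root, and the trace is read off the subleading coefficient. *)
Lemma mxtrace_nilpotent n (N : 'M[R]_n) k : N ^+ k = 0 -> \tr N = 0.
Proof.
case: n N => [|n] N Nk; first by rewrite /mxtrace big_ord0.
pose N' : 'M[R[i]]_n.+1 := map_mx (real_complex R) N.
have N'k : N' ^+ k = 0 by rewrite -[LHS](rmorphXn (map_mx (real_complex R))) Nk rmorph0.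
have [rs rsE] := closed_field_poly_normal (char_poly N').
rewrite (monicP (char_poly_monic _)) scale1r in rsE.
have rs0 z : z \in rs -> z = 0.
  move=> zrs; have : eigenvalue N' z.
    by rewrite eigenvalue_root_char rsE root_prod_XsubC.
  move=> /eigenvalueP[v vN' v0].
  have vN'i i : v *m N' ^+ i = z ^+ i *: v.
    elim: i => [|i IH]; first by rewrite !expr0 mulmx1 scale1r.
    by rewrite exprSr -mulmxE mulmxA IH -scalemxAl vN' scalerA exprSr.
  have := vN'i k; rewrite N'k mulmx0 => /esym/eqP.
  by rewrite scaler_eq0 (negbTE v0) orbF expf_eq0 => /andP[_ /eqP].
have sz : size rs = n.+1.
  by have := size_char_poly N'; rewrite rsE size_prod_XsubC => -[].
have : (char_poly N')`_n = - \tr N' by rewrite -char_poly_trace.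
have -> : (char_poly N')`_n = - \sum_(z <- rs) z.
  by rewrite rsE (_ : n = (size rs).-1) ?coefPn_prod_XsubC ?sz.
move=> /oppr_inj; rewrite big_seq big1// => tr0; apply: (fmorph_inj (real_complex R)).
by rewrite rmorph0 tr0 trace_map_mx.
Qed.

(** [T = C M B] represents [M] on the range of [P] and is [x] plus a nilpotent matrix;
    [T ^+ i - x ^+ i] has the commuting factor [T - x], so it is nilpotent and has trace zero. *)
Lemma mxtrace_unipotent_exp n (M P : 'M[R]_n) r (B : 'M[R]_(n, r))
    (C : 'M[R]_(r, n)) x a i :
  B *m C = P -> C *m B = 1%:M -> P *m M = M *m P ->
  (M - x%:M) ^+ a *m P = 0 -> \tr (M ^+ i *m P) = r%:R * x ^+ i.
Proof.
move=> BC CB PM MP0.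
have PMi j : P *m M ^+ j = M ^+ j *m P.
  elim: j => [|j IH]; first by rewrite expr0 mulmx1 mul1mx.
  by rewrite exprSr -mulmxE mulmxA IH -!mulmxA PM.
have BP : P *m B = B by rewrite -BC -mulmxA CB mulmx1.
have PC : C *m P = C by rewrite -BC mulmxA CB mul1mx.
pose T := C *m M *m B.
have CMB (X Y : 'M[R]_n) : P *m Y = Y *m P ->
    (C *m X *m B) *m (C *m Y *m B) = C *m (X *m Y) *m B.
  move=> PY; rewrite -!mulmxA (mulmxA B C) BC (mulmxA P Y) PY -(mulmxA Y).
  by rewrite BP.
have TE j : T ^+ j = C *m M ^+ j *m B.
  elim: j => [|j IH]; first by rewrite !expr0 mulmx1 CB.
  by rewrite !exprSr -!mulmxE IH CMB.
have PMx : P *m (M - x%:M) = (M - x%:M) *m P.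
  by rewrite mulmxBr mulmxBl PM scalar_mxC.
have TxE j : (T - x%:M) ^+ j = C *m (M - x%:M) ^+ j *m B.
  elim: j => [|j IH]; first by rewrite !expr0 mulmx1 CB.
  have E1 : T - x%:M = C *m (M - x%:M) *m B.
    by rewrite mulmxBr mulmxBl mul_mx_scalar -scalemxAl CB scalemx1.
  by rewrite exprSr -mulmxE IH E1 CMB// exprSr -mulmxE.
have nil : (T - x%:M) ^+ a = 0.
  by rewrite TxE -BP mulmxA -(mulmxA C) MP0 mulmx0 mul0mx.
have : \tr (T ^+ i - (x ^+ i)%:M) = 0.
  have cTx : GRing.comm T x%:M by rewrite /GRing.comm -!mulmxE scalar_mxC.
  have -> : (x ^+ i)%:M = (x%:M : 'M[R]_r) ^+ i.
    by rewrite -[RHS](rmorphXn (scalar_mx : R -> 'M[R]_r)).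
  apply: (@mxtrace_nilpotent _ _ a).
  rewrite (subrXX_comm _ cTx) exprMn_comm ?nil ?mul0r//.
  apply: commr_sum => j _; apply: commrM; apply: commrX.
    by apply: commr_sym; apply: commrB; [exact: commr_refl|].
  by apply: commr_sym; apply: commrB; [exact/commr_sym|exact: commr_refl].
move/eqP; rewrite raddfB/= mxtrace_scalar subr_eq0 => /eqP trE.
by rewrite -BC mulmxA mxtrace_mulC mulmxA -TE trE mulr_natl.
Qed.

End spectral_splitting.

(** * Integer power sums force equal multiplicities *)

Section integer_traces.
Context {R : realType}.

(* If [r != s], Cramer's rule makes [x] and [y] rational; then [D T_(n+1) - U T_n],
   with [y = U / D], is a nonzero integer tending to [0]. *)
Lemma integer_traces_mult_eq (r s : nat) (x y : R) :
  (0 < r)%N -> (0 < s)%N -> 0 < `|x| -> `|x| < 1 -> 1 < `|y| ->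
  (forall n, r%:R * x ^+ n + s%:R * y ^+ n \is a Num.int) -> r = s.
Proof.
move=> r0 s0 x0 x1 y1 TZ; apply/eqP/negPn/negP => rs.
pose T n := r%:R * x ^+ n + s%:R * y ^+ n.
have xy : x != y by apply: contraTneq y1 => <-; rewrite -leNgt ltW.
have xN0 : x != 0 by rewrite -normr_gt0.
(* [T] satisfies a recurrence with coefficients [x + y] and [- x y], whose determinant is [E].
   Cramer's rule gives [(x + y) E = T 0 * T 3 - T 1 * T 2], and [T 1 = r (x + y) + (s - r) y] then
   isolates [y] as [U / D]. *)
pose E : R := T 0 * T 2 - T 1 ^+ 2.
have EE : E = r%:R * s%:R * (x - y) ^+ 2.
  by rewrite /E /T !expr0 !expr1; ring.
pose D := E * (s%:R - r%:R).
pose U := E * T 1 - r%:R * (T 0 * T 3 - T 1 * T 2).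
have UD : U = D * y by rewrite /U /D /E /T !expr0 !expr1; ring.
have D0 : D != 0.
  rewrite /D EE !mulf_neq0 ?expf_neq0 ?subr_eq0 ?pnatr_eq0 -?lt0n//.
  by rewrite eqr_nat eq_sym.
have rN0 : r%:R != 0 :> R by rewrite pnatr_eq0 -lt0n.
have xyN0 : x - y != 0 by rewrite subr_eq0.
have natZ n : n%:R \is a @Num.int R by exact/rpred_nat.
have TZ' n : T n \is a Num.int by exact: TZ.
have EZ : E \is a Num.int by apply: rpredB; [exact: rpredM|exact: rpredX].
have DZ : D \is a Num.int by apply: rpredM => //; exact: rpredB.
have UZ : U \is a Num.int.
  apply: rpredB; first exact: rpredM.
  by apply: rpredM => //; apply: rpredB; exact: rpredM.
have aE n : D * T n.+1 - U * T n = D * r%:R * (x - y) * x ^+ n.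
  by rewrite UD /T !exprS; ring.
pose K := `|D * r%:R * (x - y)|.
have K0 : 0 < K by rewrite normr_gt0; exact: mulf_neq0 (mulf_neq0 D0 rN0) xyN0.
have : (fun n => x ^+ n) @ \oo --> (0 : R) by exact: cvg_expr.
move=> /cvgr0Pnorm_lt/(_ K^-1); rewrite invr_gt0 => /(_ K0)[n _ /(_ n (leqnn n))].
rewrite -(ltr_pM2l K0) divff ?gt_eqF// => /= /lt_geF; rewrite -normrM -aE.
suff -> : 1 <= `|D * T n.+1 - U * T n| by [].
apply: norm_intr_ge1; first by apply: rpredB; exact: rpredM.
by rewrite aE mulf_neq0 ?expf_neq0//; exact: mulf_neq0 (mulf_neq0 D0 rN0) xyN0.
Qed.

End integer_traces.

Section big_two_values.

Lemma sum_two_values (V : nmodType) (T : eqType) (rs : seq T) (x y : T)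
    (F : T -> V) : x != y ->
  {in rs, forall z, z = x \/ z = y} ->
  \sum_(z <- rs) F z = F x *+ count_mem x rs + F y *+ count_mem y rs.
Proof.
move=> xy; elim: rs => [|z rs IH] h; first by rewrite big_nil addr0.
rewrite big_cons IH => [|w wrs]; last by apply: h; rewrite inE wrs orbT.
have [->|->] := h z (mem_head _ _); rewrite /= eqxx.
  by rewrite (negbTE xy) add0n add1n mulrS addrA.
by rewrite eq_sym (negbTE xy) add0n add1n mulrS addrCA.
Qed.

Lemma prod_two_values (V : comNzRingType) (T : eqType) (rs : seq T) (x y : T)
    (F : T -> V) : x != y ->
  {in rs, forall z, z = x \/ z = y} ->
  \prod_(z <- rs) F z = F x ^+ count_mem x rs * F y ^+ count_mem y rs.
Proof.
move=> xy; elim: rs => [|z rs IH] h; first by rewrite big_nil mulr1.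
rewrite big_cons IH => [|w wrs]; last by apply: h; rewrite inE wrs orbT.
have [->|->] := h z (mem_head _ _); rewrite /= eqxx.
  by rewrite (negbTE xy) add0n add1n exprS mulrA.
by rewrite eq_sym (negbTE xy) add0n add1n exprS mulrCA.
Qed.

Lemma size_two_values (T : eqType) (rs : seq T) (x y : T) : x != y ->
  {in rs, forall z, z = x \/ z = y} ->
  size rs = (count_mem x rs + count_mem y rs)%N.
Proof.
move=> xy; elim: rs => [//|z rs IH] h.
rewrite /= IH => [|w wrs]; last by apply: h; rewrite inE wrs orbT.
have [->|->] := h z (mem_head _ _); rewrite eqxx.
  by rewrite (negbTE xy) add0n add1n.
by rewrite eq_sym (negbTE xy) add0n add1n addnS.
Qed.

End big_two_values.

Notation real_mx A := (map_mx intr A).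

(* Columns of [Bu] (resp. [Bs]) are a basis of the unstable (resp. stable)
   subspace, and [Cu] (resp. [Cs]) reads off coordinates in that basis. *)
Record hyperbolic_splitting (R : realType) (d : nat) (A : 'M[int]_d) (k : nat)
    (L : R) := HyperbolicSplitting {
  Ainv : 'M[int]_d;
  Bu : 'M[R]_(d, k);
  Cu : 'M[R]_(k, d);
  Bs : 'M[R]_(d, k);
  Cs : 'M[R]_(k, d);
  mulAV : A *m Ainv = 1%:M;
  mulVA : Ainv *m A = 1%:M;
  CuBu : Cu *m Bu = 1%:M;
  CsBs : Cs *m Bs = 1%:M;
  BCuD : Bu *m Cu + Bs *m Cs = 1%:M;
  BCu_comm : Bu *m Cu *m real_mx A = real_mx A *m (Bu *m Cu);
  k_gt0 : (0 < k)%N;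
  L_gt0 : 0 < L;
  growth : forall delta, 0 < delta -> exists2 C : R, 0 < C &
    forall n (v : 'cV[R]_d),
    [/\ enorm (real_mx A ^+ n *m (Bu *m Cu *m v)) <=
          C * expR ((L + delta) * n%:R) * enorm v,
        enorm (real_mx Ainv ^+ n *m (Bu *m Cu *m v)) <=
          C * expR (- (L - delta) * n%:R) * enorm v,
        enorm (real_mx Ainv ^+ n *m (Bs *m Cs *m v)) <=
          C * expR ((L + delta) * n%:R) * enorm v
      & enorm (real_mx A ^+ n *m (Bs *m Cs *m v)) <=
          C * expR (- (L - delta) * n%:R) * enorm v]
}.

Section spectrum.
Context {R : realType}.

Lemma normc_real (x : R) : Normc.normc (x%:C)%C = `|x|.
Proof. by rewrite /= expr0n addr0 sqrtr_sqr. Qed.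

Lemma conjc_normc (z : R[i]) : Normc.normc (z^*)%C = Normc.normc z.
Proof. by case: z => a b /=; rewrite sqrrN. Qed.

Lemma conjc_fixed_real (z : R[i]) : (z^*)%C = z -> z = ((complex.Re z)%:C)%C.
Proof.
case: z => a b /= [/eqP]; rewrite eq_sym -addr_eq0 -mulr2n mulrn_eq0 /=.
by move=> /eqP ->.
Qed.

Lemma complex_mxE d (A : 'M[int]_d) :
  complex_mx A = map_mx (real_complex R) (real_mx A).
Proof. by apply/matrixP => i j; rewrite !mxE rmorph_int. Qed.

Lemma root_conjc_char_poly d (A : 'M[int]_d) (z : R[i]) :
  root (char_poly (complex_mx A)) z -> root (char_poly (complex_mx A)) (z^*)%C.
Proof.
rewrite -complex_root_conj complex_mxE -map_char_poly -map_poly_comp.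
by congr (root _ _); apply: eq_map_poly => x /=; rewrite oppr0.
Qed.

Lemma mulmx_exp_growth_expR d (M P : 'M[R]_d) (x l : R) k :
  (M - x%:M) ^+ k *m P = 0 -> `|x| < expR l ->
  exists2 C : R, 0 < C & forall n (v : 'cV[R]_d),
    enorm (M ^+ n *m (P *m v)) <= C * expR (l * n%:R) * enorm v.
Proof.
move=> h xl; have [C C0 hC] := mulmx_exp_growth xl h.
by exists C => // n v; rewrite expRM_natr.
Qed.

Lemma nilpotent_inv d (M N P : 'M[R]_d) (x : R) k : x != 0 ->
  N *m M = 1%:M -> M *m N = 1%:M -> (M - x%:M) ^+ k *m P = 0 ->
  (N - x^-1%:M) ^+ k *m P = 0.
Proof.
move=> x0 NM MN h.
have -> : N - x^-1%:M = (- x^-1)%:M * N * (M - x%:M).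
  rewrite -!mulmxE -mulmxA mulmxBr NM mul_mx_scalar mulmxBr mulmx1.
  rewrite mul_scalar_mx scalerA mulNr mulVf// scaleN1r opprK addrC.
  by rewrite -raddfN.
have cMN : GRing.comm ((- x^-1)%:M * N) (M - x%:M).
  rewrite /GRing.comm -!mulmxE mul_scalar_mx -scalemxAl -scalemxAr.
  by rewrite mulmxBl mulmxBr NM MN mul_mx_scalar mul_scalar_mx.
by rewrite exprMn_comm// -mulmxE -mulmxA h mulmx0.
Qed.

End spectrum.

Section existence.
Context {R : realType}.

(** Complex conjugation permutes the roots and preserves moduli, so it fixes [ls] and [lu]. The
    ranks of the spectral projections follow from the traces of [A ^+ 0] and [A ^+ 1], two
    independent linear equations as [x != y]; equal multiplicities and determinant one then give
    [|x| |y| = 1]. *)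
Lemma hyperbolic_splitting_exists (d : nat) (A : 'M[int]_d) (ls lu : R[i]) :
  \det A = 1 ->
  (forall mu : R[i], eigenvalue (complex_mx A) mu <-> mu = ls \/ mu = lu) ->
  0 < Normc.normc ls -> Normc.normc ls < 1 -> 1 < Normc.normc lu ->
  ln (Normc.normc ls) = - ln (Normc.normc lu) /\
  exists _ : hyperbolic_splitting A (alg_multiplicity A ls)
    (ln (Normc.normc lu)), True.
Proof.
case: d A => [|d] A detA eigA ls0 ls1 lu1.
  have /eigenvalueP[v _] : eigenvalue (complex_mx A) ls by apply/eigA; left.
  by rewrite (thinmx0 v) eqxx.
have rootE z : root (char_poly (complex_mx A)) z <-> z = ls \/ z = lu.
  by rewrite -eigenvalue_root_char; exact: eigA.
pose x := complex.Re ls; pose y := complex.Re lu.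
have lsE : ls = (x%:C)%C.
  apply: conjc_fixed_real.
  have /root_conjc_char_poly/rootE[//|e] :
    root (char_poly (complex_mx A)) ls by apply/rootE; left.
  by move: lu1; rewrite -e conjc_normc ltNge ltW.
have luE : lu = (y%:C)%C.
  apply: conjc_fixed_real.
  have /root_conjc_char_poly/rootE[e|//] :
    root (char_poly (complex_mx A)) lu by apply/rootE; right.
  by move: ls1; rewrite -e conjc_normc ltNge ltW.
move: ls0 ls1 lu1; rewrite {1 2}lsE {1}luE !normc_real => x0 x1 y1.
have xy : x != y by apply: contraTneq y1 => <-; rewrite -leNgt ltW.
have lslu : ls != lu by rewrite lsE luE (inj_eq (fmorph_inj (real_complex R))).
have xN0 : x != 0 by rewrite -normr_gt0.
have yN0 : y != 0 by rewrite -normr_gt0 (lt_trans ltr01).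
pose a := real_mx A : 'M[R]_d.+1.
have [rs rsE] := closed_field_poly_normal (char_poly (complex_mx A : 'M[R[i]]_d.+1)).
rewrite (monicP (char_poly_monic _)) scale1r in rsE.
have rs2 : {in rs, forall z, z = ls \/ z = lu}.
  by move=> z zrs; apply/rootE; rewrite rsE root_prod_XsubC.
pose m1 := count_mem ls rs; pose m2 := count_mem lu rs.
have multE : alg_multiplicity A ls = m1.
  by rewrite /alg_multiplicity rsE mu_prod_XsubC.
have m10 : (0 < m1)%N.
  by rewrite -has_count has_pred1 -root_prod_XsubC -rsE; apply/rootE; left.
have m20 : (0 < m2)%N.
  by rewrite -has_count has_pred1 -root_prod_XsubC -rsE; apply/rootE; right.
have szrs : size rs = d.+1.
  by have := size_char_poly (complex_mx A : 'M[R[i]]_d.+1);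
     rewrite rsE size_prod_XsubC => -[].
have m12 : (m1 + m2)%N = d.+1 by rewrite -szrs (size_two_values lslu rs2).
have chA : char_poly a = ('X - x%:P) ^+ m1 * ('X - y%:P) ^+ m2.
  apply: (map_poly_inj (real_complex R)); rewrite map_char_poly -complex_mxE rsE.
  rewrite (prod_two_values (fun z => 'X - z%:P) lslu rs2).
  by rewrite rmorphM/= !rmorphXn/= !rmorphB/= map_polyX !map_polyC/= -lsE -luE.
have trA : \tr a = m1%:R * x + m2%:R * y.
  have : (char_poly (complex_mx A : 'M[R[i]]_d.+1))`_d = - \sum_(z <- rs) z.
    by rewrite rsE (_ : d = (size rs).-1) ?coefPn_prod_XsubC ?szrs.
  rewrite (sum_two_values id lslu rs2) -[d]/(d.+1.-1) char_poly_trace//.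
  move=> /oppr_inj; rewrite complex_mxE -/a lsE luE trace_map_mx => e.
  apply: (fmorph_inj (real_complex R)).
  by rewrite e rmorphD/= !rmorphM/= !rmorph_nat !mulr_natl -lsE -luE.
have prodA : x ^+ m1 * y ^+ m2 = 1.
  have := char_poly_det (complex_mx A : 'M[R[i]]_d.+1).
  rewrite rsE coef0_prod_XsubC szrs (prod_two_values id lslu rs2).
  move=> /(mulfI _)-/(_ _)/[!signr_eq0]/(_ isT).
  rewrite {1}/complex_mx det_map_mx detA rmorph1 => e.
  apply: (fmorph_inj (real_complex R)).
  by rewrite rmorphM/= !rmorphXn/= rmorph1 -lsE -luE.
clearbody m1 m2.
(* [P] belongs to the eigenvalue [x], so it projects onto the stable subspace; its complement
   provides [Bu] and [Cu]. *)
have [P [PP Pa nil1 nil2]] := spectral_projection xy chA.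
have QQ : (1%:M - P) *m (1%:M - P) = 1%:M - P.
  by rewrite mulmxBl mul1mx mulmxBr mulmx1 PP subrr subr0.
have Qa : (1%:M - P) *m a = a *m (1%:M - P).
  by rewrite mulmxBl mulmxBr mul1mx mulmx1 Pa.
have [r1 [B1 [C1 [BC1 CB1]]]] := idempotent_factor PP.
have [r2 [B2 [C2 [BC2 CB2]]]] := idempotent_factor QQ.
have trE i : \tr (a ^+ i) = r1%:R * x ^+ i + r2%:R * y ^+ i.
  rewrite -(mxtrace_unipotent_exp i BC1 CB1 Pa nil1).
  rewrite -(mxtrace_unipotent_exp i BC2 CB2 Qa nil2).
  by rewrite -mxtraceD -mulmxDr subrKC mulmx1.
have r12 : (r1 + r2)%N = d.+1.
  have := trE 0; rewrite !expr0 !mulr1 -natrD mxtrace1 => /eqP.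
  by rewrite eqr_nat eq_sym => /eqP.
have r1E : r1 = m1.
  have := trE 1; rewrite !expr1 trA => e.
  have e1 : r1%:R + r2%:R = m1%:R + m2%:R :> R by rewrite -!natrD r12 m12.
  have : (r1%:R - m1%:R) * (x - y) = 0.
    have e2 : r2%:R = m1%:R + m2%:R - r1%:R :> R by lra.
    by rewrite e2 in e; lra.
  move=> /eqP; rewrite mulf_eq0 !subr_eq0 (negbTE xy) orbF eqr_nat.
  by move=> /eqP.
have r2E : r2 = m2 by apply/eqP; rewrite -(eqn_add2l r1) r12 r1E m12.
subst r1 r2.
have m1E : m1 = m2.
  apply: (integer_traces_mult_eq m10 m20 x0 x1 y1) => i.
  rewrite -trE; have <- : real_mx (A ^+ i) = a ^+ i.
    elim: i => [|i IH]; first by rewrite !expr0 map_mx1.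
    by rewrite !exprS -!mulmxE map_mxM IH.
  by rewrite trace_map_mx; exact: intr_int.
have xyE : `|x| * `|y| = 1.
  apply/eqP; rewrite -(@eqrXn2 _ m1)// ?mulr_ge0// expr1n exprMn.
  by rewrite {2}m1E -!normrX -normrM prodA normr1.
have lnE : ln `|x| = - ln `|y|.
  apply/eqP; rewrite -addr_eq0 -lnM ?posrE// ?xyE ?ln1//.
  by rewrite (lt_trans ltr01).
have L0 : 0 < ln `|y| by rewrite ln_gt0.
have eL : expR (ln `|y|) = `|y| by rewrite lnK// posrE (lt_trans ltr01).
have eLN : expR (- ln `|y|) = `|x| by rewrite -lnE lnK// posrE.
rewrite multE lsE luE !normc_real; split => //.
pose Ai : 'M[int]_d.+1 := \adj A.
have AAi : A *m Ai = 1%:M by rewrite mul_mx_adj detA.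
have AiA : Ai *m A = 1%:M by rewrite mul_adj_mx detA.
have aai : a *m real_mx Ai = 1%:M by rewrite -map_mxM AAi map_mx1.
have aia : real_mx Ai *m a = 1%:M by rewrite -map_mxM AiA map_mx1.
have nil1V := nilpotent_inv xN0 aia aai nil1.
have nil2V := nilpotent_inv yN0 aia aai nil2.
subst m2.
unshelve eexists.
  apply: (@HyperbolicSplitting _ _ _ _ _ Ai B2 C2 B1 C1) => //.
  - by rewrite BC1 BC2 subrK.
  - by rewrite BC2.
  move=> delta d0.
  have xiE : `|x^-1| = `|y|.
    by rewrite normfV -[LHS]mulr1 -xyE mulKf// normr_eq0.
  have yiE : `|y^-1| = `|x|.
    by rewrite normfV -[LHS]mulr1 -xyE mulrCA mulVf ?mulr1// normr_eq0.
  have h1 : `|y| < expR (ln `|y| + delta) by rewrite -[ltLHS]eL ltr_expR ltrDl.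
  have h2 : `|x| < expR (- (ln `|y| - delta)).
    by rewrite -[ltLHS]eLN ltr_expR opprB ltrDr.
  have [K1 K10 g1] := mulmx_exp_growth_expR nil2 h1.
  have [K2 K20 g2] := mulmx_exp_growth_expR nil2V (etrans (congr1 (<%R^~ _) yiE) h2).
  have [K3 K30 g3] := mulmx_exp_growth_expR nil1V (etrans (congr1 (<%R^~ _) xiE) h1).
  have [K4 K40 g4] := mulmx_exp_growth_expR nil1 h2.
  exists (K1 + K2 + K3 + K4); first by rewrite !addr_gt0.
  have le_growth (K K' l : R) n (v : 'cV[R]_d.+1) : K <= K' ->
      K * expR (l * n%:R) * enorm v <= K' * expR (l * n%:R) * enorm v.
    by move=> KK'; rewrite -!mulrA ler_wpM2r// mulr_ge0 ?expR_ge0 ?enorm_ge0.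
  move=> n v; rewrite BC1 BC2; split.
  - by apply: le_trans (g1 n v) _; rewrite le_growth//; lra.
  - by apply: le_trans (g2 n v) _; rewrite le_growth//; lra.
  - by apply: le_trans (g3 n v) _; rewrite le_growth//; lra.
  - by apply: le_trans (g4 n v) _; rewrite le_growth//; lra.
exact: I.
Qed.

End existence.

(** * Mass distribution on Cantor sets *)

Lemma card_ord_ball {R : realType} (n : nat) (a : 'I_n) (rho : R) : 0 <= rho ->
  #|[pred x : 'I_n | `|x%:R - a%:R| <= rho]|%:R <= 2 * rho + 1.
Proof.
move=> rho0; pose D := Num.truncn rho.
have /andP[Drho rD] := truncn_itv rho0.
have ball x : `|x%:R - a%:R| <= rho -> (x <= a + D)%N && (a <= x + D)%N.
  rewrite ler_norml => /andP[h1 h2].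
  have h3 : x%:R < (a + D).+1%:R :> R by rewrite -addnS natrD; lra.
  have h4 : a%:R < (x + D).+1%:R :> R by rewrite -addnS natrD; lra.
  by move: h3 h4; rewrite !ltr_nat !ltnS => -> ->.
suff : (#|[pred x : 'I_n | (`|x%:R - a%:R| <= rho)%R]| <= (2 * D).+1)%N.
  rewrite -(ler_nat R) => /le_trans; apply; rewrite -addn1 natrD natrM; lra.
set A := [pred x : 'I_n | _].
(* The shift by [D] keeps the truncated subtraction exact on the ball. *)
rewrite -(@card_in_imset _ 'I_(2 * D).+1 (fun x : 'I_n => inord (x + D - a)) A).
  by rewrite -[leqRHS](card_ord (2 * D).+1) max_card.
move=> x y /ball/andP[x1 x2] /ball/andP[y1 y2] /(congr1 val).
rewrite /= !inordK; [|lia|lia] => e.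
by apply: val_inj => /=; lia.
Qed.

Definition coord_diam_le {R : realType} {k : nat} (U : set 'cV[R]_k) (r : R) :=
  forall u v : 'cV[R]_k, U u -> U v -> forall l, `|u l 0 - v l 0| <= r.

Section cantor_content.
Context {R : realType} {k : nat}.
Variables (c eta : nat -> R) (M : nat -> nat).
Variables (e : nat -> 'cV[R]_k -> 'cV[R]_k) (s : R).
Hypotheses (s_gt0 : 0 < s) (s_le : s <= k%:R).
Hypotheses (c_gt0 : forall m, 0 < c m) (eta_gt0 : forall m, 0 < eta m).
Hypothesis e_le : forall m q l, `|e m q l 0| <= eta m / 4.
Hypothesis Meta_le : forall m, (M m)%:R * eta m <= c m.
Hypothesis c_le : forall m, c m <= 2 * (M m)%:R * eta m.
Hypothesis cS_le : forall m, c m.+1 <= eta m / 8.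
Hypothesis c_pow : forall m, c m `^ s <= (M m ^ k)%:R * c m.+1 `^ s.

(** [q] is the centre of a cube of radius [c m]; the centres of its children lie on a grid of mesh
    [eta m], each moved by [e m p]. The bounds [eta m / 4] on the move and [eta m / 8] on the next
    radius keep the children disjoint. *)
Definition cantor_child m (q : 'cV[R]_k) (j : {ffun 'I_k -> 'I_(M m)}) :=
  let p := q + eta m *: \col_l (j l)%:R in p + e m p.

Definition cantor_path (q : nat -> 'cV[R]_k) :=
  q 0%N = 0 /\ forall m, exists j : {ffun 'I_k -> 'I_(M m)}, q m.+1 = cantor_child (q m) j.

Let touch (U : set 'cV[R]_k) m (q : 'cV[R]_k) :=
  exists2 u, U u & forall l, `|u l 0 - q l 0| <= c m.

Let child_ball m q (j : {ffun 'I_k -> 'I_(M m)}) (u : 'cV[R]_k) l :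
  `|u l 0 - cantor_child q j l 0| <= c m.+1 -> `|u l 0 - q l 0| <= c m.
Proof.
have jM : (j l)%:R + 1 <= (M m)%:R :> R by rewrite natr1 ler_nat.
have := e_le m (q + eta m *: \col_l (j l)%:R) l.
rewrite /cantor_child; set p := q + _ => ep.
rewrite mxE {1}/p !mxE.
move: ep (cS_le m) (Meta_le m) (eta_gt0 m); set E := e m p l 0.
move=> ep cS Me et; have j0 : 0 <= (j l)%:R :> R by [].
have h1 : ((j l)%:R + 1) * eta m <= c m.
  by apply: le_trans Me; rewrite ler_wpM2r// ltW.
have h2 : 0 <= eta m * (j l)%:R by rewrite mulr_ge0// ltW.
by move: ep; rewrite !ler_norml => /andP[? ?] /andP[? ?]; apply/andP; split; lra.
Qed.

Let touch_child U m q (j : {ffun 'I_k -> 'I_(M m)}) :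
  touch U m.+1 (cantor_child q j) -> touch U m q.
Proof. by move=> [u Uu h]; exists u => // l; exact: child_ball. Qed.

(** In units of the mesh, 3/4 is twice the displacement bound 1/4 plus twice the radius bound
    1/8. *)
Let touch_close U r m q (i j : {ffun 'I_k -> 'I_(M m)}) :
  coord_diam_le U r ->
  touch U m.+1 (cantor_child q i) -> touch U m.+1 (cantor_child q j) ->
  forall l, `|(i l)%:R - (j l)%:R| <= r / eta m + 3 / 4.
Proof.
move=> Ur [u Uu hu] [v Uv hv] l; have := Ur _ _ Uu Uv l.
have := hu l; have := hv l; have := cS_le m.
have := e_le m (q + eta m *: \col_l (i l)%:R) l.
have := e_le m (q + eta m *: \col_l (j l)%:R) l.
rewrite /cantor_child; set pi := q + _; set pj := q + _ => ei ej.
rewrite [(pj + _) _ _]mxE [(pi + _) _ _]mxE {1}/pi {1}/pj !mxE.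
move: ei ej; set Ei := e m pi l 0; set Ej := e m pj l 0.
have := eta_gt0 m; clearbody Ei Ej.
move: (i l)%:R (j l)%:R (eta m) (c m.+1) (q l 0) (u l 0) (v l 0).
move=> x y t c' q' a b t0 hi hj c't h1 h2 h3.
rewrite -(ler_pM2r t0) -{1}(gtr0_norm t0) -normrM [leRHS]mulrDl divfK ?gt_eqF//.
move: hi hj h1 h2 h3; rewrite !ler_norml.
move=> /andP[? ?] /andP[? ?] /andP[? ?] /andP[? ?] /andP[? ?].
by apply/andP; split; lra.
Qed.

(** Bound for the proportion of the uniform mass below a cube of level [m] that a set of diameter
    [r] can carry, capped at the trivial value 1. *)
Let gain r m : R := Num.min 1 (60 ^+ k * (r `^ s / c m `^ s)).

Let gain_ge0 r m : 0 <= gain r m.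
Proof. by rewrite le_min ler01 mulr_ge0// ?exprn_ge0// divr_ge0// powR_ge0. Qed.

Let pot (U : set 'cV[R]_k) r m q : R := if `[< touch U m q >] then gain r m else 0.

Let pot_ge0 U r m q : 0 <= pot U r m q.
Proof. by rewrite /pot; case: ifP. Qed.

(** Below [eta m / 8], two touched indices differ by at most 1/8 + 3/4 < 1, so they agree. Above it,
    with [rho = r / eta m], each coordinate takes at most [2 (rho + 3/4) + 1] values, which is below
    [30 rho] because [rho > 1/8]. *)
Let card_touch U r m q : 0 < r ->
  coord_diam_le U r ->
  let T := #|[pred j : {ffun 'I_k -> 'I_(M m)} |
              `[< touch U m.+1 (cantor_child q j) >]]| in
  (T <= 1)%N \/ T%:R <= (30 * (r / eta m)) ^+ k :> R.
Proof.
move=> r0 Ur /=; have et := eta_gt0 m.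
have [re|re] := leP r (eta m / 8).
  left; apply/card_le1_eqP => i j; rewrite !inE => ti tj.
  apply/ffunP => l; apply/val_inj; have := touch_close Ur ti tj l.
  have h : r / eta m <= 8^-1 by rewrite ler_pdivrMr// mulrC.
  rewrite ler_norml => /andP[h1 h2].
  have h3 : (i l)%:R < (j l).+1%:R :> R by rewrite -natr1; lra.
  have h4 : (j l)%:R < (i l).+1%:R :> R by rewrite -natr1; lra.
  by move: h3 h4; rewrite !ltr_nat !ltnS => h3 h4; apply: anti_leq; apply/andP; split.
right; set A := [pred j | _].
have [->|] := eqVneq #|A| 0%N.
  by rewrite exprn_ge0// mulr_ge0// divr_ge0// ltW.
rewrite -lt0n => /card_gt0P[j0]; rewrite inE => tj0.
have rho0 : 0 <= r / eta m + 3 / 4 by rewrite addr_ge0// divr_ge0// ltW.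
pose F l := [pred x : 'I_(M m) | `|x%:R - (j0 l)%:R| <= r / eta m + 3 / 4].
have AF : (#|A| <= #|family F|)%N.
  apply: subset_leq_card; apply/fintype.subsetP => j; rewrite inE => tj.
  by apply/familyP => l; rewrite inE; exact: (touch_close Ur tj tj0 l).
apply: (@le_trans _ _ #|family F|%:R); first by rewrite ler_nat.
rewrite card_family foldrE big_map big_enum natr_prod.
rewrite -[in leRHS](card_ord k) -prodr_const; apply: ler_prod => l _.
rewrite ler0n/= (le_trans (card_ord_ball _ rho0))//.
have h : 8^-1 < r / eta m by rewrite ltr_pdivlMr// mulrC.
by lra.
Qed.

Let card_child m : #|{: {ffun 'I_k -> 'I_(M m)}}| = (M m ^ k)%N.
Proof. by rewrite card_ffun !card_ord. Qed.

(** The supermartingale inequality. A single touched child is paid for by [c_pow]. If many are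
    touched, [c_le] bounds the mesh below by [c m / (2 M m)], which doubles 30 to 60, and [s <= k]
    with [r < c m] replaces the power [k] of [r / c m] by the power [s]. *)
Let pot_super U r m q : 0 < r ->
  coord_diam_le U r ->
  \sum_(j : {ffun 'I_k -> 'I_(M m)}) pot U r m.+1 (cantor_child q j) <=
  (M m ^ k)%:R * pot U r m q.
Proof.
move=> r0 Ur; have cm := c_gt0 m; have et := eta_gt0 m.
have -> : \sum_(j : {ffun 'I_k -> 'I_(M m)}) pot U r m.+1 (cantor_child q j) =
    #|[pred j : {ffun 'I_k -> 'I_(M m)} |
              `[< touch U m.+1 (cantor_child q j) >]]|%:R * gain r m.+1.
  rewrite /pot -big_mkcond/= sumr_const mulr_natl; congr (_ *+ _).
set A := [pred j | _].
have [A0|] := eqVneq #|A| 0%N.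
  by rewrite A0 mul0r mulr_ge0.
move=> A0; rewrite /pot; have : touch U m q.
  move: A0; rewrite -lt0n => /card_gt0P[j]; rewrite inE; exact: touch_child.
move=> /asboolP ->.
have A1 : #|A|%:R * gain r m.+1 <= (M m ^ k)%:R.
  rewrite (@le_trans _ _ (#|A|%:R))//.
    by rewrite ler_piMr// ge_min lexx.
  by rewrite ler_nat -card_child max_card.
rewrite [X in _ <= _ * X]/gain [leRHS]minr_pMr// mulr1 le_min A1/=.
have cs0 i : 0 < c i `^ s by exact: powR_gt0.
have [rc|rc] := leP (c m) r.
  apply: (le_trans A1); rewrite ler_peMr// mulr_ege1//.
    by rewrite exprn_ege1// ler1n.
  by rewrite ler_pdivlMr// mul1r ge0_ler_powR ?nnegrE// ltW.
have [T1|T1] := card_touch m q r0 Ur.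
  rewrite (@le_trans _ _ (gain r m.+1))//.
    by rewrite ler_piMl// lern1.
  rewrite (@le_trans _ _ (60 ^+ k * (r `^ s / c m.+1 `^ s)))// ?ge_min ?lexx ?orbT//.
  rewrite [leRHS]mulrCA ler_wpM2l ?exprn_ge0// [leRHS]mulrCA ler_wpM2l ?powR_ge0//.
  by rewrite ler_pdivlMr// mulrC ler_pdivrMr.
rewrite (@le_trans _ _ (#|A|%:R))//; first by rewrite ler_piMr// ge_min lexx.
apply: (le_trans T1).
have rc1 : 0 < r / c m <= 1 by rewrite divr_gt0//= ler_pdivrMr// mul1r ltW.
apply: (@le_trans _ _ ((60 * (M m)%:R * (r / c m)) ^+ k)).
  have h0 : 0 <= 30 * (r / eta m) by rewrite mulr_ge0// divr_ge0// ltW.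
  have h : 30 * (r / eta m) <= 60 * (M m)%:R * (r / c m).
    have -> : 60 * (M m)%:R * (r / c m) =
        30 * (r / eta m) * (2 * (M m)%:R * eta m / c m).
      by field; rewrite !gt_eqF.
    by rewrite ler_peMr// ler_pdivlMr// mul1r c_le.
  by apply: lerXn2r; rewrite // nnegrE ?(le_trans h0).
rewrite exprMn exprMn natrX [_ ^+ k * _]mulrC -mulrA ler_wpM2l ?exprn_ge0//.
rewrite ler_wpM2l ?exprn_ge0// -powR_mulrn ?divr_ge0 ?(ltW r0) ?(ltW cm)//.
rewrite (le_trans (ger_powR rc1 s_le))// ler_pdivlMr// -powRM ?(ltW cm)//.
  by rewrite divfK// gt_eqF.
by rewrite divr_ge0// ltW.
Qed.

Let child_gt0 m : (0 < M m ^ k)%N.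
Proof.
rewrite lt0n; apply/eqP => M0; have := c_pow m.
by rewrite M0 mul0r leNgt powR_gt0.
Qed.

Let c_cvg0 (r : R) : 0 < r -> exists m, c m <= r.
Proof.
move=> r0; have cm m : c m <= c 0 * 8^-1 ^+ m.
  elim: m => [|m IH]; first by rewrite expr0 mulr1.
  rewrite exprSr mulrA (le_trans (cS_le m))// ler_wpM2r//.
  apply: le_trans IH; apply: le_trans (Meta_le m).
  rewrite ler_peMl ?ler1n ?(ltW (eta_gt0 m))// lt0n; apply/eqP => M0.
  have := c_gt0 m; have := c_le m; rewrite M0 mulr0 mul0r => h.
  by rewrite ltNge h.
have /cvgr0Pnorm_lt/(_ (r / c 0)) : (fun n => (8^-1 : R) ^+ n) @ \oo --> (0 : R).
  by apply: cvg_expr; rewrite ger0_norm// invf_lt1// ltr1n.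
rewrite divr_gt0// => /(_ isT)[m _ /(_ m (leqnn m))] /=.
rewrite ger0_norm ?exprn_ge0// ltr_pdivlMr// mulrC => h.
by exists m; rewrite (le_trans (cm m))// ltW.
Qed.

(** Coordinatewise the cubes of a path are nested intervals, and the supremum of the left endpoints
    belongs to all of them. *)
Let path_limit (q : nat -> 'cV[R]_k) : cantor_path q ->
  exists x : 'cV[R]_k, forall m l, `|x l 0 - q m l 0| <= c m.
Proof.
move=> [_ qS].
have mono m n l : (m <= n)%N ->
    q m l 0 - c m <= q n l 0 - c n /\ q n l 0 + c n <= q m l 0 + c m.
  elim: n => [|n IH]; first by rewrite leqn0 => /eqP ->.
  rewrite leq_eqVlt ltnS => /orP[/eqP -> //|/IH[h1 h2]].
  have [j qE] := qS n; have c0 := ltW (c_gt0 n.+1).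
  have hp : `|(q n.+1 + const_mx (c n.+1)) l 0 - q n l 0| <= c n.
    by apply: (child_ball (j := j)); rewrite -qE !mxE addrAC subrr add0r ger0_norm.
  have hm : `|(q n.+1 - const_mx (c n.+1)) l 0 - q n l 0| <= c n.
    by apply: (child_ball (j := j)); rewrite -qE !mxE addrAC subrr add0r normrN ger0_norm.
  move: hp hm; rewrite !mxE !ler_norml => /andP[_ h3] /andP[h4 _].
  by split; lra.
pose E l := [set q m l 0 - c m | m in [set: nat]].
have Eub l m : ubound (E l) (q m l 0 + c m).
  move=> _ [n _ <-]; have := c_gt0 n; have := c_gt0 m.
  have [mn|/ltnW nm] := leqP m n.
    by have [_] := mono _ _ l mn; lra.
  by have [+ _] := mono _ _ l nm; lra.
exists (\col_l sup (E l)) => m l; rewrite mxE ler_norml.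
have h1 : q m l 0 - c m <= sup (E l).
  by apply: ub_le_sup; [exists (q m l 0 + c m); exact: Eub|exists m].
have h2 : sup (E l) <= q m l 0 + c m.
  by apply: ge_sup; [exists (q m l 0 - c m), m|exact: Eub].
by apply/andP; split; lra.
Qed.

(* [F m q] bounds from above the conditional mass, under the uniform measure on
   paths through [q], of the sets that are small at scale [c m]; it is a
   supermartingale, so some path keeps it below [1] and escapes every [U i]. *)
Lemma cantor_content (P : pred nat) (U : nat -> set 'cV[R]_k) (r : nat -> R) :
  (forall i, 0 < r i) -> (forall i, P i -> coord_diam_le (U i) (r i)) ->
  (forall q (x : 'cV[R]_k), cantor_path q -> (forall m l, `|x l 0 - q m l 0| <= c m) ->
     exists2 i, P i & U i x) ->
  (1 <= \sum_(i <oo | P i) (60 ^+ k * (r i `^ s / c 0 `^ s))%:E)%E.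
Proof.
move=> r0 Ur cover; rewrite leNgt; apply/negP => sum_lt1.
pose w i m q := if P i then pot (U i) (r i) m q else 0.
have w0 i m q : 0 <= w i m q by rewrite /w; case: ifP.
pose F m q := (\sum_(0 <= i <oo) (w i m q)%:E)%E.
have F0 : (F 0%N 0%R < 1)%E.
  apply: le_lt_trans sum_lt1; rewrite [leRHS]eseries_mkcond.
  apply: lee_nneseries => i; first by rewrite lee_fin.
  rewrite /w; case: ifP => // _; rewrite lee_fin /pot; case: ifP => // _.
    by rewrite /gain ge_min lexx orbT.
  by rewrite mulr_ge0 ?exprn_ge0// divr_ge0// powR_ge0.
(* If every child had [F >= 1], summing over the children and applying [pot_super] termwise would
   give [F m q >= 1]. *)
have step m q : (F m q < 1)%E ->
    exists j : {ffun 'I_k -> 'I_(M m)}, (F m.+1 (cantor_child q j) < 1)%E.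
  move=> Fq; apply: contrapT => /forallNP noj.
  have : ((M m ^ k)%:R%:E <= (M m ^ k)%:R%:E * F m q)%E.
    have bE : ((M m ^ k)%:R%:E = \sum_(j : {ffun 'I_k -> 'I_(M m)}) 1 :> \bar R)%E.
      by rewrite sumEFin sumr_const card_child.
    rewrite {1}bE.
    rewrite (@le_trans _ _ (\sum_(j : {ffun 'I_k -> 'I_(M m)})
        F m.+1 (cantor_child q j))%E)//.
      by apply: lee_sum => j _; rewrite leNgt; apply/negP; exact: noj.
    rewrite -nneseries_sum; last by move=> *; rewrite lee_fin.
    rewrite [F m q]/F -nneseriesZl; last by move=> *; rewrite lee_fin.
    apply: lee_nneseries => i; first by move=> *; rewrite sumEFin lee_fin sumr_ge0.
    move=> _; rewrite sumEFin -EFinM lee_fin /w; case: ifP => Pi.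
      exact: pot_super (Ur i Pi).
    by rewrite big1// mulr0.
  have Ffin : F m q \is a fin_num.
    rewrite ge0_fin_numE ?(lt_trans Fq) ?ltry//.
    by apply: nneseries_ge0 => *; rewrite lee_fin.
  move: Fq; rewrite -(fineK Ffin) -EFinM lte_fin lee_fin => Fq.
  by rewrite leNgt gtr_pMr ?ltr0n// Fq.
have /choice[nxt nxtP] : forall p : nat * 'cV[R]_k, exists y,
    (F p.1 p.2 < 1)%E -> (exists j : {ffun 'I_k -> 'I_(M p.1)},
      y = cantor_child p.2 j) /\ (F p.1.+1 y < 1)%E.
  move=> [m q] /=.
  have [Fq|Fq] := pselect (F m q < 1)%E; last by exists 0.
  have [j Fj] := step _ _ Fq; exists (cantor_child q j) => _.
  by split; [exists j|exact: Fj].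
pose q := fix q m := if m is m'.+1 then nxt (m', q m') else 0.
have Fq m : (F m (q m) < 1)%E.
  by elim: m => [//|m IH]; have [] := nxtP (m, q m) IH.
have qpath : cantor_path q.
  by split=> // m; have [] := nxtP (m, q m) (Fq m).
have [x xq] := path_limit qpath.
have [i Pi Ui] := cover _ _ qpath xq.
(* Once [c m] is at most [r i], [gain] equals 1 and the single term [i] contradicts
   [F m (q m) < 1]. *)
have [m cm] := c_cvg0 (r0 i).
have := Fq m; rewrite ltNge => /negP; apply.
apply: (@le_trans _ _ (w i m (q m))%:E).
  rewrite lee_fin /w Pi /pot; have -> : `[< touch (U i) m (q m) >].
    by apply/asboolP; exists x => // l; exact: xq.
  rewrite /gain le_min lexx/= mulr_ege1//.
    by rewrite exprn_ege1// ler1n.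
  have rs : c m `^ s <= r i `^ s.
    by rewrite ge0_ler_powR ?nnegrE ?(ltW s_gt0) ?(ltW (c_gt0 m)) ?(ltW (r0 i)).
  by rewrite ler_pdivlMr ?powR_gt0// mul1r.
rewrite /F (@nneseriesD1 _ _ i)//; last by move=> *; rewrite lee_fin.
by rewrite leeDl// nneseries_ge0// => *; rewrite lee_fin.
Qed.

End cantor_content.

(** * Slicing *)

Section slicing.
Context {R : realType}.
Local Open Scope ereal_scope.

(** The hypothesis is integrated over [[0, y0]] and the integral exchanged with the countable sum;
    each term gives at most [w i] times the length of an interval. *)
Lemma sum_interval_lengths (w alpha ell : nat -> R) (a y0 : R) :
  (forall i, 0 <= w i)%R -> (forall i, 0 <= ell i)%R -> (0 <= a)%R -> (0 <= y0)%R ->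
  (forall y, (0 <= y <= y0)%R ->
    a%:E <= \sum_(i <oo) (w i * (alpha i <= y <= alpha i + ell i)%R%:R)%:E) ->
  (a * y0)%:E <= \sum_(i <oo) (w i * ell i)%:E.
Proof.
move=> w0 l0 a0 y00 h.
pose mu := @lebesgue_measure R; pose D : set R := `[0%R, y0]%classic.
pose J i : set R := `[alpha i, (alpha i + ell i)%R]%classic.
pose f i : R -> \bar R := fun y => (w i)%:E * (\1_(J i) y)%:E.
have fE i y : (w i * (alpha i <= y <= alpha i + ell i)%R%:R)%:E = f i y.
  by rewrite /f -EFinM indicE mem_setE in_itv.
have f0 i y : 0 <= f i y by rewrite mule_ge0 ?lee_fin.
have mJ i : measurable (J i) by exact: measurable_itv.
have mD : measurable D by exact: measurable_itv.
have mf i : measurable_fun D (f i).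
  apply: emeasurable_funM => //; apply/measurable_EFinP.
  exact: measurable_indic.
have -> : (a * y0)%:E = \int[mu]_(y in D) a%:E.
  rewrite integral_cst// EFinM; congr (_ * _).
  rewrite [RHS]lebesgue_measure_itv/= lte_fin.
  by case: ltgtP y00 => // [_|<-]; rewrite ?sube0// oppr0 adde0.
apply: (@le_trans _ _ (\int[mu]_(y in D) \sum_(i <oo) f i y)).
  apply: ge0_le_integral => //.
  - by apply: ge0_emeasurable_sum => *; [exact: f0|exact: mf].
  - move=> y; rewrite -[D y]/(is_true (y \in `[0%R, y0]%R)) in_itv/= => /h.
    move=> /le_trans; apply.
    by apply: lee_nneseries => [i _ _|i _]; rewrite fE.
rewrite integral_nneseries//; apply: lee_nneseries => i.
  by move=> *; exact: integral_ge0.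
move=> _; have m1 : measurable_fun D (fun y : R => (\1_(J i) y)%:E : \bar R).
  by apply/measurable_EFinP; exact: measurable_indic.
rewrite /f ge0_integralZl_EFin//.
rewrite EFinM lee_wpmul2l ?lee_fin// integral_indic//.
have JD : J i `&` D `<=` J i by move=> ? [].
have mJD : measurable (J i `&` D) by apply: measurableI.
apply: le_trans (le_measure mu (mem_set mJD) (mem_set (mJ i)) JD) _.
rewrite [leLHS]lebesgue_measure_itv/= lte_fin ltrDl.
case: ifP => _; last by rewrite lee_fin.
by rewrite -EFinD lee_fin addrC addKr.
exact: mJ.
Qed.

(** Induction on [k]: the one-dimensional inequality integrates out the last coordinate, the
    indicators of the others being absorbed in the weights. Points are sequences over [nat], so that
    one coordinate can be replaced without changing types. *)
Lemma sum_box_volumes (k : nat) (alpha : nat -> nat -> R) (ell : nat -> R) (y0 : R) :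
  (forall i, 0 <= ell i)%R -> (0 <= y0)%R ->
  forall (w : nat -> R) (a : R), (forall i, 0 <= w i)%R -> (0 <= a)%R ->
  (forall y : nat -> R, (forall l, 0 <= y l <= y0)%R ->
    a%:E <= \sum_(i <oo) (w i * \prod_(l < k)
      (alpha i l <= y l <= alpha i l + ell i)%R%:R)%:E) ->
  (a * y0 ^+ k)%:E <= \sum_(i <oo) (w i * ell i ^+ k)%:E.
Proof.
move=> l0 y00; elim: k => [|k IH] w a w0 a0 h.
  have := h (fun=> 0%R) (fun=> introT andP (conj (lexx _) y00)).
  rewrite expr0 mulr1 => /le_trans; apply; apply: lee_nneseries => i.
    by move=> *; rewrite big_ord0 mulr1 lee_fin.
  by rewrite big_ord0 expr0.
rewrite exprS mulrA.
have -> : \sum_(i <oo) (w i * ell i ^+ k.+1)%:E =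
    \sum_(i <oo) (w i * ell i * ell i ^+ k)%:E.
  by apply: eq_eseriesr => i _; rewrite exprS mulrA.
apply: IH => [i||y y01]; rewrite ?mulr_ge0//.
pose v i := (w i * \prod_(l < k) (alpha i l <= y l <= alpha i l + ell i)%R%:R)%R.
have v0 i : (0 <= v i)%R by rewrite mulr_ge0// prodr_ge0.
have := @sum_interval_lengths v (alpha^~ k) ell a y0 v0 l0 a0 y00.
move=> /(_ _)/le_trans; apply=> [t t01|].
  pose y' l := if l == k then t else y l.
  have y'01 l : (0 <= y' l <= y0)%R by rewrite /y'; case: ifP.
  apply: (le_trans (h y' y'01)).
  apply: lee_nneseries => [i _ _|i _]; rewrite lee_fin.
    by rewrite mulr_ge0// prodr_ge0.
  rewrite big_ord_recr/= mulrA /y' eqxx /v; under eq_bigr do rewrite ltn_eqF//.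
  exact: lexx.
apply: lee_nneseries => [i _ _|i _]; rewrite lee_fin; first by rewrite mulr_ge0.
by rewrite /v mulrAC.
Qed.

End slicing.

(** * The torus and the splitting *)

Section torus_theory.
Context {R : realType} {d : nat}.
Implicit Types u v w : 'cV[R]_d.

Definition int_vector u := forall i, u i 0 \is a Num.int.

Lemma torus_piD_int u w : int_vector w -> torus_pi (u + w) = torus_pi u.
Proof.
move=> wZ; apply/torus_piP/int_equivP => i.
by rewrite mxE addrAC subrr add0r.
Qed.

Lemma torus_pi_eq u v : torus_pi u = torus_pi v ->
  exists2 w, int_vector w & u = v + w.
Proof.
move=> /torus_piP/int_equivP uv; exists (u - v); last by rewrite subrKC.
by move=> i; rewrite !mxE.
Qed.

Lemma int_vectorM (B : 'M[int]_d) w : int_vector w -> int_vector (real_mx B *m w).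
Proof.
by move=> wZ i; rewrite mxE; apply: rpred_sum => j _; rewrite mxE rpredM// intr_int.
Qed.

Lemma int_vectorX (B : 'M[int]_d) n w :
  int_vector w -> int_vector (real_mx B ^+ n *m w).
Proof.
move=> wZ; elim: n => [|n IH]; first by rewrite expr0 mul1mx.
by rewrite exprS -mulmxE -mulmxA; exact: int_vectorM.
Qed.

Lemma iter_torus_map (B : 'M[int]_d) n u :
  iter n (torus_map B) (torus_pi u) = torus_pi (real_mx B ^+ n *m u).
Proof.
elim: n => [|n IH]; first by rewrite expr0 mul1mx.
by rewrite iterS IH torus_map_pi exprS -mulmxE mulmxA.
Qed.

Lemma enorm_int_ge1 w : int_vector w -> w != 0 -> 1 <= enorm w.
Proof.
move=> wZ w0; have [i wi0] : exists i, w i 0 != 0.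
  apply/existsP; apply: contraNT w0 => /existsPn w0; apply/eqP/colP => i.
  by rewrite mxE; apply/eqP; rewrite -[_ == _]negbK; exact: w0.
by rewrite (le_trans _ (ler_coord_enorm w i))// norm_intr_ge1.
Qed.

(** Any other difference of lifts differs from [u - v] by a nonzero integer vector, of norm at least
    1, hence has norm at least 1/2. *)
Lemma torus_dist_chart u v :
  enorm (u - v) <= 1 / 2 -> torus_dist (torus_pi u) (torus_pi v) = enorm (u - v).
Proof.
move=> uv; apply/eqP; rewrite eq_le torus_dist_le/=.
apply: lb_le_inf; first exact: torus_dists_neq0.
move=> _ [[u' v']/= [/torus_pi_eq[m mZ ->] /torus_pi_eq[n nZ ->]] <-].
have -> : u + m - (v + n) = (u - v) - (n - m).
  by apply/matrixP => i j; rewrite !mxE; ring.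
have [->|nm] := eqVneq (n - m) 0; first by rewrite subr0.
have nm1 : 1 <= enorm (n - m).
  by apply: enorm_int_ge1 => // i; rewrite !mxE rpredB.
have : enorm (n - m) <= enorm (u - v) + enorm (u - v - (n - m)).
  have {1}-> : n - m = (u - v) - (u - v - (n - m)) by rewrite subKr.
  exact: ler_enormB.
by lra.
Qed.

Lemma fractional_part u : exists2 m, int_vector m & enorm (u - m) <= d%:R.
Proof.
exists (\col_i (Num.floor (u i 0))%:~R); first by move=> i; rewrite mxE intr_int.
rewrite -[leRHS]mulr1; apply: ler_enorm_coord => i; rewrite !mxE.
have := floor_le (u i 0); have := floorD1_gt (u i 0); rewrite intrD => h1 h2.
by rewrite ger0_norm; lra.
Qed.

End torus_theory.

Section splitting_theory.
Context {R : realType} {d : nat} {A : 'M[int]_d} {k : nat} {L : R}.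
Variable H : hyperbolic_splitting A k L.
Local Notation a := (real_mx A : 'M[R]_d).
Local Notation ai := (real_mx (Ainv H) : 'M[R]_d).
Local Notation Bu := (Bu H).
Local Notation Cu := (Cu H).
Local Notation Bs := (Bs H).
Local Notation Cs := (Cs H).

Lemma expX_mulmxK n m (v : 'M[R]_(d, m)) : ai ^+ n *m (a ^+ n *m v) = v.
Proof.
have h : ai *m a = 1%:M by rewrite -map_mxM mulVA map_mx1.
elim: n v => [|n IH] v; first by rewrite !expr0 !mul1mx.
by rewrite exprSr exprS -!mulmxE -!mulmxA (mulmxA ai a) h mul1mx IH.
Qed.

Lemma mulmx_expXK n m (v : 'M[R]_(d, m)) : a ^+ n *m (ai ^+ n *m v) = v.
Proof.
have h : a *m ai = 1%:M by rewrite -map_mxM mulAV map_mx1.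
elim: n v => [|n IH] v; first by rewrite !expr0 !mul1mx.
by rewrite exprSr exprS -!mulmxE -!mulmxA (mulmxA a ai) h mul1mx IH.
Qed.

Lemma CuBs : Cu *m Bs = 0.
Proof.
have : Bu *m Cu *m Bs + Bs *m Cs *m Bs = Bs by rewrite -mulmxDl BCuD mul1mx.
rewrite -(mulmxA Bs) CsBs mulmx1 -[X in _ = X]add0r => /addIr.
by move=> /(congr1 (mulmx Cu)); rewrite !mulmxA CuBu mul1mx mulmx0.
Qed.

Lemma CsBu : Cs *m Bu = 0.
Proof.
have : Bu *m Cu *m Bu + Bs *m Cs *m Bu = Bu by rewrite -mulmxDl BCuD mul1mx.
rewrite -(mulmxA Bu) CuBu mulmx1 -[X in _ = X]addr0 => /addrI.
by move=> /(congr1 (mulmx Cs)); rewrite !mulmxA CsBs mul1mx mulmx0.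
Qed.

Lemma split_vector (v : 'cV[R]_d) : v = Bu *m (Cu *m v) + Bs *m (Cs *m v).
Proof. by rewrite !mulmxA -mulmxDl BCuD mul1mx. Qed.

Lemma BCu_commX n : Bu *m Cu *m a ^+ n = a ^+ n *m (Bu *m Cu).
Proof.
elim: n => [|n IH]; first by rewrite expr0 mulmx1 mul1mx.
rewrite exprS -mulmxE (mulmxA (Bu *m Cu)) BCu_comm -(mulmxA a (Bu *m Cu)) IH.
exact: mulmxA.
Qed.

Lemma BCu_commV n : Bu *m Cu *m ai ^+ n = ai ^+ n *m (Bu *m Cu).
Proof.
have e : a ^+ n *m ai ^+ n = 1%:M by rewrite -[ai ^+ n]mulmx1 mulmx_expXK.
rewrite -[LHS](expX_mulmxK n) (mulmxA (a ^+ n)) -BCu_commX.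
by rewrite -(mulmxA (Bu *m Cu)) e mulmx1.
Qed.

Lemma BCsE : Bs *m Cs = 1%:M - Bu *m Cu.
Proof. by rewrite -(BCuD H) addrC addKr. Qed.

Lemma BCs_commV n : Bs *m Cs *m ai ^+ n = ai ^+ n *m (Bs *m Cs).
Proof. by rewrite BCsE mulmxBl mulmxBr BCu_commV mul1mx mulmx1. Qed.

Lemma coord_bound : exists2 C : R, 1 <= C & [/\
  forall (v : 'cV[R]_d) l, `|(Cu *m v) l 0| <= C * enorm v,
  forall (v : 'cV[R]_d) l, `|(Cs *m v) l 0| <= C * enorm v,
  forall (x : 'cV[R]_k) r, (forall l, `|x l 0| <= r) -> enorm (Bu *m x) <= C * r &
  forall (x : 'cV[R]_k) r, (forall l, `|x l 0| <= r) -> enorm (Bs *m x) <= C * r].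
Proof.
have [C1 C10 h1] := enorm_mulmx_bound Cu; have [C2 C20 h2] := enorm_mulmx_bound Cs.
have [C3 C30 h3] := enorm_mulmx_bound Bu; have [C4 C40 h4] := enorm_mulmx_bound Bs.
have k1 : 1 <= k%:R :> R by rewrite ler1n (k_gt0 H).
have k0 : 0 <= k%:R :> R by rewrite ler0n.
pose C := 1 + C1 + C2 + k%:R * (C3 + C4).
have p3 : 0 <= k%:R * C3 by rewrite mulr_ge0// ltW.
have p4 : 0 <= k%:R * C4 by rewrite mulr_ge0// ltW.
have r_ge0 (x : 'cV[R]_k) r : (forall l, `|x l 0| <= r) -> 0 <= r.
  by move=> /(_ (Ordinal (k_gt0 H))); exact: le_trans.
exists C; first by rewrite /C; lra.
split=> [v l|v l|x r xr|x r xr].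
- rewrite (le_trans (ler_coord_enorm _ _))// (le_trans (h1 v))// ler_wpM2r ?enorm_ge0//.
  by rewrite /C; lra.
- rewrite (le_trans (ler_coord_enorm _ _))// (le_trans (h2 v))// ler_wpM2r ?enorm_ge0//.
  by rewrite /C; lra.
- rewrite (le_trans (h3 x))// (@le_trans _ _ (C3 * (k%:R * r)))//.
    by rewrite ler_wpM2l ?ler_enorm_coord// ltW.
  by rewrite mulrA ler_wpM2r ?(r_ge0 x)// /C; lra.
- rewrite (le_trans (h4 x))// (@le_trans _ _ (C4 * (k%:R * r)))//.
    by rewrite ler_wpM2l ?ler_enorm_coord// ltW.
  by rewrite mulrA ler_wpM2r ?(r_ge0 x)// /C; lra.
Qed.

Lemma growth_coord delta : 0 < delta -> exists2 C : R, 1 <= C &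
  forall n (x : 'cV[R]_k),
    [/\ enorm (a ^+ n *m (Bu *m x)) <= C * expR ((L + delta) * n%:R) * enorm (Bu *m x),
        enorm (ai ^+ n *m (Bu *m x)) <= C * expR (- (L - delta) * n%:R) * enorm (Bu *m x),
        enorm (ai ^+ n *m (Bs *m x)) <= C * expR ((L + delta) * n%:R) * enorm (Bs *m x)
      & enorm (a ^+ n *m (Bs *m x)) <= C * expR (- (L - delta) * n%:R) * enorm (Bs *m x)].
Proof.
move=> /(growth H)[C C0 hC]; exists (C + 1); first by lra.
have CC t e : 0 <= e -> C * expR t * e <= (C + 1) * expR t * e.
  by move=> e0; rewrite -!mulrA ler_wpM2r ?mulr_ge0 ?expR_ge0//; lra.
move=> n x; have [h1 h2 _ _] := hC n (Bu *m x); have [_ _ h3 h4] := hC n (Bs *m x).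
rewrite -mulmxA (mulmxA Cu) CuBu mul1mx in h1 h2.
rewrite -mulmxA (mulmxA Cs) CsBs mul1mx in h3 h4.
by split; [move: h1|move: h2|move: h3|move: h4] => /le_trans; apply;
   rewrite CC// enorm_ge0.
Qed.

End splitting_theory.

(** * Covers and upper bounds *)

Section strip_cover.
Context {R : realType} {d : nat} {A : 'M[int]_d} {k : nat} {L : R}.
Variable H : hyperbolic_splitting A k L.

(** Up to integer vectors, the image of the point lifts to [zeta + e] with [enorm e < rho]. The
    inverse powers of [A] preserve integer vectors, so on the torus the preimage of the ball is a
    single strip. Its unstable width is kept whole; only the stable directions are cut, into slots
    of length [h]. *)
Lemma strip_cover delta : 0 < delta -> exists2 C : R, 1 <= C &
  forall (n : nat) (z : torus R d) (rho h : R), 0 < rho -> 0 < h ->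
  exists (N : nat) (w : nat -> 'cV[R]_d),
    N%:R <= (2 * (C * expR ((L + delta) * n%:R) * rho) / h + 1) ^+ k /\
    forall p, mdist (iter n (torus_map A) p) z < rho ->
    exists c (x y : 'cV[R]_k), [/\ (c < N)%N,
      p = torus_pi (w c + Bu H *m x + Bs H *m y),
      forall l, `|x l 0| <= C * expR (- (L - delta) * n%:R) * rho
    & forall l, 0 <= y l 0 <= h].
Proof.
move=> /(growth H)[C1 C10 hC]; have [C2 C21 [cu cs _ _]] := coord_bound H.
have C20 : 0 < C2 by rewrite (lt_le_trans ltr01).
exists (C2 * C1 + 1); first by rewrite lerDr mulr_ge0// ltW.
move=> n z rho h rho0 h0.
(* [Y] bounds the stable coordinates, so [m] slots of length [h] cover the range from [- Y] to [Y]
   in each of them. *)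
set Y := _ * rho; pose m := (Num.truncn (2 * Y / h)).+1.
have Y0 : 0 <= Y.
  by rewrite /Y !mulr_ge0 ?expR_ge0 ?(ltW rho0)// addr_ge0// mulr_ge0// ltW.
have Yh0 : 0 <= 2 * Y / h by exact: divr_ge0 (mulr_ge0 (ler0n _ 2) Y0) (ltW h0).
have /andP[m1 m2] := truncn_itv Yh0.
pose J := {ffun 'I_k -> 'I_m}.
pose f (c : nat) : J := nth [ffun=> ord0] (enum J) c.
pose zeta := torus_repr z.
pose w c := real_mx (Ainv H) ^+ n *m zeta + Bs H *m \col_l (h * (f c l)%:R - Y).
exists #|J|, w; split.
  rewrite card_ffun !card_ord natrX lerXn2r ?nnegrE ?addr_ge0//.
  by rewrite /m -natr1 lerD2r.
move=> p; rewrite -(torus_reprK p) iter_torus_map -[z]torus_reprK.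
move=> /torus_dist_lt[u [v [/torus_pi_eq[mu muZ uE] /torus_pi_eq[mv mvZ vE] uv]]].
pose e := u - v; pose x := Cu H *m (real_mx (Ainv H) ^+ n *m e).
pose y := Cs H *m (real_mx (Ainv H) ^+ n *m e).
have [_ g1 g2 _] := hC n e.
have ele : enorm e <= rho by exact: ltW.
have xle l : `|x l 0| <= (C2 * C1 + 1) * expR (- (L - delta) * n%:R) * rho.
  have -> : x = Cu H *m (real_mx (Ainv H) ^+ n *m (Bu H *m Cu H *m e)).
    rewrite (mulmxA _ (Bu H *m Cu H)) -BCu_commV -!mulmxA (mulmxA (Cu H)).
    by rewrite CuBu mul1mx.
  rewrite (le_trans (cu _ _))// (le_trans (ler_wpM2l (ltW C20) g1))//.
  rewrite !mulrA ler_pM ?enorm_ge0 ?mulr_ge0 ?expR_ge0 ?(ltW C20) ?(ltW C10)//.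
  by rewrite ler_wpM2r ?expR_ge0//; lra.
have yle l : `|y l 0| <= Y.
  have -> : y = Cs H *m (real_mx (Ainv H) ^+ n *m (Bs H *m Cs H *m e)).
    rewrite (mulmxA _ (Bs H *m Cs H)) -BCs_commV -!mulmxA (mulmxA (Cs H)).
    by rewrite CsBs mul1mx.
  rewrite (le_trans (cs _ _))// (le_trans (ler_wpM2l (ltW C20) g2))//.
  rewrite !mulrA ler_pM ?enorm_ge0 ?mulr_ge0 ?expR_ge0 ?(ltW C20) ?(ltW C10)//.
  by rewrite ler_wpM2r ?expR_ge0//; lra.
have yh0 l : 0 <= (y l 0 + Y) / h.
  by have := yle l; rewrite ler_norml => /andP[? _]; rewrite divr_ge0 ?(ltW h0)//; lra.
have jP l : (Num.truncn ((y l 0 + Y) / h)%R < m)%N.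
  rewrite -(ltr_nat R); have /andP[j1 _] := truncn_itv (yh0 l).
  apply: (le_lt_trans j1); apply: le_lt_trans m2.
  rewrite ler_pM2r ?invr_gt0//.
  by have := yle l; rewrite ler_norml => /andP[_ ?]; lra.
pose j : J := [ffun l => Ordinal (jP l)].
have jJ : j \in enum J by rewrite mem_enum.
exists (index j (enum J)), x, (y - \col_l (h * (j l)%:R - Y)); split => //.
- by rewrite cardE index_mem.
- have -> : torus_repr p = (w (index j (enum J)) + Bu H *m x +
      Bs H *m (y - \col_l (h * (j l)%:R - Y))) +
      real_mx (Ainv H) ^+ n *m (mv - mu).
    rewrite -[LHS](expX_mulmxK H n).
    have -> : real_mx A ^+ n *m torus_repr p = zeta + e + (mv - mu).
      by rewrite /e uE vE /zeta; apply/matrixP => i l; rewrite !mxE; ring.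
    rewrite (mulmxDr _ (zeta + e)); congr (_ + _).
    rewrite (mulmxDr _ zeta e) (split_vector H (_ *m e)) -/x -/y.
    rewrite /w /f nth_index// mulmxBr.
    move: (_ *m zeta) (_ *m x) (_ *m y) (_ *m \col_l _) => v1 v2 v3 v4.
    by apply/matrixP => i l; rewrite !mxE; ring.
  apply: torus_piD_int; apply: int_vectorX => i.
  by rewrite !mxE rpredB.
move=> l; rewrite mxE [X in y l 0 + X]mxE [X in y l 0 - X]mxE ffunE/=.
have /andP[j1 j2] := truncn_itv (yh0 l).
rewrite ler_pdivlMr// in j1; rewrite ltr_pdivrMr// -natr1 in j2.
by apply/andP; split; lra.
Qed.

End strip_cover.

(** * Countable covers and their sums *)

Section countable_families.
Context {R : realType}.
Local Open Scope ereal_scope.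

(** Covers are indexed by subsets of [nat], whereas those built here are indexed by pairs [(n, c)]
    with [c < N n]; [pickle] flattens the pairs. *)
Lemma esum_pairs (n0 : nat) (N : nat -> nat) :
  exists (I : set nat) (g : nat -> nat * nat), [/\
    forall i, I i -> (n0 <= (g i).1)%N /\ ((g i).2 < N (g i).1)%N,
    forall n c, (n0 <= n)%N -> (c < N n)%N -> exists2 i, I i & g i = (n, c) &
    forall (F : nat -> nat -> \bar R) (w : nat -> R), (forall n, 0 <= w n)%R ->
      (forall n c, (n0 <= n)%N -> (c < N n)%N -> 0 <= F n c <= (w n)%:E) ->
      \esum_(i in I) F (g i).1 (g i).2 <= \sum_(n0 <= n <oo) ((N n)%:R * w n)%:E].
Proof.
pose B : set (nat * nat) := [set n | (n0 <= n)%N] `*`` (fun n => `I_(N n)).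
pose g i : nat * nat := odflt (0, 0)%N (unpickle i).
have gK p : g (pickle p) = p by rewrite /g pickleK.
exists (pickle @` B), g; split.
- by move=> _ [p [h1 h2] <-]; rewrite gK.
- by move=> n c h1 h2; exists (pickle (n, c)); [exists (n, c)|rewrite gK].
move=> F w w0 hF.
rewrite (reindex_esum B _ pickle); last first.
  split; [by move=> p Bp; exists p| |by move=> _ [p Bp <-]; exists p].
  by move=> p q _ _ /(congr1 g); rewrite !gK.
under eq_esum do rewrite gK.
rewrite -esum_esum; last by move=> i j h1 h2; have /andP[] := hF _ _ h1 h2.
rewrite eseries_cond [leRHS]nneseries_esum; last first.
  by move=> n h; rewrite lee_fin mulr_ge0.
apply: le_esum => n h.
rewrite esum_fset//; last first.
  by move=> c /[!inE] hc; have /andP[] := hF _ _ h hc.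
rewrite -fsbig_ord (@le_trans _ _ (\sum_(c < N n) (w n)%:E))//.
  by apply: lee_sum => c _; have /andP[] := hF _ _ h (ltn_ord c).
by rewrite sumEFin sumr_const card_ord mulr_natl.
Qed.

Lemma geometric_tail (K q e : R) : (0 <= K)%R -> (0 <= q < 1)%R -> (0 < e)%R ->
  exists n1, forall n0, (n1 <= n0)%N -> \sum_(n0 <= n <oo) (K * q ^+ n)%:E <= e%:E.
Proof.
move=> K0 /andP[q0 q1] e0.
have f0 n : 0 <= (K * q ^+ n)%:E by rewrite lee_fin mulr_ge0// exprn_ge0.
have fin : \sum_(0 <= n <oo) (K * q ^+ n)%:E < +oo.
  have -> : \sum_(0 <= n <oo) (K * q ^+ n)%:E = (K * (1 - q)^-1)%:E.
    apply/cvg_lim => //.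
    have -> : (fun n => \sum_(0 <= i < n) (K * q ^+ i)%:E) =
        EFin \o series (geometric K q).
      by apply/funext => n; rewrite /= /series/= sumEFin.
    apply: cvg_EFin; first exact: nearW.
    by apply: cvg_geometric_series; rewrite ger0_norm.
  exact: ltry.
have := nneseries_tail_cvg fin (fun n _ => f0 n).
move=> /fine_cvgP[[m1 _ hm1]] /cvgrPdist_le/(_ _ e0)[m2 _ hm2].
exists (maxn m1 m2) => n0; rewrite geq_max => /andP[h1 h2].
have := hm2 n0 h2; rewrite sub0r normrN /= => h3.
have fn := hm1 n0 h1; rewrite /= in fn.
by rewrite -(fineK fn) lee_fin; exact: le_trans (ler_norm _) h3.
Qed.

End countable_families.

Section asymptotics.
Context {R : realType}.

Lemma linear_large (g B : R) : 0 < g ->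
  exists n0, forall n, (n0 <= n)%N -> B <= g * n%:R.
Proof.
move=> g0; exists (Num.truncn (`|B| / g)).+1 => n; rewrite -(ler_nat R) => h.
have Bg : 0 <= `|B| / g by rewrite divr_ge0// ltW.
have /andP[_ h2] := truncn_itv Bg.
have : `|B| / g <= n%:R by rewrite (le_trans (ltW h2)).
rewrite ler_pdivrMr// mulrC; exact: le_trans (ler_norm _).
Qed.

Lemma expR_decay (K g e : R) : 0 < K -> g < 0 -> 0 < e ->
  exists n0, forall n, (n0 <= n)%N -> K * expR (g * n%:R) <= e.
Proof.
move=> K0 g0 e0; have [|n0 h] := @linear_large (- g) (ln (K / e)); first by rewrite oppr_gt0.
exists n0 => n /h; rewrite -(ler_expR (ln _)) lnK ?posrE ?divr_gt0//.
rewrite mulNr expRN ler_pdivrMr// => h1.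
by rewrite -ler_pdivlMr ?expR_gt0// mulrC.
Qed.

End asymptotics.

Section upper_criteria.
Context {R : realType} {X : metricType R}.
Implicit Types (E U : set X) (f : X -> X).
Local Open Scope ereal_scope.

Lemma diam_le U (D : R) : (0 <= D)%R ->
  (forall p q, U p -> U q -> (mdist p q <= D)%R) -> diam U <= D%:E.
Proof.
move=> D0 UD; rewrite /diam ge_max lee_fin D0/=.
by apply: ge_ereal_sup => _ [[p q] [/= Up Uq] <-]; rewrite lee_fin; exact: UD.
Qed.

Lemma mdist_diam U p q : U p -> U q -> (mdist p q)%:E <= diam U.
Proof.
by move=> Up Uq; rewrite /diam le_max ereal_sup_ubound ?orbT//; exists (p, q).
Qed.

Lemma diam_ge0 U : 0 <= diam U.
Proof. by rewrite /diam le_max lexx. Qed.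

Lemma poweR_diam_le U (D s : R) : (0 < s)%R -> diam U <= D%:E ->
  poweR (diam U) s <= (D `^ s)%:E.
Proof.
move=> s0; have := diam_ge0 U; case: (diam U) => [r| |]//=.
rewrite !lee_fin => r0 rD; rewrite ge0_ler_powR ?nnegrE//; first exact: ltW.
exact: le_trans rD.
Qed.

Lemma hausdorff_premeasure_ge0 E s delta : 0 <= hausdorff_premeasure E s delta.
Proof.
apply: le_ereal_inf_tmp => _ [I [U [_ _ ->]]].
by apply: esum_ge0 => i _; exact: poweR_ge0.
Qed.

Lemma hausdorff_measure_eq0 E s :
  (forall delta : R, (0 < delta)%R -> hausdorff_premeasure E s delta = 0) ->
  hausdorff_measure E s = 0.
Proof.
move=> h; apply: lim_near_cst => //; near=> delta; apply: h.
by near: delta; exact: nbhs_right_gt.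
Unshelve. all: by end_near. Qed.

(** A Borel-Cantelli argument: every point of [E] lies in pieces of arbitrarily high level, so the
    tail families are still covers, and their sums are tails of a geometric series. *)
Lemma hausdorff_null E (s : R) (N : nat -> nat) (U : nat -> nat -> set X)
    (D : nat -> R) (K q : R) (n1 : nat) :
  (0 < s)%R -> (0 <= K)%R -> (0 <= q < 1)%R ->
  (forall n c, (n1 <= n)%N -> (c < N n)%N -> diam (U n c) <= (D n)%:E) ->
  (forall n, (n1 <= n)%N -> ((N n)%:R * D n `^ s <= K * q ^+ n)%R) ->
  (forall delta, (0 < delta)%R ->
     exists n2, forall n, (n2 <= n)%N -> (D n <= delta)%R) ->
  (forall n0 p, (n1 <= n0)%N -> E p ->
     exists n c, [/\ (n0 <= n)%N, (c < N n)%N & U n c p]) ->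
  hausdorff_measure E s = 0.
Proof.
move=> s0 K0 q01 UD ND D0 EU; apply: hausdorff_measure_eq0 => delta d0.
apply/eqP; rewrite eq_le hausdorff_premeasure_ge0 andbT.
apply/lee_addgt0Pr => e e0; rewrite add0e.
have [n3 h3] := geometric_tail K0 q01 e0; have [n2 h2] := D0 _ d0.
pose n0 := maxn n1 (maxn n2 n3).
have [h01 h02 h03] : [/\ n1 <= n0, n2 <= n0 & n3 <= n0]%N.
  by rewrite /n0 !leq_max !leqnn !orbT.
have [I [g [gI Ig gsum]]] := @esum_pairs R n0 N.
apply: le_trans (h3 _ h03).
apply: (@le_trans _ _ (\esum_(i in I) poweR (diam (U (g i).1 (g i).2)) s)).
  apply: ereal_inf_lbound; exists I, (fun i => U (g i).1 (g i).2); split => //.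
    move=> i /gI[i1 i2]; apply: le_trans (UD _ _ (leq_trans h01 i1) i2) _.
    by rewrite lee_fin h2// (leq_trans h02).
  move=> p Ep; have [n [c [nn0 cN Up]]] := EU n0 p h01 Ep.
  by have [i Ii gi] := Ig _ _ nn0 cN; exists i => //=; rewrite gi.
apply: (le_trans (gsum (fun n c => poweR (diam (U n c)) s) (fun n => D n `^ s)%R _ _)).
- by move=> n; exact: powR_ge0.
- move=> n c nn0 cN; rewrite poweR_ge0/=; apply: poweR_diam_le => //.
  exact: UD (leq_trans h01 nn0) cN.
rewrite eseries_cond [leRHS]eseries_cond; apply: lee_nneseries.
  by move=> *; rewrite lee_fin mulr_ge0// powR_ge0.
by move=> n nn0; rewrite lee_fin ND// (leq_trans h01).
Qed.

Lemma bowen_premeasure_ge0 f E (s e : R) M : 0 <= bowen_premeasure f E s e M.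
Proof.
apply: le_ereal_inf_tmp => _ [I [x [n [_ _ ->]]]].
by apply: esum_ge0 => i _; rewrite lee_fin expR_ge0.
Qed.

(** The same tail argument, with pieces of level [n] contained in Bowen balls of length [T n]. *)
Lemma bowen_null f E (s e : R) (N T : nat -> nat) (w : nat -> nat -> X)
    (U : nat -> nat -> set X) (K q : R) (n1 : nat) :
  (0 <= K)%R -> (0 <= q < 1)%R ->
  (forall n c, (n1 <= n)%N -> (c < N n)%N -> U n c `<=` bowen_ball f (T n) (w n c) e) ->
  (forall n, (n1 <= n)%N -> ((N n)%:R * expR (- s * (T n)%:R) <= K * q ^+ n)%R) ->
  (forall M, exists n2, forall n, (n2 <= n)%N -> (M <= T n)%N) ->
  (forall n0 p, (n1 <= n0)%N -> E p ->
     exists n c, [/\ (n0 <= n)%N, (c < N n)%N & U n c p]) ->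
  bowen_measure f E s e = 0.
Proof.
move=> K0 q01 UB NT TM EU; apply: lim_near_cst => //; apply: nearW => M.
apply/eqP; rewrite eq_le bowen_premeasure_ge0 andbT.
apply/lee_addgt0Pr => r r0; rewrite add0e.
have [n3 h3] := geometric_tail K0 q01 r0; have [n2 h2] := TM M.
pose n0 := maxn n1 (maxn n2 n3).
have [h01 h02 h03] : [/\ n1 <= n0, n2 <= n0 & n3 <= n0]%N.
  by rewrite /n0 !leq_max !leqnn !orbT.
have [I [g [gI Ig gsum]]] := @esum_pairs R n0 N.
apply: le_trans (h3 _ h03).
apply: (@le_trans _ _ (\esum_(i in I) (expR (- s * (T (g i).1)%:R))%:E)).
  apply: ereal_inf_lbound.
  exists I, (fun i => w (g i).1 (g i).2), (fun i => T (g i).1); split => //.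
    by move=> i /gI[i1 i2]; rewrite h2// (leq_trans h02).
  move=> p Ep; have [n [c [nn0 cN Up]]] := EU n0 p h01 Ep.
  have [i Ii gi] := Ig _ _ nn0 cN; exists i => //=; rewrite gi.
  exact: UB (leq_trans h01 nn0) cN _ Up.
apply: (le_trans (gsum (fun n c => (expR (- s * (T n)%:R))%:E)
  (fun n => expR (- s * (T n)%:R))%R _ _)).
- by move=> n; exact: expR_ge0.
- by move=> n c _ _; rewrite lexx lee_fin expR_ge0.
rewrite eseries_cond [leRHS]eseries_cond; apply: lee_nneseries.
  by move=> *; rewrite lee_fin mulr_ge0// expR_ge0.
by move=> n nn0; rewrite lee_fin NT// (leq_trans h01).
Qed.

End upper_criteria.

Lemma infinite_set_large (B : set nat) n0 : infinite_set B ->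
  exists2 n, (n0 <= n)%N & B n.
Proof.
move=> Binf; apply: contrapT => h; apply: Binf.
apply: (sub_finite_set _ (finite_II n0)) => n Bn /=.
by rewrite ltnNge; apply/negP => n0n; apply: h; exists n.
Qed.

Section upper_bounds.
Context {R : realType} {d : nat} {A : 'M[int]_d} {k : nat} {L : R}.
Variable H : hyperbolic_splitting A k L.
Variables (phi : nat -> R) (z : nat -> torus R d) (t : R) (n1 : nat).
Hypothesis phi_le : forall n, (n1 <= n)%N -> phi n <= expR (- t * n%:R).

Variable S : set (torus R d).
Hypothesis S_sub : S `<=` shrinking_target (torus_map A) phi z.

Let strip_family delta (h : nat -> R) : 0 < delta -> (forall n, 0 < h n) ->
  exists2 C : R, 1 <= C & exists (N : nat -> nat) (w : nat -> nat -> 'cV[R]_d),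
  let U n c := [set p : torus R d | exists x y : 'cV[R]_k,
      [/\ p = torus_pi (w n c + Bu H *m x + Bs H *m y),
          forall l, `|x l 0| <= C * expR (- (L - delta + t) * n%:R)
        & forall l, 0 <= y l 0 <= h n]] in
  (forall n, (N n)%:R <= (2 * (C * expR ((L + delta - t) * n%:R)) / h n + 1) ^+ k) /\
  (forall n0 p, (n1 <= n0)%N -> S p ->
     exists n c, [/\ (n0 <= n)%N, (c < N n)%N & U n c p]).
Proof.
move=> d0 h0; have [C C1 hC] := strip_cover H d0; exists C => //.
have /choice[Nw NwP] : forall n, exists Nw : nat * (nat -> 'cV[R]_d),
    Nw.1%:R <= (2 * (C * expR ((L + delta) * n%:R) * expR (- t * n%:R)) / h n + 1) ^+ k /\
    forall p, mdist (iter n (torus_map A) p) (z n) < expR (- t * n%:R) ->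
    exists c (x y : 'cV[R]_k), [/\ (c < Nw.1)%N,
      p = torus_pi (Nw.2 c + Bu H *m x + Bs H *m y),
      forall l, `|x l 0| <= C * expR (- (L - delta) * n%:R) * expR (- t * n%:R)
    & forall l, 0 <= y l 0 <= h n].
  move=> n; have [N [w [h1 h2]]] := hC n (z n) _ _ (expR_gt0 (- t * n%:R)) (h0 n).
  by exists (N, w).
exists (fun n => (Nw n).1), (fun n => (Nw n).2) => /=; split.
  move=> n; have [+ _] := NwP n; rewrite -(mulrA C) -expRD -mulrDl.
  by [].
move=> n0 p h01 Sp; have [n h0n /= pn] := infinite_set_large n0 (S_sub Sp).
have [_] := NwP n => /(_ p (lt_le_trans pn (phi_le (leq_trans h01 h0n)))).
move=> [c [x [y [cN pE hx hy]]]]; exists n, c; split => //.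
exists x, y; split => // l; have := hx l; rewrite -(mulrA C) -expRD -mulrDl.
by rewrite -opprD.
Qed.

(** [eta] is the exponential rate of the size of the pieces. It must dominate the unstable width;
    the stable directions are cut into about e^(k(L + delta - t - eta)n) cubes, and the last
    hypothesis makes their number times their size to the power [s] decay. *)
Let hausdorff_upper_gen s delta eta : 0 < s -> 0 < delta -> eta < 0 ->
  - (L - delta + t) <= eta -> 0 <= L + delta - t - eta ->
  k%:R * (L + delta - t - eta) + s * eta < 0 -> hausdorff_measure S s = 0%E.
Proof.
move=> s0 d0 eta0 h1 h2 h3.
have [C C1 [N [w /= [NP SP]]]] := strip_family d0 (fun n => expR_gt0 (eta * n%:R)).
have [C2 C21 [_ _ cu cs]] := coord_bound H.
pose K := 2 * C + 1; pose D n := C2 * K * expR (eta * n%:R).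
have C0 : 0 < C by rewrite (lt_le_trans ltr01).
have C20 : 0 < C2 by rewrite (lt_le_trans ltr01).
have K0 : 0 < K by rewrite /K; lra.
have CK0 : 0 < C2 * K by rewrite mulr_gt0.
pose g := k%:R * (L + delta - t - eta) + s * eta.
have q01 : 0 <= expR g < 1 by rewrite expR_ge0/= -expR0 ltr_expR.
have D0 n : 0 <= D n by rewrite mulr_ge0 ?expR_ge0// ltW.
apply: (hausdorff_null (N := N) (D := D) (n1 := n1)
  (K := K ^+ k * (C2 * K) `^ s) s0 _ q01 _ _ _ SP).
- by rewrite mulr_ge0 ?powR_ge0// exprn_ge0// ltW.
- move=> n c _ _; apply: diam_le => // p q.
  move=> [x [y [-> hx hy]]] [x' [y' [-> hx' hy']]].
  rewrite (le_trans (torus_dist_le _ _))//.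
  have -> : w n c + Bu H *m x + Bs H *m y - (w n c + Bu H *m x' + Bs H *m y') =
      Bu H *m (x - x') + Bs H *m (y - y').
    rewrite !mulmxBr; move: (_ *m x) (_ *m x') (_ *m y) (_ *m y') => v1 v2 v3 v4.
    by apply/matrixP => i l; rewrite !mxE; ring.
  rewrite (le_trans (ler_enormD _ _))//.
  have e1 : expR (- (L - delta + t) * n%:R) <= expR (eta * n%:R).
    by rewrite ler_expR ler_wpM2r.
  have b1 : enorm (Bu H *m (x - x')) <= C2 * (2 * C * expR (eta * n%:R)).
    apply: cu => l; rewrite !mxE (le_trans (ler_normB _ _))//.
    have := hx l; have := hx' l; have := ler_wpM2l (ltW C0) e1.
    by lra.
  have b2 : enorm (Bs H *m (y - y')) <= C2 * expR (eta * n%:R).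
    apply: cs => l; rewrite !mxE ler_norml.
    by have /andP[? ?] := hy l; have /andP[? ?] := hy' l; apply/andP; split; lra.
  by rewrite /D /K; lra.
- move=> n _; rewrite /D (powRM _ (ltW CK0) (expR_ge0 _)).
  rewrite -expRM -expRM_natr.
  have Nle : (N n)%:R <= K ^+ k * expR ((L + delta - t - eta) * n%:R * k%:R).
    rewrite (le_trans (NP n))// (expRM_natr k) -exprMn lerXn2r ?nnegrE//.
    - by rewrite addr_ge0// divr_ge0 ?expR_ge0// !mulr_ge0 ?expR_ge0// ltW.
    - by rewrite mulr_ge0 ?expR_ge0// ltW.
    - have -> : 2 * (C * expR ((L + delta - t) * n%:R)) / expR (eta * n%:R) =
          2 * C * expR ((L + delta - t - eta) * n%:R).
        rewrite -!mulrA -expRN -expRD; congr (_ * (_ * expR _)); ring.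
      rewrite /K [leRHS]mulrDl mul1r lerD2l -expR0 ler_expR.
      by rewrite mulr_ge0.
  apply: le_trans (ler_wpM2r _ Nle) _; first by rewrite mulr_ge0 ?powR_ge0 ?expR_ge0.
  rewrite mulrACA -expRD.
  have -> : (L + delta - t - eta) * n%:R * k%:R + eta * n%:R * s = g * n%:R.
    by rewrite /g; ring.
  by [].
- move=> e e0; have [n2 h] := expR_decay CK0 eta0 e0.
  by exists n2.
Qed.

Lemma hausdorff_upper s : - L < t -> 2 * L * k%:R < s * (L + t) ->
  hausdorff_measure S s = 0%E.
Proof.
move=> tL sL; have Lt : 0 < L + t by rewrite addrC -ltrBlDr sub0r.
have L0 := L_gt0 H; have k0 : 0 < k%:R :> R by rewrite ltr0n (k_gt0 H).
have s0 : 0 < s.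
  by rewrite -(pmulr_lgt0 _ Lt) (lt_trans _ sL)// !mulr_gt0.
pose delta := (s * (L + t) - 2 * L * k%:R) / (2 * s).
have d0 : 0 < delta by rewrite divr_gt0 ?mulr_gt0// subr_gt0.
have sd : s * delta = (s * (L + t) - 2 * L * k%:R) / 2.
  by rewrite /delta; field; rewrite gt_eqF.
have p0 : 0 < L - delta + t.
  rewrite -(pmulr_rgt0 _ s0) mulrDr mulrBr sd.
  have : 0 < 2 * L * k%:R by rewrite !mulr_gt0.
  by lra.
(* The cubes have the size of the unstable width, so their number has rate [2 L k]; [delta] spends
   half of the slack in the hypothesis. *)
apply: (hausdorff_upper_gen (delta := delta) (eta := - (L - delta + t))) => //.
- by rewrite oppr_lt0.
- by lra.
- by lra.
Qed.

(** Beyond [L] the stable width shrinks too. The chosen [delta] and [eta] give the number of pieces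
    rate 0, so any positive [s] suffices. *)
Lemma hausdorff_upper0 s : 0 < s -> L < t -> hausdorff_measure S s = 0%E.
Proof.
move=> s0 tL; have L0 := L_gt0 H.
apply: (hausdorff_upper_gen (delta := (t - L) / 2) (eta := (L - t) / 2)) => //.
- by lra.
- by lra.
- by lra.
- by lra.
- rewrite (_ : L + (t - L) / 2 - t - (L - t) / 2 = 0); last by lra.
  by rewrite mulr0 add0r pmulr_rlt0//; lra.
Qed.

(** A strip of unstable width e^(-(L+t)n) stays small for about (1 + t/L)n steps, and stable pieces
    of a fixed width [h] stay small forever. About e^(k(L-t)n) Bowen balls of that length suffice,
    whence the critical exponent kL(L-t)/(L+t). *)
Lemma bowen_upper s e : 0 < e -> - L < t -> t < L ->
  k%:R * (L - t) * L < s * (L + t) ->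
  bowen_measure (torus_map A) S s e = 0%E.
Proof.
move=> e0 tL1 tL2 sL; have L0 := L_gt0 H.
have k0 : 0 < k%:R :> R by rewrite ltr0n (k_gt0 H).
have Lt : 0 < L + t by lra.
have s0 : 0 < s.
  by rewrite -(pmulr_lgt0 _ Lt) (lt_trans _ sL)// !mulr_gt0// subr_gt0.
pose G := s * (L + t) - k%:R * (L - t) * L.
have G0 : 0 < G by rewrite subr_gt0.
(* With denominators cleared, the condition [g < 0] below takes at most [delta * Q] from the gap
   [G]; [3 L + 1] bounds [2 L - t + delta]. *)
pose Q := k%:R * (3 * L + 1) + 2 * s.
have Q0 : 0 < Q by rewrite addr_gt0// mulr_gt0//; lra.
pose delta := Num.min (Num.min 1 (L / 2)) (Num.min ((L + t) / 4) (G / (2 * Q))).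
have d0 : 0 < delta.
  by rewrite !lt_min !divr_gt0//= ?mulr_gt0//; lra.
have d1 : delta <= 1 by rewrite !ge_min lexx.
have dL : delta <= L / 2 by rewrite !ge_min lexx orbT.
have dLt : delta <= (L + t) / 4 by rewrite !ge_min lexx !orbT.
have dG : delta * Q <= G / 2.
  rewrite -ler_pdivlMr//; have -> : G / 2 / Q = G / (2 * Q) by field; rewrite gt_eqF.
  by rewrite !ge_min lexx !orbT.
clearbody delta.
have [Cg Cg1 hCg] := growth_coord H d0.
have [C2 C21 [_ _ cu cs]] := coord_bound H.
have Cg0 : 0 < Cg by rewrite (lt_le_trans ltr01).
have C20 : 0 < C2 by rewrite (lt_le_trans ltr01).
pose h := e / (4 * (Cg * C2)).
have CC0 : 0 < Cg * C2 by rewrite mulr_gt0.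
have h0 : 0 < h by rewrite divr_gt0// mulr_gt0.
have [C C1 [N [w /= [NP SP]]]] := strip_family d0 (fun=> h0).
have C0 : 0 < C by rewrite (lt_le_trans ltr01).
(* Solves [(L + delta) theta - (L - delta + t) = - delta]: up to time [theta n] the unstable
   displacement is at most a constant times e^(-delta n). *)
pose theta := (L - 2 * delta + t) / (L + delta).
have Ld : 0 < L + delta by rewrite addr_gt0.
have theta0 : 0 < theta by rewrite divr_gt0//; lra.
pose T n := Num.truncn (theta * n%:R).
have T1 n : (T n)%:R <= theta * n%:R.
  by have /andP[] := truncn_itv (mulr_ge0 (ltW theta0) (ler0n R n)).
have T2 n : theta * n%:R < (T n)%:R + 1.
  by have /andP[_] := truncn_itv (mulr_ge0 (ltW theta0) (ler0n R n)); rewrite natr1.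
pose K1 := 2 * C / h + 1.
have K10 : 0 < K1 by rewrite addr_gt0// divr_gt0// mulr_gt0.
pose g := k%:R * (L + delta - t) - s * theta.
have g0 : g < 0.
  rewrite subr_lt0 /theta mulrA ltr_pdivlMr//.
  have kd : 0 <= k%:R * delta by rewrite mulr_ge0// ltW.
  have h1 : k%:R * delta * (2 * L - t + delta) <= k%:R * delta * (3 * L + 1).
    by rewrite ler_wpM2l//; lra.
  by move: dG G0 h1; rewrite /Q /G; lra.
have q01 : 0 <= expR g < 1 by rewrite expR_ge0/= -expR0 ltr_expR.
have [n2 hn2] : exists n2, forall n, (n2 <= n)%N ->
    Cg * C2 * C * expR (- delta * n%:R) <= e / 4.
  by apply: expR_decay; rewrite ?mulr_gt0 ?oppr_lt0 ?divr_gt0.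
pose n3 := maxn n1 n2.
have SP3 n0 p (h3 : (n3 <= n0)%N) := SP n0 p (leq_trans (leq_maxl n1 n2) h3).
apply: (bowen_null (N := N) (T := T) (w := fun n c => torus_pi (w n c)) (n1 := n3)
  (K := K1 ^+ k * expR s) _ q01 _ _ _ SP3).
- by rewrite mulr_ge0 ?expR_ge0// exprn_ge0// ltW.
- move=> n c nn3 cN p [x [y [-> hx hy]]] i iT.
  rewrite !iter_torus_map (le_lt_trans (torus_dist_le _ _))//.
  rewrite -!addrA !mulmxDr opprD addNKr -enormN opprK.
  rewrite (le_lt_trans (ler_enormD _ _))//.
  have [g1 _ _ _] := hCg i x; have [_ _ _ g4] := hCg i y.
  have b1 : enorm (real_mx A ^+ i *m (Bu H *m x)) <= e / 4.
    rewrite (le_trans g1)//.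
    apply: le_trans (hn2 n _); last by rewrite (leq_trans _ nn3)// leq_maxr.
    apply: le_trans (ler_wpM2l _ (cu _ _ hx)) _.
      by rewrite mulr_ge0 ?expR_ge0// ltW.
    rewrite [X in X <= _](_ : _ = Cg * C2 * C *
      (expR ((L + delta) * i%:R) * expR (- (L - delta + t) * n%:R))); last by ring.
    have CCC : 0 <= Cg * C2 * C by rewrite ltW// !mulr_gt0.
    rewrite ler_wpM2l// -expRD ler_expR.
    have iT' : i%:R <= theta * n%:R.
      by apply: le_trans (T1 n); rewrite ler_nat ltnW.
    have := ler_wpM2l (ltW Ld) iT'.
    have thE : (L + delta) * theta = L - 2 * delta + t.
      by rewrite /theta; field; rewrite gt_eqF.
    by rewrite mulrA thE; lra.
  have b2 : enorm (real_mx A ^+ i *m (Bs H *m y)) <= e / 4.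
    rewrite (le_trans g4)//.
    have hy' l : `|y l 0| <= h by have /andP[? ?] := hy l; rewrite ger0_norm.
    apply: le_trans (ler_wpM2l _ (cs _ _ hy')) _.
      by rewrite mulr_ge0 ?expR_ge0// ltW.
    have E1 : expR (- (L - delta) * i%:R) <= 1.
      by rewrite -expR0 ler_expR mulr_le0_ge0// oppr_le0; lra.
    have -> : e / 4 = Cg * 1 * (C2 * h).
      by rewrite /h; field; rewrite !gt_eqF.
    have C2h : 0 <= C2 * h by rewrite ltW// mulr_gt0.
    by rewrite ler_wpM2r// ler_wpM2l// ltW.
  by lra.
- move=> n _; rewrite -expRM_natr.
  have Nle : (N n)%:R <= K1 ^+ k * expR ((L + delta - t) * n%:R * k%:R).
    rewrite (le_trans (NP n))// (expRM_natr k) -exprMn lerXn2r ?nnegrE//.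
    - by rewrite addr_ge0// divr_ge0 ?(ltW h0)// !mulr_ge0 ?expR_ge0// ltW.
    - by rewrite mulr_ge0 ?expR_ge0// ltW.
    - rewrite /K1 [leRHS]mulrDl mul1r mulrA [X in X + 1]mulrAC lerD2l -expR0 ler_expR.
      by rewrite mulr_ge0//; lra.
  apply: le_trans (ler_wpM2r (expR_ge0 _) Nle) _.
  rewrite -!mulrA ler_wpM2l ?exprn_ge0 ?(ltW K10)// -!expRD ler_expR.
  have := ler_wpM2l (ltW s0) (ltW (T2 n)); rewrite /g; lra.
- move=> M; have [n4 hn4] := linear_large M.+1%:R theta0.
  exists n4 => n /hn4 h1; have := le_lt_trans h1 (T2 n).
  by rewrite natr1 ltr_nat ltnS => /ltnW.
Qed.

End upper_bounds.

(** * Construction of points hitting all targets *)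

Section stage.
Context {R : realType}.

(** At [delta = 0] the last inequality is the hypothesis; [Q] collects the harmful terms linear in
    [delta], once denominators are cleared and a factor [L] is taken out. *)
Lemma stage_slack (k L t s : R) : 0 < k -> 0 <= t -> t < L -> 0 < s ->
  s * (L + t) < k * (L - t) ->
  exists2 delta, 0 < delta & t + 2 * delta < L /\
    s * (L + t + 2 * delta) <
    k * (L - 2 * delta) * ((L - 2 * delta - t) / (L - delta)).
Proof.
move=> k0 t0 tL s0 h.
pose G := k * (L - t) - s * (L + t); have G0 : 0 < G by rewrite subr_gt0.
pose Q := 4 * k + 2 * s; have Q0 : 0 < Q by rewrite addr_gt0// mulr_gt0.
pose delta := Num.min ((L - t) / 4) (G / (2 * Q)).
have d0 : 0 < delta by rewrite lt_min !divr_gt0//= ?mulr_gt0// subr_gt0.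
have d1 : delta <= (L - t) / 4 by rewrite ge_min lexx.
have d2 : delta * Q <= G / 2.
  rewrite -ler_pdivlMr// (_ : G / 2 / Q = G / (2 * Q)); last by field; rewrite gt_eqF.
  by rewrite ge_min lexx orbT.
clearbody delta; exists delta => //; split; first by lra.
have Ld : 0 < L - delta by lra.
rewrite mulrA ltr_pdivlMr//.
have L0 : 0 < L by lra.
have p1 : L * (delta * Q) <= L * (G / 2) by rewrite ler_wpM2l// ltW.
have p2 : 0 < L * G by rewrite mulr_gt0.
have p3 : 0 <= s * delta * (L + t + 2 * delta).
  by rewrite !mulr_ge0 ?(ltW s0) ?(ltW d0)//; lra.
have p4 : 0 <= k * delta * t by rewrite !mulr_ge0 ?(ltW k0) ?(ltW d0).
have p5 : 0 <= k * delta * delta by rewrite !mulr_ge0 ?(ltW k0) ?(ltW d0).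
by move: p1 p2 p3 p4 p5; rewrite /Q /G; lra.
Qed.

(** [theta] is the proportion [g / n] of free time, [eta] slightly exceeds the size of a correction
    made at time [g], and [c'] is the precision required for time [n]. The radius [c] is fixed
    before [n], so all factors depending on it are absorbed by exponential decay; [gam] is the rate
    left by the gap inequality. *)
Lemma stage_scales (k : nat) (L t s delta C3 C4 c : R) :
  0 <= t -> 0 < delta -> t + 2 * delta < L ->
  s * (L + t + 2 * delta) <
    k%:R * (L - 2 * delta) * ((L - 2 * delta - t) / (L - delta)) ->
  0 < C3 -> 0 < C4 -> 0 < c ->
  exists n0, forall n, (n0 <= n)%N -> exists g M : nat,
  let eta := expR (- (L - 2 * delta) * g%:R) in
  let c' := expR (- (L + t + 2 * delta) * n%:R) in
  [/\ (g <= n)%N, (t + delta) * n%:R <= (L - delta) * (n - g)%:R,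
      C3 * expR (- delta * n%:R) <= 1 / 2 &
      [/\ C4 * expR (- (L - delta) * g%:R) <= eta / 4,
          M%:R * eta <= c, c <= 2 * M%:R * eta, c' <= eta / 8 &
          c `^ s <= (M ^ k)%:R * c' `^ s]].
Proof.
move=> t0 d0 tL gap C30 C40 c0.
set theta := _ / (L - delta) in gap.
have Ld : 0 < L - delta by lra.
have L2d : 0 < L - 2 * delta by lra.
have th0 : 0 < theta by rewrite divr_gt0//; lra.
have thE : (L - delta) * theta = L - 2 * delta - t.
  by rewrite /theta; field; rewrite gt_eqF.
have th1 : theta <= 1 by rewrite ler_pdivrMr// mul1r; lra.
pose gam := k%:R * (L - 2 * delta) * theta - s * (L + t + 2 * delta).
have gam0 : 0 < gam by rewrite subr_gt0.
clearbody theta.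
have [n1 h1] : exists n0, forall n, (n0 <= n)%N -> C3 * expR (- delta * n%:R) <= 1 / 2.
  by apply: expR_decay => //; rewrite ?oppr_lt0// divr_gt0.
have [n2 h2] : exists n0, forall n, (n0 <= n)%N ->
    C4 * expR delta * expR (- (delta * theta) * n%:R) <= 1 / 4.
  by apply: expR_decay; rewrite ?oppr_lt0 ?mulr_gt0 ?expR_gt0 ?invr_gt0.
have [n3 h3] : exists n0, forall n, (n0 <= n)%N ->
    expR (L - 2 * delta) * expR (- ((L - 2 * delta) * theta) * n%:R) <= c.
  by apply: expR_decay; rewrite ?oppr_lt0 ?mulr_gt0 ?expR_gt0.
have [n4 h4] : exists n0, forall n, (n0 <= n)%N ->
    1 * expR (- (4 * delta) * n%:R) <= 1 / 8 :> R.
  by apply: expR_decay; rewrite ?oppr_lt0 ?mulr_gt0 ?expR_gt0 ?invr_gt0.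
have [n5 h5] : exists n0, forall n, (n0 <= n)%N ->
    c `^ s * (2 / c) ^+ k * expR (k%:R * (L - 2 * delta)) * expR (- gam * n%:R) <= 1.
  apply: expR_decay; rewrite ?oppr_lt0//.
  by rewrite !mulr_gt0 ?expR_gt0 ?exprn_gt0 ?powR_gt0 ?divr_gt0.
exists (maxn n1 (maxn n2 (maxn n3 (maxn n4 n5)))) => n.
rewrite !geq_max => /andP[/h1 {}h1 /andP[/h2 {}h2 /andP[/h3 {}h3]]].
move=> /andP[/h4 {}h4 /h5 {}h5].
have thn0 : 0 <= theta * n%:R by rewrite mulr_ge0// ltW.
pose g := Num.truncn (theta * n%:R).
have /andP[g1 g2] := truncn_itv thn0; rewrite -/g -natr1 in g1 g2.
pose eta := expR (- (L - 2 * delta) * g%:R).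
have eta0 : 0 < eta by exact: expR_gt0.
have ce0 : 0 <= c / eta by rewrite divr_ge0// ltW.
(* The number of mesh steps that fit in [c]; it is at least 1 because [eta <= c], so rounding down
   loses at most a factor 2. *)
pose M := Num.truncn (c / eta).
have /andP[M1 M2] := truncn_itv ce0; rewrite -/M -natr1 in M1 M2.
rewrite ler_pdivlMr// in M1; rewrite ltr_pdivrMr// in M2.
have gn : (g <= n)%N.
  rewrite -(ler_nat R) (le_trans g1)// -[leRHS]mul1r ler_wpM2r//.
have etac : eta <= c.
  apply: le_trans h3; rewrite -expRD ler_expR.
  by have := ler_wpM2l (ltW L2d) (ltW g2); lra.
have Mpos : 1 <= M%:R :> R.
  rewrite ler1n lt0n; apply/eqP => M0; move: M2; rewrite M0 add0r mul1r.
  by rewrite ltNge etac.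
have cM : c <= 2 * M%:R * eta.
  by have := ler_wpM2r (ltW eta0) Mpos; lra.
exists g, M; rewrite -/eta; split => //.
- rewrite natrB// mulrBr; have := ler_wpM2l (ltW Ld) g1.
  by rewrite mulrA thE; lra.
split => //.
- have -> : expR (- (L - delta) * g%:R) = expR (- delta * g%:R) * eta.
    by rewrite -expRD; congr expR; ring.
  rewrite mulrA [leRHS]mulrC ler_wpM2r ?(ltW eta0)//.
  rewrite -[leRHS]mul1r; apply: le_trans h2; rewrite -mulrA -expRD.
  rewrite ler_wpM2l ?(ltW C40)// ler_expR.
  by have := ler_wpM2l (ltW d0) (ltW g2); lra.
- have -> : expR (- (L + t + 2 * delta) * n%:R) =
      expR (- (4 * delta) * n%:R) * expR (- (L + t - 2 * delta) * n%:R).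
    by rewrite -expRD; congr expR; ring.
  rewrite mulrC -[leRHS]/(eta * 8^-1) ler_pM ?expR_ge0//; last by lra.
  rewrite ler_expR !mulNr lerN2 ler_pM//; [exact: ltW|lra|by rewrite ler_nat].
- have Mk : (c / (2 * eta)) ^+ k <= (M ^ k)%:R.
    rewrite natrX lerXn2r ?nnegrE//; first by rewrite divr_ge0 ?mulr_ge0// ltW.
    by rewrite ler_pdivrMr ?mulr_gt0//; lra.
  apply: le_trans (ler_wpM2r (powR_ge0 _ _) Mk).
  have cs0 : 0 < c `^ s by exact: powR_gt0.
  rewrite -(ler_pM2r (x := (2 / c) ^+ k)) ?exprn_gt0 ?divr_gt0//.
  have -> : (c / (2 * eta)) ^+ k * expR (- (L + t + 2 * delta) * n%:R) `^ s *
      (2 / c) ^+ k = expR (k%:R * (L - 2 * delta) * g%:R - s * (L + t + 2 * delta) * n%:R).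
    rewrite mulrAC -exprMn; have -> : c / (2 * eta) * (2 / c) = eta^-1.
      by field; rewrite !gt_eqF.
    rewrite /eta -expRN -expRM_natr -expRM -expRD; congr expR; ring.
  apply: (@le_trans _ _ (expR (gam * n%:R - k%:R * (L - 2 * delta)))); last first.
    have kL0 : 0 <= k%:R * (L - 2 * delta) by rewrite mulr_ge0// ltW.
    by rewrite ler_expR; have := ler_wpM2l kL0 (ltW g2); rewrite /gam; lra.
  move: h5; rewrite [- gam * _]mulNr [expR (- (gam * _))]expRN.
  rewrite ler_pdivrMr ?expR_gt0// mul1r => h5.
  by rewrite expRD [expR (- _)]expRN ler_pdivlMr ?expR_gt0.
Qed.

End stage.

Lemma infinite_set_unbounded (B : set nat) :
  (forall n0, exists2 n, (n0 <= n)%N & B n) -> infinite_set B.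
Proof.
move=> h /finite_seqP[r rE].
have [n rn Bn] := h (\max_(i <- r) i).+1.
have : n \in r by move: Bn; rewrite rE.
move=> nr; move: rn; rewrite ltnNge => /negP; apply.
exact: leq_bigmax_seq.
Qed.

Section stable_slices.
Context {R : realType} {d : nat} {A : 'M[int]_d} {k : nat} {L : R}.
Variable H : hyperbolic_splitting A k L.
Variables (phi : nat -> nat -> R) (z : nat -> nat -> torus R d) (t : R).
Hypotheses (t_ge0 : 0 <= t) (t_lt : t < L).
Hypothesis phi_ge : forall j n0, (1 <= j)%N ->
  exists2 n, (n0 <= n)%N & expR (- t * n%:R) <= phi j n.

Let S : set (torus R d) :=
  \bigcap_(j in [set j | (1 <= j)%N]) shrinking_target (torus_map A) (phi j) (z j).

(* At stage [m] the unstable coordinate is refined freely down to scale [eta m]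
   and then corrected, so that from time [g] on the orbit shadows the orbit
   meeting the target at time [n]; the stable error has decayed by then. *)
Lemma stable_slice_content (s c0 : R) : 0 < s -> 0 < c0 ->
  s * (L + t) < k%:R * (L - t) ->
  exists2 K : R, 0 < K & forall y : 'cV[R]_k, (forall l, `|y l 0| <= 1) ->
  forall (P : pred nat) (U : nat -> set 'cV[R]_k) (r : nat -> R),
  (forall i, 0 < r i) -> (forall i, P i -> coord_diam_le (U i) (r i)) ->
  (forall x : 'cV[R]_k, (forall l, `|x l 0| <= c0) ->
     S (torus_pi (Bu H *m x + Bs H *m y)) -> exists2 i, P i & U i x) ->
  (1 <= \sum_(i <oo | P i) (K * r i `^ s)%:E)%E.
Proof.
move=> s0 c00 sL.
have k0 : 0 < k%:R :> R by rewrite ltr0n (k_gt0 H).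
have [delta d0 [tdL gap]] := stage_slack k0 t_ge0 t_lt s0 sL.
have L0 := L_gt0 H; have t0 : 0 <= t by []; have tL : t < L by [].
have sk : s <= k%:R.
  have h1 : s * (L + t) <= k%:R * (L + t).
    rewrite (le_trans (ltW sL))// ler_wpM2l//.
    by lra.
  by rewrite -(ler_pM2r (x := L + t))//; lra.
have [Cg Cg1 hCg] := growth_coord H d0.
have [C2 C21 [cu cs bu bs]] := coord_bound H.
have Cg0 : 0 < Cg by rewrite (lt_le_trans ltr01).
have C20 : 0 < C2 by rewrite (lt_le_trans ltr01).
pose D : R := d%:R + 1; have D0 : 0 < D by rewrite ltr_wpDl.
(* [C4] is the constant in the bound for the correction [e m p]; [C3] adds up the constants of the
   three errors made at the hitting time. *)
pose C4 := C2 * (Cg * (C2 * (C2 * D))).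
have C40 : 0 < C4 by rewrite !mulr_gt0.
pose C3 := Cg * C2 * (2 + C2 * D).
have C2D : 0 < C2 * D by exact: mulr_gt0.
have C30 : 0 < C3 by apply: mulr_gt0; [exact: mulr_gt0|lra].
have /choice[fl flP] : forall u : 'cV[R]_d, exists m,
    int_vector m /\ enorm (u - m) <= D.
  move=> u; have [m mZ mD] := fractional_part u; exists m; split => //.
  by rewrite (le_trans mD)// lerDl.
(* The 2-adic valuation makes every index [j >= 1] occur at infinitely many stages. *)
pose J m := (logn 2 m.+1).+1.
pose stage m (c : R) (ngM : nat * nat * nat) :=
  let: (n, g, M) := ngM in
  let eta := expR (- (L - 2 * delta) * g%:R) in
  let c' := expR (- (L + t + 2 * delta) * n%:R) in
  [/\ (m <= n)%N /\ expR (- t * n%:R) <= phi (J m) n, (g <= n)%N,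
      (t + delta) * n%:R <= (L - delta) * (n - g)%:R,
      C3 * expR (- delta * n%:R) <= 1 / 2 &
      [/\ C4 * expR (- (L - delta) * g%:R) <= eta / 4,
          M%:R * eta <= c, c <= 2 * M%:R * eta, c' <= eta / 8 &
          c `^ s <= (M ^ k)%:R * c' `^ s]].
(* The times depend on the radius reached so far, and that radius on the previous hitting time;
   hence a choice function on pairs (stage, radius), iterated by the fixpoint [c]. *)
have /choice[F FP] : forall p : nat * R, exists ngM, 0 < p.2 -> stage p.1 p.2 ngM.
  move=> [m c] /=; have [c_gt0|] := boolP (0 < c); last by exists (0, 0, 0)%N.
  have [n0 hn0] := stage_scales t_ge0 d0 tdL gap C30 C40 c_gt0.
  have [n nn0 phin] := phi_ge (maxn m n0) (isT : (1 <= J m)%N).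
  move: nn0; rewrite geq_max => /andP[mn /hn0[g [M [h1 h2 h3 h4]]]].
  by exists (n, g, M).
pose c := fix c m := if m is m'.+1 then
  expR (- (L + t + 2 * delta) * (F (m', c m')).1.1%:R) else c0.
have c_gt0 m : 0 < c m by case: m => [//|m]; exact: expR_gt0.
pose n m := (F (m, c m)).1.1; pose g m := (F (m, c m)).1.2.
pose M m := (F (m, c m)).2.
pose eta m := expR (- (L - 2 * delta) * (g m)%:R).
have stP m : stage m (c m) (n m, g m, M m).
  by have := FP (m, c m) (c_gt0 m); rewrite /n /g /M; case: (F (m, c m)) => [[? ?] ?].
have cS m : c m.+1 = expR (- (L + t + 2 * delta) * (n m)%:R) by [].
pose zeta m := torus_repr (z (J m) (n m)).
(* Added at time [g] to the orbit of [p], the vector [aim] would put it on the orbit of the target.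
   [rest] reduces it modulo integer vectors to bounded size, and [e] pulls the unstable part of
   [rest] back to time 0. *)
pose aim m (p : 'cV[R]_k) := real_mx (Ainv H) ^+ (n m - g m) *m zeta m -
  real_mx A ^+ g m *m (Bu H *m p).
pose rest m p := aim m p - fl (aim m p).
pose e m p := Cu H *m (real_mx (Ainv H) ^+ g m *m (Bu H *m (Cu H *m rest m p))).
have e_le m q l : `|e m q l 0| <= eta m / 4.
  have [_ _ _ _ [h _ _ _ _]] := stP m; apply: le_trans h.
  rewrite (le_trans (cu _ _))// /C4 -mulrA ler_wpM2l ?(ltW C20)//.
  have [_ h2 _ _] := hCg (g m) (Cu H *m rest m q).
  rewrite (le_trans h2)// mulrAC ler_wpM2r ?expR_ge0// ler_wpM2l ?(ltW Cg0)//.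
  apply: bu => l'; rewrite (le_trans (cu _ _))// ler_wpM2l ?(ltW C20)//.
  by have [] := flP (aim m q).
pose K := 60 ^+ k / c0 `^ s.
have K0 : 0 < K by rewrite divr_gt0 ?exprn_gt0 ?powR_gt0.
exists K => // y y1 P U r r0 Ur cover.
have main := @cantor_content R k c eta M e s s0 sk c_gt0 (fun m => expR_gt0 _) e_le.
suff : (1 <= \sum_(i <oo | P i) (60 ^+ k * (r i `^ s / c 0%N `^ s))%:E)%E.
  move=> /le_trans; apply; apply: lee_nneseries => [i _ _|i _].
    by rewrite lee_fin mulr_ge0 ?exprn_ge0// divr_ge0// powR_ge0.
  by rewrite lee_fin /K /= mulrAC -mulrA.
apply: (main _ _ _ _ _ U) => // [m|m|m|m|q x qpath xq].
- by have [_ _ _ _ []] := stP m.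
- by have [_ _ _ _ []] := stP m.
- by rewrite cS; have [_ _ _ _ []] := stP m.
- by rewrite cS; have [_ _ _ _ []] := stP m.
have [q0 qS] := qpath.
apply: cover => [l|j j1].
  by have := xq 0%N l; rewrite q0 mxE subr0.
apply: infinite_set_unbounded => N0.
have [m mE] : exists m, m.+1 = (2 ^ j.-1 * (2 * N0).+1)%N.
  by exists (2 ^ j.-1 * (2 * N0).+1).-1; rewrite prednK// muln_gt0 expn_gt0.
have Jm : J m = j.
  rewrite /J mE lognM ?expn_gt0// pfactorK//.
  by rewrite logn_coprime ?coprime2n /= ?oddM// addn0 prednK.
have N0m : (N0 <= m)%N.
  have : ((2 * N0).+1 <= m.+1)%N by rewrite mE leq_pmull// expn_gt0.
  rewrite ltnS; apply: leq_trans; exact: leq_pmull.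
have [[mn phin] gn h1 h2 _] := stP m.
exists (n m); first exact: leq_trans mn.
rewrite /= iter_torus_map -[z j (n m)]torus_reprK.
rewrite -Jm -/(zeta m); apply: lt_le_trans phin.
have [i qE] := qS m.
set p := q m + eta m *: \col_l (i l)%:R.
have qE' : q m.+1 = p + e m p by rewrite qE.
pose rs := rest m p.
have [flZ flD] := flP (aim m p).
(* At time [n] the corrected point misses the lift [zeta m] only by an integer vector and by the
   stable part of [rest], contracted since time [g]. *)
have hit : real_mx A ^+ n m *m (Bu H *m q m.+1) =
    zeta m - real_mx A ^+ (n m - g m) *m fl (aim m p) -
    real_mx A ^+ (n m - g m) *m (Bs H *m (Cs H *m rs)).
  have -> : real_mx A ^+ n m = real_mx A ^+ (n m - g m) *m real_mx A ^+ g m :> 'M[R]_d.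
    by rewrite mulmxE -exprD subnK.
  have Be : Bu H *m e m p = real_mx (Ainv H) ^+ g m *m (Bu H *m (Cu H *m rs)).
    rewrite /e -/rs (mulmxA (Bu H)) (mulmxA (Bu H *m Cu H)) BCu_commV.
    by rewrite -(mulmxA _ (Bu H *m Cu H)) -(mulmxA (Bu H)) (mulmxA (Cu H)) CuBu mul1mx.
  have -> : real_mx A ^+ (n m - g m) *m real_mx A ^+ g m *m (Bu H *m q m.+1) =
      real_mx A ^+ (n m - g m) *m (real_mx (Ainv H) ^+ (n m - g m) *m zeta m -
        fl (aim m p) - Bs H *m (Cs H *m rs)).
    rewrite -mulmxA; congr (_ *m _); rewrite qE' mulmxDr mulmxDr Be mulmx_expXK.
    have -> : Bu H *m (Cu H *m rs) = rs - Bs H *m (Cs H *m rs).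
      by rewrite {2}(split_vector H rs) addrK.
    have rsE : rs = real_mx (Ainv H) ^+ (n m - g m) *m zeta m -
      real_mx A ^+ g m *m (Bu H *m p) - fl (aim m p) by [].
    move: (Bs H *m (Cs H *m rs)) => v; rewrite rsE.
    move: (fl _) (_ *m zeta m) (_ *m (_ *m p)) => v1 v2 v3.
    by apply/matrixP => l1 l2; rewrite !mxE; ring.
  by rewrite !mulmxBr mulmx_expXK.
have -> : torus_pi (zeta m) =
    torus_pi (zeta m - real_mx A ^+ (n m - g m) *m fl (aim m p)).
  rewrite torus_piD_int// => l; rewrite mxE rpredN; exact: int_vectorX.
rewrite (le_lt_trans (torus_dist_le _ _))//.
have -> : real_mx A ^+ n m *m (Bu H *m x + Bs H *m y) -
    (zeta m - real_mx A ^+ (n m - g m) *m fl (aim m p)) =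
    real_mx A ^+ n m *m (Bu H *m (x - q m.+1)) + real_mx A ^+ n m *m (Bs H *m y)
    - real_mx A ^+ (n m - g m) *m (Bs H *m (Cs H *m rs)).
  rewrite mulmxDr mulmxBr mulmxBr hit.
  move: (_ *m (_ *m x)) (_ *m (_ *m y)) (_ *m (_ *m (_ *m rs))) => v1 v2 v3.
  move: (zeta m) (_ *m fl _) => v4 v5.
  by apply/matrixP => l1 l2; rewrite !mxE; ring.
(* Three errors, each at most a constant times [E]: the distance from [x] to the centre [q m.+1],
   the stable coordinate [y], and the stable part of [rest]. *)
have [g1 _ _ _] := hCg (n m) (x - q m.+1).
have [_ _ _ g2] := hCg (n m) y.
have [_ _ _ g3] := hCg (n m - g m)%N (Cs H *m rs).
pose E := expR (- (t + delta) * (n m)%:R).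
have n0 : 0 <= (n m)%:R :> R by [].
have b1 : enorm (Bu H *m (x - q m.+1)) <= C2 * c m.+1.
  by apply: bu => l; have := xq m.+1 l; rewrite !mxE.
have b2 : enorm (Bs H *m y) <= C2 * 1 by exact: bs.
have b3 : enorm (Bs H *m (Cs H *m rs)) <= C2 * (C2 * D).
  by apply: bs => l; rewrite (le_trans (cs _ _))// ler_wpM2l// ltW.
have E1 : enorm (real_mx A ^+ n m *m (Bu H *m (x - q m.+1))) <= Cg * C2 * E.
  rewrite (le_trans g1)//; apply: le_trans (ler_wpM2l _ b1) _.
    by rewrite mulr_ge0 ?expR_ge0// ltW.
  rewrite cS mulrACA -expRD; rewrite le_eqVlt; apply/orP; left; apply/eqP.
  by congr (_ * expR _); ring.
have E2 : enorm (real_mx A ^+ n m *m (Bs H *m y)) <= Cg * C2 * E.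
  rewrite (le_trans g2)//; apply: le_trans (ler_wpM2l _ b2) _.
    by rewrite mulr_ge0 ?expR_ge0// ltW.
  rewrite mulr1 mulrAC ler_wpM2l//; first by rewrite mulr_ge0// ltW.
  have h3 : - (L - delta) <= - (t + delta) by lra.
  by rewrite ler_expR ler_wpM2r.
have E3 : enorm (real_mx A ^+ (n m - g m) *m (Bs H *m (Cs H *m rs))) <=
    Cg * C2 * (C2 * D) * E.
  rewrite (le_trans g3)//; apply: le_trans (ler_wpM2l _ b3) _.
    by rewrite mulr_ge0 ?expR_ge0// ltW.
  rewrite mulrAC -[leLHS]mulrA mulrA -[leLHS]mulrA.
  have p0 : 0 <= Cg * C2 * (C2 * D) by rewrite !mulr_ge0// ltW.
  have e1 : expR (- (L - delta) * (n m - g m)%:R) <= E.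
    by rewrite ler_expR !mulNr lerN2.
  by have := ler_wpM2l p0 e1; lra.
have EE : E = expR (- delta * (n m)%:R) * expR (- t * (n m)%:R).
  by rewrite -expRD /E; congr expR; ring.
have CE : C3 * E <= 1 / 2 * expR (- t * (n m)%:R).
  by rewrite EE mulrA ler_wpM2r// expR_ge0.
have := expR_gt0 (- t * (n m)%:R).
have := ler_enormB (real_mx A ^+ n m *m (Bu H *m (x - q m.+1)) +
  real_mx A ^+ n m *m (Bs H *m y)) (real_mx A ^+ (n m - g m) *m (Bs H *m (Cs H *m rs))).
have := ler_enormD (real_mx A ^+ n m *m (Bu H *m (x - q m.+1)))
  (real_mx A ^+ n m *m (Bs H *m y)).
move: CE; rewrite /C3; move: E1 E2 E3; clear.
move: (enorm (_ + _)) (enorm (_ + _ - _)) (enorm _) => e1 e2 e3.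
by lra.
Qed.

End stable_slices.

(** * Lower bounds *)

Section lower_criteria.
Context {R : realType} {X : metricType R}.
Local Open Scope ereal_scope.

Lemma hausdorff_measure_neq0 (E : set X) (s c : R) : (0 < c)%R ->
  (forall delta, (0 < delta <= 1)%R -> c%:E <= hausdorff_premeasure E s delta) ->
  hausdorff_measure E s <> 0.
Proof.
move=> c0 h h0; have cv : cvg (hausdorff_premeasure E s delta @[delta --> (0:R)^'+]).
  apply: nonincreasing_at_right_is_cvge; apply: nearW => e x y _ _ xy.
  apply: ereal_inf_le_tmp => _ [I [U [hU EU ->]]]; exists I, U; split => //.
  by move=> i /hU /le_trans; apply; rewrite lee_fin.
have : c%:E <= hausdorff_measure E s.
  apply: lime_ge => //; near=> delta; apply: h; apply/andP; split.
    by near: delta; exact: nbhs_right_gt.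
  by near: delta; exact: nbhs_right_le.
by rewrite h0 lee_fin leNgt c0.
Unshelve. all: by end_near. Qed.

(** The case [M = 0] is set aside because a Bowen ball of length 0 is the whole space. *)
Lemma bowen_measure_neq0 f (E : set X) (s e c : R) : (0 < c)%R ->
  (forall M, (1 <= M)%N -> c%:E <= bowen_premeasure f E s e M) ->
  bowen_measure f E s e <> 0.
Proof.
move=> c0 h h0; have cv : cvgn (bowen_premeasure f E s e).
  apply: ereal_nondecreasing_is_cvgn => m n mn.
  apply: ereal_inf_le_tmp => _ [I [x [T [hT EU ->]]]]; exists I, x, T; split => //.
  by move=> i /hT; exact: leq_trans.
have : c%:E <= bowen_measure f E s e.
  by apply: lime_ge => //; exists 1%N => // M /= M1; exact: h.
by rewrite h0 lee_fin leNgt c0.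
Qed.

End lower_criteria.

Section lower_bounds.
Context {R : realType} {d : nat} {A : 'M[int]_d} {k : nat} {L : R}.
Variable H : hyperbolic_splitting A k L.
Variables (phi : nat -> nat -> R) (z : nat -> nat -> torus R d) (t : R).
Hypotheses (t_ge0 : 0 <= t) (t_lt : t < L).
Hypothesis phi_ge : forall j n0, (1 <= j)%N ->
  exists2 n, (n0 <= n)%N & expR (- t * n%:R) <= phi j n.

Let S : set (torus R d) :=
  \bigcap_(j in [set j | (1 <= j)%N]) shrinking_target (torus_map A) (phi j) (z j).

(** If the intersection were empty, the empty family would be an admissible cover in
    [stable_slice_content], giving [1 <= 0]. *)
Lemma shrinking_targets_neq0 : S !=set0.
Proof.
have k0 : 0 < k%:R :> R by rewrite ltr0n (k_gt0 H).
have Lt : 0 < L + t by rewrite ltr_pwDl// (L_gt0 H).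
have s0 : 0 < k%:R * (L - t) / (L + t) / 2 by rewrite !divr_gt0// mulr_gt0// subr_gt0.
have s1 : k%:R * (L - t) / (L + t) / 2 * (L + t) < k%:R * (L - t).
  have -> : k%:R * (L - t) / (L + t) / 2 * (L + t) = k%:R * (L - t) / 2.
    by field; rewrite gt_eqF.
  have : 0 < k%:R * (L - t) by rewrite mulr_gt0// subr_gt0.
  by lra.
have [K K0 hK] := stable_slice_content H z t_ge0 t_lt phi_ge s0 ltr01 s1.
apply: contrapT => /nonemptyPn S0.
have : (1 <= \sum_(i <oo | pred0 i) (K * 1 `^ (k%:R * (L - t) / (L + t) / 2))%:E)%E.
  apply: (hK 0 _ pred0 (fun=> set0) (fun=> 1)) => // [l|x _ Sx].
    by rewrite mxE normr0.
  by move: S0 => /seteqP[/(_ _ Sx)].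
by rewrite eseries_pred0// lee_fin ler10.
Qed.

(** Two points of the leaf [y = 0] in a Bowen ball of length n are still close at time n - 1;
    contracting back, they lie within about e^(-(L-delta)n). A sum with exponent [u] thus dominates
    the leaf sum with exponent [s] when [u <= (L - delta) s]. *)
Lemma bowen_lower s delta Ca e u : 0 < s -> s * (L + t) < k%:R * (L - t) ->
  0 < delta -> delta < L ->
  0 < Ca -> (forall v : 'cV[R]_d, enorm (real_mx A *m v) <= Ca * enorm v) ->
  0 < e -> e < 1 / (4 * Ca) -> u <= (L - delta) * s ->
  bowen_measure (torus_map A) S u e <> 0%E.
Proof.
move=> s0 s1 d0 dL Ca0 hCa e0 eCa us.
have [Cg Cg0 hCg] := growth H d0.
have [C2 C21 [cu _ bu _]] := coord_bound H.
have C20 : 0 < C2 by rewrite (lt_le_trans ltr01).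
pose c0 := 1 / (4 * C2).
have c00 : 0 < c0 by rewrite divr_gt0// mulr_gt0.
have [K K0 hK] := stable_slice_content H z t_ge0 t_lt phi_ge s0 c00 s1.
(* [expR (L - delta)] compensates for contracting over one step less than the length of the ball. *)
pose Q := C2 * (Cg * expR (L - delta) * (2 * e)).
have Q0 : 0 < Q by rewrite !mulr_gt0// expR_gt0.
have KQ0 : 0 < K * Q `^ s by rewrite mulr_gt0// powR_gt0.
apply: (@bowen_measure_neq0 _ _ _ _ _ _ (K * Q `^ s)^-1); first by rewrite invr_gt0.
move=> M M1; apply: le_ereal_inf_tmp => _ [I [xx [n [In SB ->]]]].
pose P : pred nat := fun i => i \in I.
pose U i := [set x : 'cV[R]_k | (forall l, `|x l 0| <= c0) /\
  bowen_ball (torus_map A) (n i) (xx i) e (torus_pi (Bu H *m x + Bs H *m 0))].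
pose r i := Q * expR (- (L - delta) * (n i)%:R).
have r0 i : 0 < r i by rewrite mulr_gt0// expR_gt0.
have Ur i : P i -> coord_diam_le (U i) (r i).
  rewrite /P inE => Ii x x' [hx bx] [hx' bx'] l.
  rewrite !mulmx0 !addr0 in bx bx'.
  have n1 : (1 <= n i)%N by exact: leq_trans (In i Ii).
  pose v := Bu H *m (x - x').
  have v12 : enorm v <= 1 / 2.
    have -> : 1 / 2 = C2 * (c0 + c0) by rewrite /c0; field; rewrite gt_eqF.
    by apply: bu => l'; rewrite !mxE (le_trans (ler_normB _ _))// lerD.
  have close j : (j < n i)%N -> enorm (real_mx A ^+ j *m v) <= 1 / 2 ->
      enorm (real_mx A ^+ j *m v) < 2 * e.
    move=> jn vj; have vE : real_mx A ^+ j *m v =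
        real_mx A ^+ j *m (Bu H *m x) - real_mx A ^+ j *m (Bu H *m x').
      by rewrite /v !mulmxBr.
    rewrite vE in vj *; rewrite -(torus_dist_chart vj) -!iter_torus_map.
    have h1 := bx j jn; have h2 := bx' j jn.
    apply: le_lt_trans (torus_dist_triangle (iter j (torus_map A) (xx i)) _ _) _.
    by rewrite mulr2n mulrDl mul1r ltrD// torus_dist_sym.
  (* [e < 1 / (4 Ca)] carries the bound 1/2 to the next iterate, so the torus distance remains
     Euclidean at all times before [n i]. *)
  have small j : (j < n i)%N -> enorm (real_mx A ^+ j *m v) <= 1 / 2.
    elim: j => [_|j IH jn]; first by rewrite expr0 mul1mx.
    rewrite exprS -mulmxE -mulmxA (le_trans (hCa _))//.
    have := close j (ltnW jn) (IH (ltnW jn)) => /ltW h.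
    have -> : 1 / 2 = Ca * (2 * (1 / (4 * Ca))) by field; rewrite gt_eqF.
    by rewrite ler_wpM2l ?(ltW Ca0)// (le_trans h)// ler_wpM2l// ltW.
  have n1n : ((n i).-1 < n i)%N by rewrite prednK.
  have vsmall := ltW (close _ n1n (small _ n1n)).
  have BCv : Bu H *m Cu H *m (real_mx A ^+ (n i).-1 *m v) = real_mx A ^+ (n i).-1 *m v.
    rewrite mulmxA BCu_commX -mulmxA; congr (_ *m _).
    by rewrite /v -mulmxA (mulmxA (Cu H)) CuBu mul1mx.
  have [_ + _ _] := hCg (n i).-1 (real_mx A ^+ (n i).-1 *m v).
  rewrite BCv expX_mulmxK => h.
  have -> : x l 0 - x' l 0 = (Cu H *m v) l 0.
    by rewrite /v mulmxA CuBu mul1mx !mxE.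
  rewrite (le_trans (cu _ _))// /r /Q -mulrA ler_wpM2l ?(ltW C20)//.
  apply: (le_trans h).
  have -> : expR (- (L - delta) * (n i).-1%:R) =
      expR (L - delta) * expR (- (L - delta) * (n i)%:R).
    by rewrite -expRD -[in RHS](prednK n1) -natr1; congr expR; ring.
  have p0 : 0 <= Cg * (expR (L - delta) * expR (- (L - delta) * (n i)%:R)).
    by rewrite !mulr_ge0 ?expR_ge0// ltW.
  by have := ler_wpM2l p0 vsmall; lra.
have hsum : (1 <= \sum_(i <oo | P i) (K * r i `^ s)%:E)%E.
  apply: (hK 0 _ P U r) => // [l|x hx Sx]; first by rewrite mxE normr0.
  have [i Ii xi] := SB _ Sx.
  by exists i; [rewrite /P inE|split].
rewrite -(@lee_pmul2l _ (K * Q `^ s)%:E) ?lte_fin// -EFinM divff ?gt_eqF//.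
apply: (le_trans hsum).
have -> : (\esum_(i in I) (expR (- u * (n i)%:R))%:E =
    \sum_(i <oo | P i) (expR (- u * (n i)%:R))%:E)%E.
  rewrite nneseries_esum; last by move=> *; rewrite lee_fin expR_ge0.
  by rewrite -[in LHS](set_mem_set I).
rewrite -nneseriesZl; last by move=> *; rewrite lee_fin expR_ge0.
apply: lee_nneseries => [i _ _|i Pi].
  by rewrite lee_fin mulr_ge0 ?powR_ge0// ltW.
rewrite -EFinM lee_fin /r powRM ?expR_ge0 ?(ltW Q0)// mulrA.
rewrite ler_wpM2l ?(ltW KQ0)// -expRM ler_expR.
have := ler_wpM2r (ler0n R (n i)) us; lra.
Qed.

(** A cover of [S] induces on each slice [y] a cover by the members whose stable extent contains
    [y]. The leaf inequality with exponent [s] holds for every [y]; integrating it over a cube of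
    side [c0] multiplies each term by about the [k]-th power of the diameter, whence the exponent
    [s + k]. *)
Lemma hausdorff_lower s u : 0 < s -> s * (L + t) < k%:R * (L - t) ->
  0 <= u -> u <= s + k%:R -> hausdorff_measure S u <> 0%E.
Proof.
move=> s0 s1 u0 us.
have [B B1 [cu cs bu bs]] := coord_bound H.
have B0 : 0 < B by rewrite (lt_le_trans ltr01).
pose c0 := 1 / (8 * B); have c00 : 0 < c0 by rewrite divr_gt0// mulr_gt0.
have c01 : c0 <= 1 by rewrite ler_pdivrMr ?mulr_gt0//; lra.
have [K K0 hK] := stable_slice_content H z t_ge0 t_lt phi_ge s0 c00 s1.
pose K' := K * B `^ s * (2 * B) ^+ k.
have K'0 : 0 < K' by rewrite !mulr_gt0 ?exprn_gt0 ?powR_gt0 ?mulr_gt0.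
(* Chosen so that [c0 ^+ k = 2 K' kap]: one half pays for the enlargements [ep i], the other is the
   final bound. *)
pose kap := c0 ^+ k / (2 * K').
have kap0 : 0 < kap.
  by apply: divr_gt0; [exact: exprn_gt0|apply: mulr_gt0 => //; exact: K'0].
have sk0 : 0 < s + k%:R by rewrite ltr_wpDr.
apply: (hausdorff_measure_neq0 kap0) => D /andP[D0 D1].
apply: le_ereal_inf_tmp => _ [I [U [UD SU ->]]].
pose P : pred nat := fun i => i \in I.
pose dm i := fine (diam (U i)).
have dmE i : P i -> diam (U i) = (dm i)%:E.
  rewrite /P inE => /UD h; rewrite /dm fineK// ge0_fin_numE ?diam_ge0//.
  exact: le_lt_trans h (ltry _).
have dm0 i : 0 <= dm i by rewrite /dm fine_ge0// diam_ge0.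
have dm1 i : P i -> dm i <= 1.
  move=> Pi; rewrite -lee_fin -dmE//; move: Pi; rewrite /P inE => /UD.
  by move=> /le_trans; apply; rewrite lee_fin.
(* Sets of diameter zero need a positive size in the leaf inequality; the powers [s + k] of these
   sizes sum to [kap]. *)
pose ep i := (kap / (2 ^ i.+1)%:R) `^ (s + k%:R)^-1.
have ep0 i : 0 < ep i by rewrite powR_gt0// divr_gt0// ltr0n expn_gt0.
pose r i := Num.max (dm i) (ep i).
have r0 i : 0 < r i by rewrite lt_max ep0 orbT.
have Br0 i : 0 < B * r i by rewrite mulr_gt0.
pose V i (x y : 'cV[R]_k) := [/\ forall l, `|x l 0| <= c0, forall l, 0 <= y l 0 <= c0
  & U i (torus_pi (Bu H *m x + Bs H *m y))].
have Vclose i x y x' y' : P i -> V i x y -> V i x' y' -> forall l,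
    `|x l 0 - x' l 0| <= B * r i /\ `|y l 0 - y' l 0| <= B * r i.
  move=> Pi [hx hy Uxy] [hx' hy' Uxy'] l.
  pose v := Bu H *m (x - x') + Bs H *m (y - y').
  have vE : v = (Bu H *m x + Bs H *m y) - (Bu H *m x' + Bs H *m y').
    rewrite /v !mulmxBr; move: (_ *m x) (_ *m x') (_ *m y) (_ *m y') => v1 v2 v3 v4.
    by apply/matrixP => l1 l2; rewrite !mxE; ring.
  have v12 : enorm v <= 1 / 2.
    have -> : 1 / 2 = B * (c0 + c0) + B * (c0 + c0) by rewrite /c0; field; rewrite gt_eqF.
    rewrite /v (le_trans (ler_enormD _ _))// lerD//.
      by apply: bu => l'; rewrite !mxE (le_trans (ler_normB _ _))// lerD.
    apply: bs => l'; rewrite !mxE (le_trans (ler_normB _ _))// lerD//.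
      by have /andP[? ?] := hy l'; rewrite ger0_norm.
    by have /andP[? ?] := hy' l'; rewrite ger0_norm.
  have vr : enorm v <= r i.
    rewrite le_max; apply/orP; left; rewrite vE -torus_dist_chart -?vE//.
    by rewrite -lee_fin -dmE//; exact: mdist_diam.
  have -> : x l 0 - x' l 0 = (Cu H *m v) l 0.
    by rewrite /v mulmxDr !mulmxA CuBu CuBs mul1mx mul0mx addr0 !mxE.
  have -> : y l 0 - y' l 0 = (Cs H *m v) l 0.
    by rewrite /v mulmxDr !mulmxA CsBs CsBu mul1mx mul0mx add0r !mxE.
  by split; [apply: le_trans (cu _ _) _|apply: le_trans (cs _ _) _];
     rewrite ler_wpM2l// ltW.
(* [al i] is the lower corner of a box of side [2 B r i] containing the stable coordinates of the
   [i]-th set; it is arbitrary if that set has no point in the chart. *)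
have /choice[al alP] : forall i, exists al : nat -> R, P i -> forall x y, V i x y ->
    forall l : 'I_k, al l <= y l 0 <= al l + 2 * (B * r i).
  move=> i; have [[[x y] /= Vxy]|noV] := pselect (exists p : 'cV[R]_k * 'cV[R]_k, V i p.1 p.2).
    exists (fun l => if insub l is Some l' then y l' 0 - B * r i else 0) => Pi x' y' Vxy' l.
    rewrite valK; have [_] := Vclose _ _ _ _ _ Pi Vxy Vxy' l.
    by rewrite ler_norml => /andP[? ?]; apply/andP; split; lra.
  by exists (fun=> 0) => _ x y Vxy; case: noV; exists (x, y).
pose w i := if P i then K * (B * r i) `^ s else 0.
have w0 i : 0 <= w i by rewrite /w; case: ifP => // _; rewrite mulr_ge0 ?powR_ge0 ?(ltW K0).
have slices (y : nat -> R) : (forall l, 0 <= y l <= c0) ->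
    (1%:E <= \sum_(i <oo) (w i * \prod_(l < k)
      (al i l <= y l <= al i l + 2 * (B * r i))%R%:R)%:E)%E.
  move=> y01; pose yv : 'cV[R]_k := \col_l y l.
  have yv1 l : `|yv l 0| <= 1.
    by rewrite mxE; have /andP[? ?] := y01 l; rewrite ger0_norm// (le_trans _ c01).
  pose P' : pred nat := fun i => P i &&
    [forall l : 'I_k, (al i l <= y l <= al i l + 2 * (B * r i))%R].
  have h := hK yv yv1 P' (fun i => [set x | V i x yv]) (fun i => B * r i) Br0 _ _.
  apply: (@le_trans _ _ (\sum_(i <oo | P' i) (K * (B * r i) `^ s)%:E)%E).
    apply: h => [i /andP[Pi _] x x' Vx Vx' l|x hx Sx].
      by have [] := Vclose _ _ _ _ _ Pi Vx Vx' l.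
    have [i Ii Ui] := SU _ Sx.
    have Vi : V i x yv by split => // l; rewrite mxE.
    exists i => //; rewrite /P' /P mem_set//=; apply/forallP => l.
    by have := alP i (mem_set Ii) _ _ Vi l; rewrite mxE.
  rewrite eseries_mkcond; apply: lee_nneseries => [i _ _|i _].
    by case: ifP => // _; rewrite lee_fin mulr_ge0 ?powR_ge0 ?(ltW K0).
  case: ifP => [/andP[Pi /forallP yJ]|_]; rewrite lee_fin.
    by rewrite /w Pi big1 ?mulr1// => l _; rewrite yJ.
  by rewrite mulr_ge0// prodr_ge0.
have l0 i : 0 <= 2 * (B * r i) by rewrite mulr_ge0// ltW.
have := sum_box_volumes l0 (ltW c00) w0 ler01 slices; rewrite mul1r => hsum.
pose p := s + k%:R.
have rp i : r i `^ p <= dm i `^ p + kap / (2 ^ i.+1)%:R.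
  have kk : 0 <= kap / (2 ^ i.+1)%:R by rewrite divr_ge0// ltW.
  have epE : ep i `^ p = kap / (2 ^ i.+1)%:R.
    by rewrite /ep -powRrM mulVf ?gt_eqF// powRr1.
  have [h|h] := leP (dm i) (ep i).
    by rewrite /r max_r// epE lerDr powR_ge0.
  by rewrite /r max_l ?(ltW h)// lerDl.
have bound : (\sum_(i <oo) (w i * (2 * (B * r i)) ^+ k)%:E <=
    K'%:E * (\sum_(i <oo | P i) (dm i `^ p)%:E + kap%:E))%E.
  have -> : (kap%:E = \sum_(i <oo) (kap / (2 ^ i.+1)%:R)%:E)%E.
    apply/esym/cvg_lim => //; have := @cvg_geometric_eseries_half R kap 0.
    by rewrite expr0 divr1; apply: cvg_trans; apply: near_eq_cvg; apply: nearW => n;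
       apply: eq_bigr => i _; rewrite addn1.
  rewrite [X in (_ * (X + _))%E]eseries_mkcond -nneseriesD; last 2 first.
  - by move=> i _ _; case: ifP => // _; rewrite lee_fin powR_ge0.
  - by move=> i _ _; rewrite lee_fin divr_ge0// ltW.
  rewrite -nneseriesZl; last first.
    move=> i _; rewrite adde_ge0//; last by rewrite lee_fin divr_ge0// ltW.
    by case: ifP => // _; rewrite lee_fin powR_ge0.
  apply: lee_nneseries => [i _ _|i _]; first by rewrite lee_fin mulr_ge0// exprn_ge0.
  rewrite /w; case: ifP => _; last first.
    rewrite mul0r add0e mule_ge0// lee_fin; first exact: ltW.
    by rewrite divr_ge0// ltW.
  rewrite -EFinD -EFinM lee_fin.
  apply: le_trans (ler_wpM2l (ltW K'0) (rp i)).
  rewrite /K' /p powRD; last by rewrite gt_eqF.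
  rewrite powR_mulrn ?(ltW (r0 i))// powRM ?(ltW B0) ?(ltW (r0 i))//.
  rewrite (mulrA 2) exprMn; lra.
have {hsum bound} := le_trans hsum bound.
have dsum : (\sum_(i <oo | P i) (dm i `^ p)%:E <=
    \esum_(i in I) poweR (diam (U i)) u)%E.
  rewrite -[X in (_ <= \esum_(i in X) _)%E](set_mem_set I).
  rewrite -(nneseries_esum (P := P)); last by move=> *; exact: poweR_ge0.
  apply: lee_nneseries => [i _ _|i Pi]; first by rewrite lee_fin powR_ge0.
  rewrite dmE// poweR_EFin lee_fin.
  (* For [0 < dm i <= 1] the smaller exponent gives the larger power, which is where the restriction
     to scales at most 1 enters; at 0 the left side vanishes since [p] is positive. *)
  have [d0|d0] := eqVneq (dm i) 0.
    by rewrite d0 powR0 ?powR_ge0// gt_eqF.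
  by rewrite ger_powR// dm1// andbT lt_neqAle eq_sym d0 dm0.
move=> h; apply: le_trans dsum.
move: h; case: (\sum_(i <oo | P i) (dm i `^ p)%:E)%E => [T| |].
- rewrite -EFinD -EFinM !lee_fin => h.
  rewrite -(lerD2r kap) -(ler_pM2l K'0); apply: le_trans h.
  rewrite le_eqVlt; apply/orP; left; apply/eqP.
  by rewrite /kap; field; rewrite gt_eqF.
- by rewrite leey.
- by rewrite addNye gt0_muleNy ?lte_fin// leeNy_eq.
Qed.

End lower_bounds.

(** * Values of the entropy and of the dimension *)

Section liminf.
Context {R : realType}.
Local Open Scope ereal_scope.

Lemma limn_einfE (u : (\bar R)^nat) : limn_einf u = ereal_sup (range (einfs u)).
Proof. by rewrite limn_einf_lim; apply/cvg_lim => //; exact: cvg_einfs_sup. Qed.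

Lemma lt_limn_einf (u : (\bar R)^nat) x : x < limn_einf u ->
  exists n0, forall n, (n0 <= n)%N -> x < u n.
Proof.
rewrite limn_einfE => /ereal_sup_gt[_ [n0 _ <-] xn0]; exists n0 => n n0n.
by apply: (lt_le_trans xn0); apply: ereal_inf_lbound; exists n.
Qed.

Lemma limn_einf_lt (u : (\bar R)^nat) x n0 : limn_einf u < x ->
  exists2 n, (n0 <= n)%N & u n < x.
Proof.
move=> ux; have : einfs u n0 < x.
  apply: le_lt_trans ux; rewrite limn_einfE; apply: ereal_sup_ubound.
  by exists n0.
by move=> /ereal_inf_lt[_ [n /= n0n <-] un]; exists n.
Qed.

Lemma limn_einf_ge0 (u : (\bar R)^nat) : (forall n, 0 <= u n) -> 0 <= limn_einf u.
Proof.
move=> u0; apply: (@le_trans _ _ (einfs u 0%N)).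
  by apply: le_ereal_inf_tmp => _ [n _ <-].
by rewrite limn_einfE; apply: ereal_sup_ubound; exists 0%N.
Qed.

Lemma ereal_inf_threshold_le (Q : R -> Prop) (V : R) :
  (0 <= V)%R -> (forall s, (V < s)%R -> Q s) ->
  ereal_inf [set s%:E | s in [set s : R | (0 <= s)%R /\ Q s]] <= V%:E.
Proof.
move=> V0 h; apply/lee_addgt0Pr => e e0; apply: ereal_inf_lbound.
exists (V + e)%R => //; split; first by rewrite addr_ge0// ltW.
by apply: h; rewrite ltrDl.
Qed.

Lemma ereal_inf_threshold_ge (Q : R -> Prop) (V : R) :
  (forall s, (0 <= s)%R -> (s < V)%R -> ~ Q s) ->
  V%:E <= ereal_inf [set s%:E | s in [set s : R | (0 <= s)%R /\ Q s]].
Proof.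
move=> h; apply: le_ereal_inf_tmp => _ [s [s0 Qs] <-]; rewrite lee_fin leNgt.
by apply/negP => sV; exact: h s0 sV Qs.
Qed.

End liminf.

(** * Choice of exponents near the thresholds *)

Section parameters.
Context {R : realType}.

(** The strict inequality at [r] persists slightly below [r]: [b] is the value of [t] giving
    equality, and the midpoint of [b] and [r] is taken. Since [r] may be 0, [t] may be negative,
    whence the range [- L < t]. *)
Lemma upper_parameter (k L r s : R) : 0 < k -> 0 < L -> 0 <= r -> r <= L ->
  2 * L * k < s * (L + r) -> exists t, [/\ - L < t, t < r & 2 * L * k < s * (L + t)].
Proof.
move=> k0 L0 r0 rL h.
have s0 : 0 < s.
  rewrite -(pmulr_lgt0 (x := L + r)); last by lra.
  by apply: lt_trans h; rewrite !mulr_gt0.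
pose b := 2 * L * k / s - L.
have bE : s * b = 2 * L * k - s * L by rewrite /b; field; rewrite gt_eqF.
have b1 : b < r by rewrite -(ltr_pM2l s0) bE; lra.
have b2 : - L < b by rewrite ltrBrDr addNr divr_gt0// !mulr_gt0.
exists ((b + r) / 2); split; [by lra|by lra|].
have : s * b < s * ((b + r) / 2) by rewrite ltr_pM2l//; lra.
by rewrite bE; lra.
Qed.

Lemma upper_parameter_entropy (k L r s : R) : 0 < k -> 0 < L -> 0 <= r -> r <= L ->
  k * (L - r) * L < s * (L + r) ->
  exists t, [/\ - L < t, t < r & k * (L - t) * L < s * (L + t)].
Proof.
move=> k0 L0 r0 rL h.
have Lr : 0 < L + r by lra.
have s0 : 0 < s.
  rewrite -(pmulr_lgt0 _ Lr); apply: le_lt_trans h.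
  by rewrite !mulr_ge0 ?(ltW k0) ?(ltW L0)// subr_ge0.
have q0 : 0 < s + k * L by rewrite addr_gt0// mulr_gt0.
pose b := (k * L * L - s * L) / (s + k * L).
have bE : (s + k * L) * b = k * L * L - s * L by rewrite /b; field; rewrite gt_eqF.
have b1 : b < r by rewrite -(ltr_pM2l q0) bE; lra.
have b2 : - L < b.
  rewrite -(ltr_pM2l q0) bE; have : 0 < k * L * L by rewrite !mulr_gt0.
  by lra.
exists ((b + r) / 2); split; [by lra|by lra|].
have : (s + k * L) * b < (s + k * L) * ((b + r) / 2) by rewrite ltr_pM2l//; lra.
by rewrite bE; lra.
Qed.

(** Both parameters are raised: [t] by an [e] costing at most half of the gap [G], then [s] halfway
    to the new threshold [w], which makes it positive even if it was 0. *)
Lemma lower_parameter (k L r s : R) : 0 < k -> 0 <= r -> r < L -> 0 <= s ->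
  s * (L + r) < k * (L - r) ->
  exists t s', [/\ r < t, t < L, s < s' & s' * (L + t) < k * (L - t)].
Proof.
move=> k0 r0 rL s0 h; pose G := k * (L - r) - s * (L + r).
have G0 : 0 < G by rewrite subr_gt0.
have ks : 0 < k + s by rewrite ltr_pwDl.
pose e := Num.min ((L - r) / 2) (G / (2 * (k + s))).
have e0 : 0 < e by rewrite lt_min !divr_gt0//= ?mulr_gt0// subr_gt0.
have e1 : e <= (L - r) / 2 by rewrite ge_min lexx.
have e2 : (k + s) * e <= G / 2.
  have -> : G / 2 = (k + s) * (G / (2 * (k + s))) by field; rewrite gt_eqF.
  by rewrite ler_wpM2l ?(ltW ks)// ge_min lexx orbT.
clearbody e.
have h2 : s * (L + (r + e)) < k * (L - (r + e)) by move: e2 G0; rewrite /G; lra.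
have Lt : 0 < L + (r + e) by lra.
pose w := k * (L - (r + e)) / (L + (r + e)).
have wE : w * (L + (r + e)) = k * (L - (r + e)) by rewrite /w; field; rewrite gt_eqF.
have sw : s < w by rewrite -(ltr_pM2r Lt) wE.
exists (r + e), ((s + w) / 2); split; [by lra|by lra|by lra|].
by rewrite -wE ltr_pM2r//; lra.
Qed.

End parameters.

(** * The three regimes of the decay rate *)

Section main.
Context {R : realType} {d : nat} {A : 'M[int]_d} {k : nat} {L : R}.
Variable H : hyperbolic_splitting A k L.
Variables (phi : nat -> nat -> R) (z : nat -> nat -> torus R d).
Hypothesis phi01 : forall j n, (1 <= j)%N -> 0 < phi j n /\ phi j n <= 1.

Let S : set (torus R d) :=
  \bigcap_(j in [set j | (1 <= j)%N]) shrinking_target (torus_map A) (phi j) (z j).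

Let u j n : \bar R := (- (ln (phi j n) / n%:R))%:E.

Let tau_gt t : (t%:E < tau_inf phi)%E -> exists2 j, (1 <= j)%N &
  exists n1, forall n, (n1 <= n)%N -> phi j n <= expR (- t * n%:R).
Proof.
move=> /ereal_sup_gt[_ [j /= j1 <-] /lt_limn_einf[n0 h]]; exists j => //.
(* [n >= 1] avoids the index at which division by [n] gives 0 by convention. *)
exists (maxn 1 n0) => n; rewrite geq_max => /andP[n1 /h].
have [p0 _] := phi01 n j1.
rewrite lte_fin -mulNr ltr_pdivlMr ?ltr0n// => h1.
by rewrite -[leLHS]lnK ?posrE// ler_expR; lra.
Qed.

Let tau_lt t : (tau_inf phi < t%:E)%E -> forall j n0, (1 <= j)%N ->
  exists2 n, (n0 <= n)%N & expR (- t * n%:R) <= phi j n.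
Proof.
move=> tt j n0 j1; have [n + h] : exists2 n, (maxn 1 n0 <= n)%N & (u j n < t%:E)%E.
  apply: limn_einf_lt; apply: le_lt_trans tt; apply: ereal_sup_ubound.
  by exists j.
rewrite geq_max => /andP[n1 n0n]; exists n => //.
have [p0 _] := phi01 n j1; move: h.
rewrite lte_fin -mulNr ltr_pdivrMr ?ltr0n// => h1.
by rewrite -[leRHS]lnK ?posrE// ler_expR; lra.
Qed.

Let tau_ge0 : (0 <= tau_inf phi)%E.
Proof.
apply: (@le_trans _ _ (limn_einf (u 1%N))).
  apply: limn_einf_ge0 => n; rewrite lee_fin.
  have [p0 p1] := phi01 n (leqnn 1).
  by rewrite oppr_ge0 mulr_le0_ge0 ?invr_ge0// ln_le0.
by apply: ereal_sup_ubound; exists 1%N.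
Qed.

Let S_sub j : (1 <= j)%N -> S `<=` shrinking_target (torus_map A) (phi j) (z j).
Proof. by move=> j1 p /(_ j j1). Qed.

Let k0 : 0 < k%:R :> R. Proof. by rewrite ltr0n (k_gt0 H). Qed.

Let L0 : 0 < L := L_gt0 H.

(** Any lower bound [r] of [tau] in [[0, L]] is allowed: [r = tau] serves the subcritical case, and
    [r = L], where the bound is 0, the other two. *)
Let htop_scale_le r e : 0 <= r -> r <= L -> (r%:E <= tau_inf phi)%E -> 0 < e ->
  (htop_scale (torus_map A) S e <= (k%:R * ((L * L - r * L) / (L + r)))%:E)%E.
Proof.
move=> r0 rL rt e0; have L0' := L0; have Lr : 0 < L + r by lra.
have rE : k%:R * ((L * L - r * L) / (L + r)) = k%:R * (L - r) * L / (L + r).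
  by field; rewrite gt_eqF.
rewrite rE; apply: ereal_inf_threshold_le => [|s].
  by rewrite divr_ge0 ?(ltW Lr)// !mulr_ge0 ?(ltW L0)// subr_ge0.
rewrite ltr_pdivrMr// => /(upper_parameter_entropy k0 L0 r0 rL)[t [t1 t2 t3]].
have [j j1 [n1 h]] := tau_gt (lt_le_trans (t2 : (t%:E < r%:E)%E) rt).
exact: (bowen_upper H h (S_sub j1) e0 t1 (lt_le_trans t2 rL) t3).
Qed.

Let hausdorff_dim_le r : 0 <= r -> r <= L -> (r%:E <= tau_inf phi)%E ->
  (hausdorff_dim S <= (k%:R * ((L + L) / (L + r)))%:E)%E.
Proof.
move=> r0 rL rt; have L0' := L0; have Lr : 0 < L + r by lra.
have rE : k%:R * ((L + L) / (L + r)) = 2 * L * k%:R / (L + r).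
  by field; rewrite gt_eqF.
rewrite rE; apply: ereal_inf_threshold_le => [|s].
  by rewrite divr_ge0 ?(ltW Lr)// !mulr_ge0 ?(ltW L0).
rewrite ltr_pdivrMr// => /(upper_parameter k0 L0 r0 rL)[t [t1 t2 t3]].
have [j j1 [n1 h]] := tau_gt (lt_le_trans (t2 : (t%:E < r%:E)%E) rt).
exact: (hausdorff_upper H h (S_sub j1) t1 t3).
Qed.

Let htop_scale_ge0 e : (0 <= htop_scale (torus_map A) S e)%E.
Proof. by apply: ereal_inf_threshold_ge => s s0; rewrite ltNge s0. Qed.

Let hausdorff_dim_ge0 : (0 <= hausdorff_dim S)%E.
Proof. by apply: ereal_inf_threshold_ge => s s0; rewrite ltNge s0. Qed.

Lemma subcritical_values : (tau_inf phi < L%:E)%E ->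
  [/\ S !=set0,
      htop (torus_map A) S =
        (k%:R * ((L * L - fine (tau_inf phi) * L) / (L + fine (tau_inf phi))))%:E
    & hausdorff_dim S = (k%:R * ((L + L) / (L + fine (tau_inf phi))))%:E].
Proof.
move=> tL; have tfin : tau_inf phi \is a fin_num.
  by rewrite ge0_fin_numE// (lt_trans tL) ?ltry.
move: tL; have := tau_ge0; rewrite -(fineK tfin) lee_fin lte_fin.
have tle : ((fine (tau_inf phi))%:E <= tau_inf phi)%E by rewrite fineK.
have tlt t : fine (tau_inf phi) < t -> (tau_inf phi < t%:E)%E.
  by move=> h; rewrite -(fineK tfin) lte_fin.
set r := fine _ in tle tlt *; rewrite /= => r0 rL.
have L0' := L0; have Lr : 0 < L + r by lra.
split.
- have Lrt : r < (L + r) / 2 by lra.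
  apply: (shrinking_targets_neq0 H z (t := (L + r) / 2)); [by lra|by lra|].
  exact: tau_lt (tlt _ Lrt).
- have [Ca Ca0 hCa] := enorm_mulmx_bound (real_mx A : 'M[R]_d).
  (* Below the scale [1 / (4 Ca)] the entropy at scale [e] already has its limit value. *)
  apply: lim_near_cst => //; near=> e.
  have e0 : 0 < e by near: e; exact: nbhs_right_gt.
  have eCa : e < 1 / (4 * Ca).
    by near: e; apply: nbhs_right_lt; rewrite divr_gt0// mulr_gt0.
  apply/eqP; rewrite eq_le htop_scale_le//=; last exact: ltW.
  apply: ereal_inf_threshold_ge => s s0 sV.
  (* Division by [L] converts an entropy exponent into a dimension inside the leaf. *)
  have h : s / L * (L + r) < k%:R * (L - r).
    rewrite mulrAC ltr_pdivrMr//.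
    have rE : k%:R * ((L * L - r * L) / (L + r)) = k%:R * (L - r) * L / (L + r).
      by field; rewrite gt_eqF.
    by move: sV; rewrite rE ltr_pdivlMr.
  have sL0 : 0 <= s / L by rewrite divr_ge0// ltW.
  have [t [s' [rt tL ss' h']]] := lower_parameter k0 r0 rL sL0 h.
  have s'0 : 0 < s' by exact: le_lt_trans ss'.
  have sE : s = s / L * L by rewrite divfK// gt_eqF.
  (* Makes [s' delta] half of [L s' - s], so that [(L - delta) s'] still exceeds [s]. *)
  pose delta := L * (s' - s / L) / (2 * s').
  have dE : s' * delta = L * (s' - s / L) / 2 by rewrite /delta; field; rewrite !gt_eqF.
  have d0 : 0 < delta by rewrite divr_gt0 ?mulr_gt0// subr_gt0.
  have p1 : 0 < L * s' by rewrite mulr_gt0.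
  have p2 : 0 <= L * (s / L) by rewrite mulr_ge0// ltW.
  have p3 : 0 < L * (s' - s / L) by rewrite mulr_gt0// subr_gt0.
  have t0 : 0 <= t by exact: ltW (le_lt_trans r0 rt).
  have dL : delta < L by rewrite -(ltr_pM2l s'0) dE; lra.
  have us : s <= (L - delta) * s' by rewrite mulrBl [delta * _]mulrC dE; lra.
  exact: (bowen_lower H t0 tL (tau_lt (tlt _ rt)) s'0 h' d0 dL Ca0 hCa e0 eCa us).
apply/eqP; rewrite eq_le hausdorff_dim_le//=; last exact: ltW.
apply: ereal_inf_threshold_ge => s s0 sV.
have rE : k%:R * ((L + L) / (L + r)) = 2 * L * k%:R / (L + r).
  by field; rewrite gt_eqF.
rewrite rE ltr_pdivlMr// in sV.
(* For [s] below [k] the stable directions alone suffice, and [s1 = 0] yields some positive [s']. *)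
pose s1 := Num.max 0 (s - k%:R).
have s10 : 0 <= s1 by rewrite le_max lexx.
have h : s1 * (L + r) < k%:R * (L - r).
  rewrite /s1; have [h|h] := leP 0 (s - k%:R); last by rewrite mul0r mulr_gt0// subr_gt0.
  by lra.
have [t [s' [rt tL ss' h']]] := lower_parameter k0 r0 rL s10 h.
have s'0 : 0 < s' by exact: le_lt_trans ss'.
have t0 : 0 <= t by exact: ltW (le_lt_trans r0 rt).
apply: (hausdorff_lower H t0 tL (tau_lt (tlt _ rt)) s'0 h' s0).
by rewrite -lerBlDr ltW// (le_lt_trans _ ss')// le_max lexx orbT.
Unshelve. all: by end_near. Qed.

Lemma supercritical_entropy : (L%:E <= tau_inf phi)%E -> htop (torus_map A) S = 0%E.
Proof.
move=> Lt; apply: lim_near_cst => //; near=> e.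
have e0 : 0 < e by near: e; exact: nbhs_right_gt.
apply/eqP; rewrite eq_le htop_scale_ge0 andbT.
by have := htop_scale_le (ltW L0) (lexx L) Lt e0; rewrite subrr mul0r mulr0.
Unshelve. all: by end_near. Qed.

Lemma critical_dimension : (L%:E <= tau_inf phi)%E -> (hausdorff_dim S <= k%:R%:E)%E.
Proof.
move=> Lt; have := hausdorff_dim_le (ltW L0) (lexx L) Lt.
by rewrite divff ?mulr1// gt_eqF// addr_gt0.
Qed.

Lemma supercritical_dimension : (L%:E < tau_inf phi)%E -> hausdorff_dim S = 0%E.
Proof.
move=> Lt; apply/eqP; rewrite eq_le hausdorff_dim_ge0 andbT.
(* [tau] may be infinite, so the real number between [L] and [tau] is found by cases. *)
have [t Lt' tt] : exists2 t, L < t & (t%:E < tau_inf phi)%E.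
  move: Lt; case: (tau_inf phi) => [r| |]//.
    by rewrite lte_fin => Lr; exists ((L + r) / 2); rewrite ?lte_fin; lra.
  by move=> _; exists (L + 1); rewrite ?ltry ?ltrDl.
have [j j1 [n1 h]] := tau_gt tt.
apply: ereal_inf_threshold_le => // s s0.
exact: (hausdorff_upper0 H h (S_sub j1) s0 Lt').
Qed.

End main.

Theorem theorem1p11 (R : realType) (d : nat) (A : 'M[int]_d)
  (detA : \det A = 1)
  (hypA : hyperbolic_mx R A)
  (ls lu : R[i])
  (eigA : forall mu : R[i], eigenvalue (complex_mx A) mu <-> mu = ls \/ mu = lu)
  (ls_gt0 : 0 < Normc.normc ls) (ls_lt1 : Normc.normc ls < 1)
  (lu_gt1 : 1 < Normc.normc lu)
  (phi : nat -> nat -> R)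
  (phi01 : forall j n : nat, (1 <= j)%N -> 0 < phi j n /\ phi j n <= 1)
  (z : nat -> nat -> torus R d) :
  let S : set (torus R d) :=
    \bigcap_(j in [set j | (1 <= j)%N])
      shrinking_target (torus_map A) (phi j) (z j) in
  let ds : R := (alg_multiplicity A ls)%:R in
  let tau : \bar R := tau_inf phi in
  let Ls : R := ln (Normc.normc ls) in
  let Lu : R := ln (Normc.normc lu) in
  [/\ (tau < (- Ls)%:E)%E ->
        [/\ S !=set0,
            htop (torus_map A) S =
              (ds * ((ln (Normc.normc ls)^-1 * Lu - fine tau * Lu)
                     / (Lu + fine tau)))%:E
          & hausdorff_dim S =
              (ds * ((ln (Normc.normc ls)^-1 + Lu) / (Lu + fine tau)))%:E],
      tau = (- Ls)%:E ->
        htop (torus_map A) S = 0%:E /\ (hausdorff_dim S <= ds%:E)%E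
    & ((- Ls)%:E < tau)%E ->
        htop (torus_map A) S = 0%:E /\ hausdorff_dim S = 0%:E].
Proof.
move=> S ds tau Ls Lu.
have [lsE [H _]] := hyperbolic_splitting_exists detA eigA ls_gt0 ls_lt1 lu_gt1.
(* The moduli are inverse to each other, so both rates equal the [L] of the splitting and the stated
   formulas become those in [L] and [tau]. *)
have LsE : - Ls = Lu by rewrite /Ls lsE opprK.
rewrite (lnV ls_gt0 : ln (Normc.normc ls)^-1 = - Ls) LsE; split.
- exact: (subcritical_values H z phi01).
- move=> tE; have h : (Lu%:E <= tau)%E by rewrite tE.
  split; first exact: (supercritical_entropy H z phi01 h).
  exact: (critical_dimension H z phi01 h).
- move=> h; split; first exact: (supercritical_entropy H z phi01 (ltW h)).
  exact: (supercritical_dimension H z phi01 h).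
Qed.
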